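(* Let $n\ge k\ge 1$. Then: (a) The length of the $R_n$-module $(\operatorname{Ind}^{R_n}_{R_{n-1}}\circ\operatorname{Res}^{R_n}_{R_{n-1}})^k(\mathbb{C}_{\mathrm{triv}})$ equals $\sum_{\mu}g_k(\mu)$. (b) The dimension of $(\operatorname{Ind}^{R_n}_{R_{n-1}}\circ\operatorname{Res}^{R_n}_{R_{n-1}})^k(\mathbb{C}_{\mathrm{triv}})$ equals $\sum_{\mu}g_k(\mu)f^\mu\binom{n}{|\mu|}$. Here both sums run over all partitions $\mu$ of all non-negative integers ($g_k(\mu)=0$ unless $|\mu|\le k$).
   Context: $R_n$ is the rook monoid of $n\times n$ matrices with entries in $\{0,1\}$ with at most one $1$ in each row and column; $R_{n-1}$ embeds in $R_n$ via $A\mapsto\begin{pmatrix}A&0\\0&1\end{pmatrix}$ ($R_0$ is the one-element monoid). $\operatorname{Res}$ is restriction along this embedding, $\operatorname{Ind}=\mathbb{C}[R_n]\otimes_{\mathbb{C}[R_{n-1}]}(-)$, and $\mathbb{C}_{\mathrm{triv}}$ is the one-dimensional module on which all elements of $R_n$ act as the identity. $f^\mu$ is the number of standard Young tableaux of shape $\mu$. Young's lattice $\mathbf{Y}$ is the graph on all partitions of non-negative integers in which $\lambda\vdash m$ and $\mu\vdash m+1$ are adjacent iff $\lambda$ is obtained from $\mu$ by removing a removable node. A simplified vacillating tableau of shape $\mu$ and semi-length $k$ is a walk with $2k$ steps on $\mathbf{Y}$ that starts at $\varnothing$ and ends at $\mu$, such that at each odd step one either does nothing or removes a removable node, and at each even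 step one either does nothing or inserts an insertable node. $g_k(\mu)$ is the number of simplified vacillating tableaux of shape $\mu$ and semi-length $k$. *)

(* Defs.v *)
From HB Require Import structures.
From mathcomp Require Import all_boot all_order all_algebra.
From mathcomp Require Import finmap classical_sets functions cardinality fsbigop.
From mathcomp Require Import reals complex.

Set Implicit Arguments.
Unset Strict Implicit.
Unset Printing Implicit Defensive.
Import GRing.Theory.

Local Open Scope ring_scope.

#[short(type="finMonoidType")]
HB.structure Definition FinMonoid := {G of Monoid G & Finite G}.

(* Quotient of a finite-dimensional vector space V by a subspace U, realised  *)
(* on a complement of U; [quot_proj U] is onto, with kernel U.                *)
Section Quotient.
Variables (F : fieldType) (V : vectType F) (U : {vspace V}).

Definition quot_space := subvs_of (U^C)%VS.

HB.instance Definition _ := Vector.on quot_space.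

Definition quot_proj : 'Hom(V, quot_space) :=
  (linfun (vsproj (U^C)%VS) \o daddv_pi (U^C)%VS U)%VF.

Definition quot_lift : 'Hom(quot_space, V) := linfun (@vsval F V (U^C)%VS).

Lemma quot_liftK w : quot_proj (quot_lift w) = w.
Proof.
rewrite comp_lfunE !lfunE /= daddv_pi_id ?subvsP //; last first.
  by rewrite capvC capv_compl.
by rewrite vsvalK.
Qed.

Lemma quot_projK v : v - quot_lift (quot_proj v) \in U.
Proof.
rewrite comp_lfunE !lfunE /= vsprojK ?memv_pi //.
have cap0 : (U^C :&: U = 0)%VS by rewrite capvC capv_compl.
rewrite -[X in X - _](@daddv_pi_add _ _ (U^C)%VS U) //; last first.
  by rewrite addvC addv_complf memvf.
by rewrite addrC addKr memv_pi.
Qed.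

Lemma quot_proj_eq0 v : (quot_proj v == 0) = (v \in U).
Proof.
apply/eqP/idP => [v0|vU]; first by move: (quot_projK v); rewrite v0 linear0 subr0.
rewrite -(quot_liftK (quot_proj v)); have := quot_projK v.
set w := quot_lift _ => /(rpredB vU); rewrite opprB addrC subrK => wU.
rewrite (_ : w = 0) ?linear0 //; apply/eqP; rewrite -memv0 -(capv_compl U).
by rewrite memv_cap wU /w lfunE subvsP.
Qed.

Lemma quot_proj_eq u v : u - v \in U -> quot_proj u = quot_proj v.
Proof.
by rewrite -quot_proj_eq0 linearB subr_eq0 => /eqP.
Qed.

End Quotient.

(* A finite-dimensional left F[M]-module, given as an F-space on which the    *)
(* monoid M acts by linear maps.                                              *)
Record fmodule (F : fieldType) (M : monoidType) := FModule {
  fmod_sort :> vectType F;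
  act : M -> 'End(fmod_sort);
  act1 : act 1%g = \1%VF;
  actM : forall x y : M, act (x * y)%g = (act x \o act y)%VF }.

Section Modules.
Variables (F : fieldType) (M : monoidType).

Lemma triv_mul (x y : M) : (\1 = \1 \o \1 :> 'End(F^o))%VF.
Proof. by rewrite comp_lfun1l. Qed.

Definition triv_module : fmodule F M :=
  @FModule F M F^o (fun=> \1%VF) erefl triv_mul.

Variable V : fmodule F M.

Definition fmod_dim : nat := \dim {:V}.

Definition is_submodule (U : {vspace V}) : Prop :=
  forall x : M, (act V x @: U <= U)%VS.

Definition is_maximal_submodule (U W : {vspace V}) : Prop :=
  [/\ is_submodule U, is_submodule W, (U <= W)%VS, U != W &
      forall X : {vspace V}, is_submodule X -> (U <= X)%VS -> (X <= W)%VS ->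
        X = U \/ X = W].

(* U is a composition series with l factors. *)
Definition has_length (l : nat) : Prop :=
  exists U : nat -> {vspace V},
    [/\ U 0%N = 0%VS, U l = fullv &
        forall i, (i < l)%N -> is_maximal_submodule (U i) (U i.+1)].

End Modules.

Section Restriction.
Variables (F : fieldType) (H G : monoidType).
Variable phi : UMagmaMorphism.type H G.
Variable V : fmodule F G.

Lemma res1 : act V (phi 1%g) = \1%VF.
Proof. by rewrite gmulf1 act1. Qed.

Lemma resM (a b : H) : act V (phi (a * b)%g) = (act V (phi a) \o act V (phi b))%VF.
Proof. by rewrite gmulfM actM. Qed.

Definition Res : fmodule F H := FModule res1 resM.

End Restriction.

(* F[G] (x)_{F[H]} V, with F[H] acting on F[G] on the right through phi.  As  *)
(* F[G] has basis G, the space F[G] (x)_F V is {ffun G -> V}, with x (x) v    *)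
(* being the function supported at x with value v; one then divides by the    *)
(* span of the (x * phi a) (x) v - x (x) (a . v).                             *)
Section Induction.
Variables (F : fieldType) (H G : finMonoidType).
Variable phi : UMagmaMorphism.type H G.
Variable V : fmodule F H.

Local Notation T := {ffun G -> V}.

Definition tens (x : G) (v : V) : T := [ffun y => if y == x then v else 0].

Lemma tens_is_linear x : linear (tens x).
Proof.
move=> c u v; apply/ffunP => y; rewrite !ffunE.
by case: eqP => // _; rewrite scaler0 addr0.
Qed.

HB.instance Definition _ x :=
  GRing.isSemilinear.Build F V T _ (tens x) (GRing.semilinear_linear (tens_is_linear x)).

Lemma tens_sum (t : T) : t = \sum_x tens x (t x).
Proof.
apply/ffunP => y; rewrite sum_ffunE (bigD1 y) //= ffunE eqxx big1 ?addr0 //.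
by move=> x /negbTE xy; rewrite ffunE eq_sym xy.
Qed.

Definition balance (x : G) (a : H) (v : V) : T :=
  tens (x * phi a)%g v - tens x (act V a v).

Lemma balance_is_linear x a : linear (balance x a).
Proof.
move=> c u v; rewrite /balance (linearP (act V a)) !(linearP (tens _)) /=.
by rewrite scalerBr opprD addrACA.
Qed.

HB.instance Definition _ x a :=
  GRing.isSemilinear.Build F V T _ (balance x a)
    (GRing.semilinear_linear (balance_is_linear x a)).

Definition balance_space : {vspace T} :=
  (\sum_(x : G) \sum_(a : H) limg (linfun (balance x a)))%VS.

Lemma mem_balance x a v : balance x a v \in balance_space.
Proof.
rewrite memvE; apply: subv_trans (sumv_sup x _ (subvv _)) => //.
apply: subv_trans (sumv_sup a _ (subvv _)) => //.
by rewrite -memvE -[balance x a v]lfunE memv_img ?memvf.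
Qed.

Definition lmul (g : G) (t : T) : T := \sum_x tens (g * x)%g (t x).

Lemma lmul_is_linear g : linear (lmul g).
Proof.
move=> c u v; rewrite /lmul scaler_sumr -big_split /=.
by apply: eq_bigr => x _; rewrite !ffunE linearP.
Qed.

HB.instance Definition _ g :=
  GRing.isSemilinear.Build F T T _ (lmul g)
    (GRing.semilinear_linear (lmul_is_linear g)).

Lemma lmul_tens g x v : lmul g (tens x v) = tens (g * x)%g v.
Proof.
rewrite /lmul (bigD1 x) //= ffunE eqxx big1 ?addr0 // => y /negbTE yx.
by rewrite ffunE yx linear0.
Qed.

Lemma lmul1 t : lmul 1%g t = t.
Proof. by rewrite [RHS]tens_sum; apply: eq_bigr => x _; rewrite mul1g. Qed.

Lemma lmulM g h t : lmul (g * h)%g t = lmul g (lmul h t).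
Proof.
rewrite [lmul h t]/lmul linear_sum /=.
by apply: eq_bigr => x _; rewrite lmul_tens mulgA.
Qed.

Lemma lmul_balance g t : t \in balance_space -> lmul g t \in balance_space.
Proof.
case/memv_sumP => f fB ->; rewrite linear_sum rpred_sum // => x _.
case/memv_sumP: (fB x isT) => h hB ->; rewrite linear_sum rpred_sum // => a _.
case/memv_imgP: (hB a isT) => v _ ->; rewrite lfunE /= /balance linearB /=.
by rewrite !lmul_tens mulgA mem_balance.
Qed.

Local Notation Q := (quot_space balance_space).

Definition ind_act (g : G) : 'End(Q) :=
  (quot_proj balance_space \o linfun (lmul g) \o quot_lift balance_space)%VF.

Lemma ind_act_proj g t :
  ind_act g (quot_proj balance_space t) = quot_proj balance_space (lmul g t).
Proof.
rewrite /ind_act 2!comp_lfunE; apply/esym/quot_proj_eq.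
by rewrite lfunE /= -(linearB (lmul g)) lmul_balance ?quot_projK.
Qed.

Lemma ind1 : ind_act 1%g = \1%VF.
Proof.
apply/lfunP => w; rewrite -(quot_liftK w) ind_act_proj lmul1.
by rewrite id_lfunE.
Qed.

Lemma indM g h : ind_act (g * h)%g = (ind_act g \o ind_act h)%VF.
Proof.
apply/lfunP => w; rewrite -(quot_liftK w) comp_lfunE !ind_act_proj.
by rewrite lmulM.
Qed.

Definition Ind : fmodule F G := FModule ind1 indM.

End Induction.

Definition is_rook n (A : 'M[nat]_n) : bool :=
  [&& [forall i, forall j, (A i j <= 1)%N],
      [forall i, (\sum_j A i j <= 1)%N] &
      [forall j, (\sum_i A i j <= 1)%N]].

Record rook (n : nat) := Rook { rook_mx :> 'M[nat]_n; rookP : is_rook rook_mx }.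

Section RookMonoid.
Variable n : nat.

HB.instance Definition _ := [isSub for @rook_mx n].
HB.instance Definition _ := [Countable of rook n by <:].

Definition rook_code (A : rook n) : 'M[bool]_n := map_mx (fun a => a != 0%N) A.

Definition rook_decode (B : 'M[bool]_n) : option (rook n) :=
  insub (map_mx nat_of_bool B).

Lemma rook_codeK : pcancel rook_code rook_decode.
Proof.
move=> A; rewrite /rook_decode (_ : map_mx _ _ = A) ?valK //.
apply/matrixP => i j; rewrite !mxE.
by case/and3P: (rookP A) => /forallP/(_ i)/forallP/(_ j); case: (A i j) => [|[]].
Qed.

HB.instance Definition _ : isFinite (rook n) := PCanIsFinite rook_codeK.

Lemma is_rook1 : is_rook (1%:M : 'M[nat]_n).
Proof.
apply/and3P; split; apply/forallP => i.
- by apply/forallP => j; rewrite mxE; case: eqP.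
- rewrite (bigD1 i) //= mxE eqxx big1 // => j /negbTE ji.
  by rewrite mxE eq_sym ji.
rewrite (bigD1 i) //= mxE eqxx big1 // => j /negbTE ji.
by rewrite mxE ji.
Qed.

Lemma is_rookM (A B : rook n) : is_rook (rook_mx A *m rook_mx B).
Proof.
case/and3P: (rookP A) => _ /forallP rA /forallP cA.
case/and3P: (rookP B) => _ /forallP rB /forallP cB.
have rAB i : (\sum_j (rook_mx A *m rook_mx B) i j <= 1)%N.
  apply: leq_trans (rA i); under eq_bigr do rewrite mxE.
  rewrite exchange_big /=; apply: leq_sum => k _.
  by rewrite -big_distrr /= -[leqRHS]muln1 leq_mul.
have cAB j : (\sum_i (rook_mx A *m rook_mx B) i j <= 1)%N.
  apply: leq_trans (cB j); under eq_bigr do rewrite mxE.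
  rewrite exchange_big /=; apply: leq_sum => k _.
  by rewrite -big_distrl /= -[leqRHS]mul1n leq_mul.
apply/and3P; split; apply/forallP => // i; apply/forallP => j.
by apply: leq_trans (rAB i); rewrite (bigD1 j) //= leq_addr.
Qed.

Definition rook_one : rook n := Rook is_rook1.
Definition rook_mul (A B : rook n) : rook n := Rook (is_rookM A B).

Lemma rook_mulA : associative rook_mul.
Proof. by move=> A B C; apply/val_inj/mulmxA. Qed.

Lemma rook_mul1 : left_id rook_one rook_mul.
Proof. by move=> A; apply/val_inj/mul1mx. Qed.

Lemma rook_mulr1 : right_id rook_one rook_mul.
Proof. by move=> A; apply/val_inj/mulmx1. Qed.

HB.instance Definition _ := isMonoid.Build (rook n) rook_mulA rook_mul1 rook_mulr1.

End RookMonoid.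

Section RookEmbedding.
Variable n : nat.

Lemma is_rook_emb (A : rook n) : is_rook (block_mx A 0 0 1%:M : 'M[nat]_(n + 1)).
Proof.
case/and3P: (rookP A) => /forallP eA /forallP rA /forallP cA.
apply/and3P; split; apply/forallP => i.
- apply/forallP => j; case: (split_ordP i) => {}i ->; case: (split_ordP j) => {}j ->.
  + by rewrite block_mxEul; have /forallP := eA i; exact.
  + by rewrite block_mxEur mxE.
  + by rewrite block_mxEdl mxE.
  + by rewrite block_mxEdr mxE; case: eqP.
- rewrite big_split_ord /=; case: (split_ordP i) => {}i ->.
  + under eq_bigr do rewrite block_mxEul.
    under [X in (_ + X)%N]eq_bigr do rewrite block_mxEur mxE.
    by rewrite big1_eq addn0.
  + under eq_bigr do rewrite block_mxEdl mxE.
    under [X in (_ + X)%N]eq_bigr do rewrite block_mxEdr mxE.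
    by rewrite big1_eq add0n big_ord1; case: eqP.
rewrite big_split_ord /=; case: (split_ordP i) => {}i ->.
+ under eq_bigr do rewrite block_mxEul.
  under [X in (_ + X)%N]eq_bigr do rewrite block_mxEdl mxE.
  by rewrite big1_eq addn0.
+ under eq_bigr do rewrite block_mxEur mxE.
  under [X in (_ + X)%N]eq_bigr do rewrite block_mxEdr mxE.
  by rewrite big1_eq add0n big_ord1; case: eqP.
Qed.

Definition rook_emb (A : rook n) : rook (n + 1) := Rook (is_rook_emb A).

Lemma rook_emb_monoid : monoid.monoid_morphism rook_emb.
Proof.
split=> [|A B]; apply/val_inj => /=; first by rewrite -scalar_mx_block.
by rewrite mulmx_block !mulmx0 !mul0mx !addr0 !add0r mulmx1.
Qed.

HB.instance Definition _ := isUMagmaMorphism.Build _ _ rook_emb rook_emb_monoid.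

End RookEmbedding.

Definition IndRes (F : fieldType) (n : nat) (V : fmodule F (rook (n + 1))) :
    fmodule F (rook (n + 1)) :=
  Ind (rook_emb (n := n)) (Res (rook_emb (n := n)) V).

Local Open Scope nat_scope.

Record intpart := IntPart {
  parts :> seq nat;
  partsP : sorted geq parts && (0 \notin parts) }.

HB.instance Definition _ := [isSub for parts].
HB.instance Definition _ := [Countable of intpart by <:].

Definition part0 : intpart := @IntPart [::] isT.

Definition part_size (mu : intpart) : nat := sumn mu.

(* Nodes are pairs (row, column), counted from 0. *)
Definition node (mu : intpart) (c : nat * nat) : bool := c.2 < nth 0 mu c.1.

Definition removable (mu : intpart) (c : nat * nat) : bool :=
  [&& node mu c, ~~ node mu (c.1.+1, c.2) & ~~ node mu (c.1, c.2.+1)].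

Definition young_cover (lam mu : intpart) : Prop :=
  exists2 c, removable mu c & forall d, node lam d = node mu d && (d != c).

(* v is the list of the 2k+1 vertices of the walk, starting with v 0; for     *)
(* i < k, steps 2i+1 and 2i+2 are the (i+1)-st odd and even steps.            *)
Definition is_svt (k : nat) (mu : intpart) (w : (k.*2.+1).-tuple intpart) : Prop :=
  let v := nth part0 w in
  [/\ v 0 = part0, v k.*2 = mu &
      forall i, i < k ->
        (v i.*2.+1 = v i.*2 \/ young_cover (v i.*2.+1) (v i.*2)) /\
        (v i.*2.+2 = v i.*2.+1 \/ young_cover (v i.*2.+1) (v i.*2.+2))].

(* [#|` fset_set A|] is the cardinality of A when A is finite. *)
Definition num_svt (k : nat) (mu : intpart) : nat :=
  #|` fset_set [set w : (k.*2.+1).-tuple intpart | is_svt mu w]%classic|.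

(* A tableau is the list of its rows, filled with 1, ..., |mu|. *)
Definition is_syt (mu : intpart) (t : seq (seq nat)) : Prop :=
  [/\ shape t = mu,
      perm_eq (flatten t) (iota 1 (part_size mu)),
      forall i j, node mu (i, j.+1) ->
        nth 0 (nth [::] t i) j < nth 0 (nth [::] t i) j.+1 &
      forall i j, node mu (i.+1, j) ->
        nth 0 (nth [::] t i) j < nth 0 (nth [::] t i.+1) j].

Definition num_syt (mu : intpart) : nat :=
  #|` fset_set [set t | is_syt mu t]%classic|.

(* Main.v *)
Require Import Defs.
From HB Require Import structures.
From mathcomp Require Import all_boot all_order all_algebra.
From mathcomp Require Import finmap classical_sets functions cardinality fsbigop.
From mathcomp Require Import reals complex.
From mathcomp Require Import boolp zify fintype finset fingroup perm.

(** Write N = n + 1, let R_N be the rook monoid and w the last index, which the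
embedded R_{N-1} fixes.  Let Z_m be the left ideal of rook matrices with no
entry outside the first m columns, on which R_N acts by left multiplication.

The trivial module is the span of the one-point set Z_0.  As a set with an
action of R_{N-1}, Z_m is the disjoint union of the sets {t in Z_m | t sends q
to w} for q < m and of {t in Z_{m+1} | t sends m to w}: if w is not in the
image of t, let t send m to w.  As long as m < N, inducing {t in Z_r | t sends
q to w} to R_N gives Z_r, through (g, t) |-> g t.  So Ind Res C[Z_m] is the
span of Z_{m+1} and of m copies of Z_m, and (Ind Res)^k of the trivial module
is spanned by S(k, m) copies of Z_m for each m, where S(k, m) is a Stirling
number of the second kind; [stirsum k f] is the sum over m of S(k, m) f(m).
This is [iter_perm_basis].

Filtering C[Z_m] by the domain S of its elements gives one layer for each
subset S of the first m columns, of dimension N (N - 1) ... (N - |S| + 1).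
The layer is a free right module over C[Sym S], and each minimal idempotent e
of C[Sym S] cuts out a simple subquotient.  Hence the layer has as many
composition factors as there are idempotents in a decomposition of 1 into
orthogonal minimal idempotents of C[Sym S].  That number is the number of
involutions of S, identity included ([sym_orth_decomp]): decompose 1 along a
chain of symmetric groups, adding one point at a time.  Every permutation is
conjugate to its inverse by a permutation fixing a given point, so the
anti-automorphism tau : g |-> g^-1 fixes eAe pointwise when A is the group
algebra of one group of the chain and e is a minimal idempotent of the previous
one; then eAe is commutative, and it splits further into tau-fixed idempotents.
Finally a Frobenius-Schur count gives the number of idempotents as the trace of
tau.

On the combinatorial side, let D and U be the operators on functions of
partitions that sum over the partitions obtained by removing, respectively
adding, one node.  They satisfy UD - DU = 1.  With delta the indicator of the
empty partition, D^r delta gives the numbers of standard tableaux of size r,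
and U D^r delta = r D^{r-1} delta.  The number of simplified vacillating
tableaux is ((1 + D)(1 + U))^k delta, and (1 + D)(1 + U) maps (1 + D)^m delta to
(1 + D)^{m+1} delta + m (1 + D)^m delta: this is the recursion satisfied by the
sets Z_m ([svt_count_stirsum]).  Both claims are thus reduced to
sum f^mu = number of involutions and sum (f^mu)^2 = r!, over the partitions mu
of r, and both of these follow from the commutation relation. *)

Set Implicit Arguments.
Unset Strict Implicit.
Unset Printing Implicit Defensive.
Import GRing.Theory Num.Theory.

Local Open Scope nat_scope.

(** * Adding and removing nodes of a partition *)
Section YoungLattice.

Implicit Types (la mu nu : intpart) (i j : nat).

(** Rows are counted from 0; row [size la] is empty, and it is always addable:
a new row may be started. *)
Definition addable la i : bool := (i == 0) || (nth 0 la i < nth 0 la i.-1).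
Definition rembl mu i : bool := nth 0 mu i.+1 < nth 0 mu i.

Lemma sorted_geq_nth (s : seq nat) :
  (forall i, nth 0 s i.+1 <= nth 0 s i) -> sorted geq s.
Proof.
case: s => //= x s H; apply/(pathP 0) => i lti.
by have := H i.
Qed.

Lemma nth_part_anti mu i : nth 0 mu i.+1 <= nth 0 mu i.
Proof.
case: mu => s /= /andP[ss _].
have [lti|] := ltnP i.+1 (size s); last by move=> /(nth_default 0) ->.
by case: s ss lti => //= x s /(pathP 0) /(_ i) H lti; apply: H.
Qed.

Lemma nth_part_gt0 mu i : (0 < nth 0 mu i) = (i < size mu).
Proof.
have [lti|/(nth_default 0)->//] := ltnP i (size mu).
case: mu lti => s /= /andP[_ s0] lti; rewrite lt0n.
by apply: contra s0 => /eqP<-; apply: mem_nth.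
Qed.

Lemma intpart_ext la mu : (forall i, nth 0 la i = nth 0 mu i) -> la = mu.
Proof.
move=> eqn; apply/val_inj/(@eq_from_nth _ 0) => //=.
have H a : (a < size la) = (a < size mu) by rewrite -!nth_part_gt0 eqn.
have := H (size la); have := H (size mu); rewrite !ltnn; lia.
Qed.

Lemma addable_leq_size la i : addable la i -> i <= size la.
Proof.
case: i => //= i; rewrite /addable /= => lti.
by rewrite -nth_part_gt0; apply: leq_ltn_trans lti.
Qed.

Lemma rembl_lt_size mu i : rembl mu i -> i < size mu.
Proof. by rewrite -nth_part_gt0; apply: leq_ltn_trans. Qed.

Definition addbox la i : intpart := insubd la (incr_nth la i).

Lemma val_addbox la i : addable la i -> addbox la i = incr_nth la i :> seq nat.
Proof.
move=> ai; rewrite insubdK //; apply/andP; split.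
  apply: sorted_geq_nth => j; rewrite !nth_incr_nth.
  have := nth_part_anti la j; move: ai; rewrite /addable.
  by have [->|_] := eqVneq i j.+1; [rewrite gtn_eqF //=|have [->|_] := eqVneq i j]; lia.
apply/negP => /(nthP 0)[j ltj]; rewrite nth_incr_nth.
move: ltj; rewrite size_incr_nth; have := nth_part_gt0 la j.
have := addable_leq_size ai.
have [|] := eqVneq i j; have [|] := ltnP i (size la); lia.
Qed.

Lemma nth_addbox la i j : addable la i ->
  nth 0 (addbox la i) j = nth 0 la j + (i == j).
Proof. by move=> ai; rewrite val_addbox // nth_incr_nth addnC. Qed.

(** Filtering out zeros deletes the last row when its only node is removed. *)
Definition rembox mu i : intpart :=
  insubd mu [seq x <- set_nth 0 mu i (nth 0 mu i).-1 | x != 0].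

Lemma nth_filter_nz (s : seq nat) j : sorted geq s ->
  nth 0 [seq x <- s | x != 0] j = nth 0 s j.
Proof.
elim: s j => [|x s IH] j; first by rewrite nth_nil.
move=> xs; have ss := path_sorted xs; rewrite /=.
have [x0|nx0] /= := eqVneq x 0; last by case: j => //= j; rewrite IH.
have s0 : s = nseq (size s) 0.
  apply/all_pred1P; apply/allP => y ys; have := order_path_min _ xs.
  move=> /(_ (rev_trans leq_trans)) /allP /(_ y ys) /=; rewrite x0; lia.
by rewrite IH // s0; case: j => [|j] /=; rewrite ?nth_nseq ?if_same ?x0.
Qed.

Lemma nth_rembox mu i j : rembl mu i ->
  nth 0 (rembox mu i) j = nth 0 mu j - (i == j).
Proof.
move=> ri; have ss : sorted geq (set_nth 0 mu i (nth 0 mu i).-1).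
  apply: sorted_geq_nth => k; rewrite !nth_set_nth /=.
  have := nth_part_anti mu k; move: ri; rewrite /rembl.
  by have [->|_] := eqVneq k i; [rewrite gtn_eqF //=|have [<-|_] := eqVneq k.+1 i; rewrite /=]; lia.
rewrite insubdK; last first.
  rewrite unfold_in; apply/andP; split; last by rewrite mem_filter.
  by apply: sorted_filter => //; apply: (rev_trans leq_trans).
by rewrite nth_filter_nz // nth_set_nth /= eq_sym; case: eqP => [->|]; lia.
Qed.

Lemma rembl_addbox la i : addable la i -> rembl (addbox la i) i.
Proof.
move=> ai; rewrite /rembl !nth_addbox // eqxx.
by have := nth_part_anti la i; have [|] := eqVneq i i.+1; lia.
Qed.

Lemma addable_rembox mu i : rembl mu i -> addable (rembox mu i) i.
Proof.
move=> ri; rewrite /addable !nth_rembox // eqxx.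
case: i ri => //= i; rewrite /rembl => ri.
by have := nth_part_anti mu i; have [|] := eqVneq i.+1 i; lia.
Qed.

Lemma addboxK la i : addable la i -> rembox (addbox la i) i = la.
Proof.
move=> ai; apply: intpart_ext => j.
by rewrite nth_rembox ?rembl_addbox // nth_addbox // addnK.
Qed.

Lemma remboxK mu i : rembl mu i -> addbox (rembox mu i) i = mu.
Proof.
move=> ri; apply: intpart_ext => j.
rewrite nth_addbox ?addable_rembox // nth_rembox // subnK //.
by case: eqP => // <-; apply: leq_ltn_trans ri.
Qed.

Lemma sumn_incr_nth (s : seq nat) i : sumn (incr_nth s i) = (sumn s).+1.
Proof.
elim: s i => [|x s IH] [|i] //=; last by rewrite IH addnS.
by rewrite sumn_ncons mul0n.
Qed.

Lemma part_size_addbox la i : addable la i -> part_size (addbox la i) = (part_size la).+1.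
Proof. by move=> ai; rewrite /part_size val_addbox // sumn_incr_nth. Qed.

Lemma part_size_rembox mu i : rembl mu i -> part_size mu = (part_size (rembox mu i)).+1.
Proof. by move=> ri; rewrite -{1}(remboxK ri) part_size_addbox // addable_rembox. Qed.

Lemma addbox_inj la i j : addable la i -> addable la j ->
  addbox la i = addbox la j -> i = j.
Proof.
by move=> ai aj /(congr1 val); rewrite /= !val_addbox // => /incr_nth_inj.
Qed.

Lemma rembox_inj mu i j : rembl mu i -> rembl mu j ->
  rembox mu i = rembox mu j -> i = j.
Proof.
move=> ri rj eq_r; have := nth_rembox i ri; rewrite eq_r nth_rembox // eqxx.
by move: ri; rewrite /rembl; have [|] := eqVneq j i; lia.
Qed.

Lemma young_coverP la mu :
  young_cover la mu <-> exists2 i, rembl mu i & la = rembox mu i.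
Proof.
split=> [[[i j]]|[i ri ->]].
  rewrite /removable /node /= -!leqNgt => /and3P[ji ij1 ij2] H.
  have nthi : nth 0 mu i = j.+1 by lia.
  have ri : rembl mu i by rewrite /rembl nthi; lia.
  exists i => //; apply: intpart_ext => k; rewrite nth_rembox //.
  have lt_eq a : (a < nth 0 la k) = (a < nth 0 mu k - (i == k)).
    have := H (k, a); rewrite /node /= => ->; rewrite xpair_eqE.
    by have [->|_] := eqVneq k i; rewrite /= ?eqxx ?nthi; lia.
  have := lt_eq (nth 0 la k); have := lt_eq (nth 0 mu k - (i == k)).
  rewrite !ltnn; lia.
exists (i, (nth 0 mu i).-1) => [|[a b]].
  by move: ri; rewrite /removable /node /rembl /=; lia.
rewrite /node /= nth_rembox // xpair_eqE; move: ri; rewrite /rembl.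
by have [->|_] := eqVneq a i; rewrite /= ?eqxx; lia.
Qed.

Lemma young_coverP_add la mu :
  young_cover la mu <-> exists2 i, addable la i & mu = addbox la i.
Proof.
rewrite young_coverP; split=> [[i ri ->]|[i ai ->]]; exists i.
- exact: addable_rembox.
- by rewrite remboxK.
- exact: rembl_addbox.
- by rewrite addboxK.
Qed.

(** * Down and up operators on functions of partitions *)
Definition dn (phi : intpart -> nat) mu : nat :=
  \sum_(i < size mu | rembl mu i) phi (rembox mu i).
Definition up (phi : intpart -> nat) la : nat :=
  \sum_(i < (size la).+1 | addable la i) phi (addbox la i).

Lemma dnE L phi mu : size mu <= L ->
  dn phi mu = \sum_(i < L | rembl mu i) phi (rembox mu i).
Proof.
move=> leL; rewrite /dn (big_ord_widen_cond L (rembl mu) (fun i => phi (rembox mu i))) //.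
apply: eq_bigl => i; case ri: (rembl mu i) => //=; exact: rembl_lt_size.
Qed.

Lemma upE L phi la : size la < L ->
  up phi la = \sum_(i < L | addable la i) phi (addbox la i).
Proof.
move=> ltL; rewrite /up (big_ord_widen_cond L (addable la) (fun i => phi (addbox la i))) //.
apply: eq_bigl => i; case ai: (addable la i) => //=; exact: addable_leq_size.
Qed.

Lemma size_addbox_leq la i : addable la i -> size (addbox la i) <= (size la).+1.
Proof.
move=> ai; rewrite val_addbox // size_incr_nth.
have := addable_leq_size ai; case: ltnP; lia.
Qed.

Lemma size_rembox_leq mu i : rembl mu i -> size (rembox mu i) <= size mu.
Proof.
move=> ri; rewrite leqNgt -nth_part_gt0 nth_rembox // nth_default //.
Qed.

(** Adding in row i and removing from another row j involve the same two
inequalities between consecutive rows in either order. *)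
Lemma rembl_add_comm la i j : i != j ->
  (addable la i && rembl (addbox la i) j) =
  (rembl la j && addable (rembox la j) i).
Proof.
move=> nij; case ai: (addable la i); case rj: (rembl la j) => //=.
- rewrite /rembl /addable !nth_addbox ?nth_rembox //.
  move: ai rj; rewrite /rembl /addable; case: i nij => [|i] nij /=.
    by rewrite (negbTE nij); case: j nij => //= j _; lia.
  rewrite (negbTE nij) [j == i.+1]eq_sym (negbTE nij) eqSS.
  by have [->|] := eqVneq i j; rewrite ?eqxx; lia.
- apply/negP; rewrite /rembl !nth_addbox // (negbTE nij).
  by move: rj; rewrite /rembl; have [|] := eqVneq i j.+1; lia.
- apply/esym/negP => ari; move: ai ari; rewrite /addable !nth_rembox //.
  by case: i nij => // i nij /=; rewrite [j == _]eq_sym (negbTE nij); lia.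
Qed.

Lemma add_rem_comm la i j : i != j -> addable la i -> rembl (addbox la i) j ->
  rembox (addbox la i) j = addbox (rembox la j) i.
Proof.
move=> nij ai rj; have := rembl_add_comm la nij; rewrite ai rj /=.
move=> /esym/andP[rj' ai']; apply: intpart_ext => k.
rewrite nth_rembox // !nth_addbox // nth_rembox //.
by have [ik|_] := eqVneq i k; have [jk|_] := eqVneq j k; lia.
Qed.

(** Young's lattice is a differential poset.  Off the diagonal, adding in row i
and removing from row j commute; on the diagonal one counts addable rows
against removable rows, and there is exactly one more addable row, since row
i + 1 is addable iff row i is removable while row 0 is always addable. *)
Lemma up_dn phi la : up (dn phi) la = dn (up phi) la + phi la.
Proof.
(* One bound on the rows for all the partitions involved. *)
set L := (size la).+2.
have -> : up (dn phi) la = \sum_(i < L) \sum_(j < L)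
    if addable la i && rembl (addbox la i) j then phi (rembox (addbox la i) j) else 0.
  rewrite (@upE L) // big_mkcond; apply: eq_bigr => i _.
  case ai: (addable la i); last by rewrite big1_eq.
  rewrite (@dnE L) ?big_mkcond //.
  by apply: leq_trans (size_addbox_leq ai) _.
have -> : dn (up phi) la = \sum_(i < L) \sum_(j < L)
    if rembl la j && addable (rembox la j) i then phi (addbox (rembox la j) i) else 0.
  rewrite exchange_big (@dnE L) ?leqW //= big_mkcond; apply: eq_bigr => j _.
  case rj: (rembl la j); last by rewrite big1_eq.
  rewrite (@upE L) ?big_mkcond //.
  by have := size_rembox_leq rj; rewrite /L; lia.
transitivity (\sum_(i < L) (addable la i * phi la + \sum_(j < L | j != i)
    if addable la i && rembl (addbox la i) j then phi (rembox (addbox la i) j) else 0)).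
  apply: eq_bigr => i _; rewrite (bigD1 i) //=; congr (_ + _).
  by case ai: (addable la i) => //=; rewrite rembl_addbox // mul1n addboxK.
transitivity (\sum_(i < L) (rembl la i * phi la + \sum_(j < L | j != i)
    if rembl la j && addable (rembox la j) i then phi (addbox (rembox la j) i) else 0)
    + phi la); last first.
  congr (_ + _); apply: eq_bigr => i _; rewrite [RHS](bigD1 i) //=; congr (_ + _).
  by case ri: (rembl la i) => //=; rewrite addable_rembox // mul1n remboxK.
rewrite !big_split /= addnAC; congr (_ + _); last first.
  apply: eq_bigr => i _; apply: eq_bigr => j nij.
  have nij' : i != j :> nat by rewrite eq_sym.
  rewrite -rembl_add_comm //; case: ifP => // /andP[ai rj].
  by rewrite add_rem_comm.
rewrite -!big_distrl /= -mulSnr; congr (_ * _).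
rewrite big_ord_recl [X in _ = X.+1]big_ord_recr /= add1n; congr (_.+1).
rewrite [X in _ = _ + nat_of_bool X](_ : _ = false) ?addn0 //.
by apply/negP => /rembl_lt_size; rewrite ltnNge leqnSn.
Qed.

Lemma eq_dn phi psi : phi =1 psi -> dn phi =1 dn psi.
Proof. by move=> eq mu; apply: eq_bigr => i _; apply: eq. Qed.

Lemma eq_up phi psi : phi =1 psi -> up phi =1 up psi.
Proof. by move=> eq mu; apply: eq_bigr => i _; apply: eq. Qed.

Lemma dnD phi psi mu : dn (fun x => phi x + psi x) mu = dn phi mu + dn psi mu.
Proof. exact: big_split. Qed.

Lemma upD phi psi la : up (fun x => phi x + psi x) la = up phi la + up psi la.
Proof. exact: big_split. Qed.

Lemma dnZ c phi mu : dn (fun x => c * phi x) mu = c * dn phi mu.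
Proof. by rewrite /dn big_distrr. Qed.

Definition lazy_dn (phi : intpart -> nat) mu := phi mu + dn phi mu.
Definition at_empty mu : nat := mu == part0.
Definition syt_count r := iter r dn at_empty.
Definition lazy_dn_pow m := iter m lazy_dn at_empty.

Lemma up_at_empty la : up at_empty la = 0.
Proof.
apply: big1 => i ai; rewrite /at_empty; case: eqP => // eq0.
by have := part_size_addbox ai; rewrite eq0.
Qed.

(** In operator form U D^(r+1) = D^(r+1) U + (r+1) D^r, and U kills [at_empty]. *)
Lemma up_syt_count r la : up (syt_count r.+1) la = r.+1 * syt_count r la.
Proof.
elim: r la => [|r IH] la; rewrite [syt_count _.+1]iterS up_dn.
  by rewrite (eq_dn up_at_empty) /dn big1_eq mul1n.
by rewrite (eq_dn IH) dnZ [RHS]mulSnr.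
Qed.

Lemma eq_lazy_dn phi psi : phi =1 psi -> lazy_dn phi =1 lazy_dn psi.
Proof. by move=> eq mu; rewrite /lazy_dn eq (eq_dn eq). Qed.

Lemma lazy_dn_powS m mu : lazy_dn_pow m.+1 mu = lazy_dn_pow m mu + dn (lazy_dn_pow m) mu.
Proof. by []. Qed.

Lemma up_lazy_dn_pow m la : up (lazy_dn_pow m) la = m * lazy_dn_pow m.-1 la.
Proof.
elim: m la => [|m IH] la; first by rewrite up_at_empty.
rewrite (upD (lazy_dn_pow m)) up_dn IH (eq_dn IH) dnZ addnA -mulnDr.
case: m {IH} => [|m]; first by rewrite mul0n mul1n.
by rewrite /= -lazy_dn_powS [RHS]mulSnr.
Qed.

Lemma lazy_dn_pow_binomial m mu : lazy_dn_pow m mu = \sum_(j < m.+1) 'C(m, j) * syt_count j mu.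
Proof.
elim: m mu => [|m IH] mu; first by rewrite big_ord1 mul1n.
rewrite lazy_dn_powS IH (eq_dn IH).
have -> : dn (fun x => \sum_(j < m.+1) 'C(m, j) * syt_count j x) mu =
          \sum_(j < m.+1) 'C(m, j) * syt_count j.+1 mu.
  rewrite /dn exchange_big /=; apply: eq_bigr => j _.
  by rewrite -big_distrr.
rewrite [RHS]big_ord_recl bin0 big_ord_recl bin0 -addnA; congr (_ + _).
under [RHS]eq_bigr do rewrite /= binS mulnDl.
rewrite big_split /=; congr (_ + _).
by rewrite [RHS]big_ord_recr /= bin_small // mul0n addn0.
Qed.

(** The sum over m of S(k, m) F m, where S(k, m) is the Stirling number of the
second kind; the recursion is S(k+1, m) = S(k, m-1) + m S(k, m), read on F. *)
Fixpoint stirsum k (F : nat -> nat) : nat :=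
  if k is k'.+1 then stirsum k' (fun m => F m.+1 + m * F m) else F 0.

Lemma eq_stirsum k F G : F =1 G -> stirsum k F = stirsum k G.
Proof.
elim: k F G => [|k IH] F G eq /=; first exact: eq.
by apply: IH => m; rewrite !eq.
Qed.

Lemma stirsum_sum (I : Type) (s : seq I) k (F : I -> nat -> nat) :
  stirsum k (fun m => \sum_(x <- s) F x m) = \sum_(x <- s) stirsum k (F x).
Proof.
elim: k F => [|k IH] F //=; rewrite -IH; apply: eq_stirsum => m.
by rewrite big_distrr -big_split.
Qed.

Lemma stirsumD k F G : stirsum k (fun m => F m + G m) = stirsum k F + stirsum k G.
Proof.
elim: k F G => //= k IH F G; rewrite -IH; apply: eq_stirsum => m; nia.
Qed.

Lemma stirsumZ k c F : stirsum k (fun m => F m * c) = stirsum k F * c.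
Proof.
elim: k F => //= k IH F; rewrite -IH; apply: eq_stirsum => m; nia.
Qed.

(** Each pair of steps of a simplified vacillating tableau, read backwards from
its final shape, stays or removes a node and then stays or adds one. *)
Definition svt_count k := iter k (fun phi => lazy_dn (fun mu => phi mu + up phi mu)) at_empty.

(** By [up_lazy_dn_pow], the operator (1 + D)(1 + U) sends the m-th lazy power to
the (m+1)-st plus m times the m-th: the Stirling recursion. *)
Lemma svt_count_stirsum k mu : svt_count k mu = stirsum k (fun m => lazy_dn_pow m mu).
Proof.
elim: k mu => [|k IH] mu; first by [].
rewrite [svt_count _.+1]iterS.
rewrite [RHS]/(stirsum k (fun m => lazy_dn_pow m.+1 mu + m * lazy_dn_pow m mu)).
have E x : svt_count k x + up (svt_count k) x =
    stirsum k (fun m => lazy_dn_pow m x + m * lazy_dn_pow m.-1 x).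
  rewrite stirsumD -IH; congr (_ + _).
  rewrite (eq_up IH) /up -big_filter.
  rewrite -[RHS](@eq_stirsum k (fun m =>
    \sum_(i <- [seq i <- index_enum 'I_(size x).+1 | addable x (val i)])
      lazy_dn_pow m (addbox x (val i)))).
    by rewrite stirsum_sum.
  by move=> m; rewrite big_filter -up_lazy_dn_pow.
rewrite (eq_lazy_dn E) /lazy_dn.
have -> : dn (fun x => stirsum k (fun m => lazy_dn_pow m x + m * lazy_dn_pow m.-1 x)) mu =
   stirsum k (fun m => dn (fun x => lazy_dn_pow m x + m * lazy_dn_pow m.-1 x) mu).
  rewrite /dn -big_filter -stirsum_sum; apply: eq_stirsum => m.
  by rewrite big_filter.
rewrite -stirsumD; apply: eq_stirsum => m.
rewrite dnD dnZ lazy_dn_powS addnACA -mulnDr; congr (_ + _).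
by case: m => //= m; rewrite !mul0n.
Qed.

Fixpoint partitions r : seq intpart :=
  if r is r'.+1 then
    undup [seq addbox la i | la <- partitions r', i <- [seq i <- iota 0 r'.+1 | addable la i]]
  else [:: part0].

Lemma size_leq_part_size mu : size mu <= part_size mu.
Proof.
rewrite /part_size; case: mu => s /= /andP[_].
by elim: s => //= x s IH; rewrite inE negb_or => /andP[? /IH]; lia.
Qed.

Lemma part_size_eq0 mu : part_size mu = 0 -> mu = part0.
Proof.
move=> s0; apply: intpart_ext => i; rewrite nth_nil nth_default //.
by have := size_leq_part_size mu; lia.
Qed.

Lemma rembl_last mu : mu != part0 -> rembl mu (size mu).-1.
Proof.
move=> nz; have : 0 < size mu.
  rewrite lt0n; apply: contra nz => /eqP/size0nil s0.
  by apply/eqP/val_inj.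
move=> lt0; rewrite /rembl prednK // (nth_default 0 (leqnn _)) nth_part_gt0; lia.
Qed.

Lemma partitions_uniq r : uniq (partitions r).
Proof. by case: r => //= r; apply: undup_uniq. Qed.

Lemma mem_partitions r mu : (mu \in partitions r) = (part_size mu == r).
Proof.
elim: r mu => [|r IH] mu.
  rewrite inE; apply/eqP/eqP => [->|/part_size_eq0] //.
rewrite mem_undup; apply/allpairsPdep/eqP => [[la [i [+ +]]]|smu].
  by rewrite IH mem_filter => /eqP <- /andP[ai _] ->; apply: part_size_addbox.
have ri : rembl mu (size mu).-1 by apply: rembl_last; apply: contra_eqN smu => /eqP->.
exists (rembox mu (size mu).-1), (size mu).-1; split; last by rewrite remboxK.
  by have := part_size_rembox ri; rewrite IH smu => -[<-].
rewrite mem_filter addable_rembox // mem_iota.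
by have := size_leq_part_size mu; rewrite smu; lia.
Qed.

Arguments partitions : simpl never.

(** Double counting of the covering pairs between two consecutive ranks. *)
Lemma sum_cover r (F : intpart -> intpart -> nat) :
  \sum_(mu <- partitions r.+1) \sum_(i < size mu | rembl mu i) F (rembox mu i) mu =
  \sum_(la <- partitions r) \sum_(i < (size la).+1 | addable la i) F la (addbox la i).
Proof.
transitivity (\sum_(mu <- partitions r.+1) \sum_(i < r.+2 | rembl mu i) F (rembox mu i) mu).
  apply: eq_big_seq => mu; rewrite mem_partitions => /eqP smu.
  exact: (@dnE r.+2 (fun x => F x mu)) (leq_trans (size_leq_part_size _) (leqW (eq_leq smu))).
transitivity (\sum_(la <- partitions r) \sum_(i < r.+2 | addable la i) F la (addbox la i));
  last first.
  apply: eq_big_seq => mu; rewrite mem_partitions => /eqP smu.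
  symmetry; apply: (@upE r.+2 (fun x => F mu x)).
  exact: leq_ltn_trans (size_leq_part_size _) (leqW (eq_leq (congr1 S smu))).
rewrite [LHS](exchange_big_dep xpredT) // [RHS](exchange_big_dep xpredT) //.
apply: eq_bigr => i _; rewrite -big_filter -[RHS]big_filter /=.
rewrite (perm_big [seq addbox la i | la <- [seq la <- partitions r | addable la i]]); last first.
  apply: uniq_perm; first by rewrite filter_uniq ?partitions_uniq.
    rewrite map_inj_in_uniq ?filter_uniq ?partitions_uniq // => x y.
    rewrite !mem_filter => /andP[ax _] /andP[ay _] /(congr1 (rembox^~ i)).
    by rewrite !addboxK.
  move=> mu; rewrite mem_filter mem_partitions; apply/andP/mapP.
    case=> ri /eqP smu; exists (rembox mu i); last by rewrite remboxK.
    rewrite mem_filter addable_rembox // mem_partitions.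
    by have := part_size_rembox ri; rewrite smu => -[<-]; rewrite eqxx.
  case=> la; rewrite mem_filter mem_partitions => /andP[ai /eqP sla] ->.
  by rewrite /= rembl_addbox //= part_size_addbox //= sla eqxx.
rewrite big_map; apply: eq_big_seq => la; rewrite mem_filter => /andP[ai _].
by rewrite addboxK.
Qed.

Definition syt_total r := \sum_(mu <- partitions r) syt_count r mu.

Lemma syt_count_support r mu : syt_count r mu != 0 -> part_size mu = r.
Proof.
elim: r mu => [|r IH] mu; first by rewrite /syt_count /= /at_empty; have [->|] := eqVneq mu part0.
move=> nz; apply/eqP; apply: contraNT nz => ne; apply/eqP/big1 => i ri.
by apply/eqP; apply: contraNT ne => /IH; rewrite (part_size_rembox ri) => ->.
Qed.

Lemma syt_total0 : syt_total 0 = 1.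
Proof. by rewrite /syt_total big_seq1. Qed.

Lemma count_add_rem la c : \sum_(i < (size la).+1 | addable la i) c =
  c + \sum_(i < size la | rembl la i) c.
Proof. by rewrite big_mkcond big_ord_recl /= -big_mkcond. Qed.

(** This is the recursion for the numbers of involutions.  Summing D phi over
rank r+1 weighs phi by the number of addable rows, which exceeds the number of
removable rows by one; summing U phi over rank r-1 weighs it by the latter. *)
Lemma syt_totalS r :
  syt_total r.+1 = syt_total r + r * syt_total r.-1.
Proof.
have -> : syt_total r.+1 = \sum_(la <- partitions r)
    \sum_(i < (size la).+1 | addable la i) syt_count r la.
  by rewrite -(sum_cover r (fun la mu => syt_count r la)).
under eq_bigr do rewrite count_add_rem.
rewrite big_split /=; congr (_ + _).
case: r => [|r]; first by rewrite big_seq1 big_ord0 mul0n.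
rewrite (sum_cover r (fun la mu => syt_count r.+1 mu)) [RHS]big_distrr /=.
by apply: eq_bigr => la _; rewrite -up_syt_count.
Qed.

(** D and U are adjoint, so <f_(r+1), f_(r+1)> = <f_r, U f_(r+1)> = (r+1) <f_r, f_r>. *)
Lemma sum_syt_count_sqr r : \sum_(mu <- partitions r) syt_count r mu * syt_count r mu = r`!.
Proof.
elim: r => [|r IH]; first by rewrite big_seq1.
transitivity (\sum_(mu <- partitions r.+1) \sum_(i < size mu | rembl mu i)
   syt_count r (rembox mu i) * syt_count r.+1 mu).
  by apply: eq_bigr => mu _; rewrite -big_distrl.
rewrite (sum_cover r (fun la mu => syt_count r la * syt_count r.+1 mu)) factS -IH big_distrr /=.
by apply: eq_bigr => la _; rewrite -big_distrr /= -/(up _ _) up_syt_count mulnCA.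
Qed.

(** * Counting vacillating tableaux *)
Lemma card_fset_set_seq (T : choiceType) (A : set T) (s : seq T) :
  uniq s -> (forall x, A x <-> x \in s) -> #|` fset_set A| = size s.
Proof.
move=> us As; have -> : A = [set` [fset x in s]%fset]%classic.
  by apply/seteqP; split=> x /=; rewrite !finmap.inE -As.
by rewrite set_fsetK card_fseq undup_id.
Qed.

Lemma uniq_flatten_map (T U : eqType) (f : T -> seq U) (s : seq T) :
  uniq s -> (forall x, x \in s -> uniq (f x)) ->
  (forall x y z, x \in s -> y \in s -> z \in f x -> z \in f y -> x = y) ->
  uniq (flatten (map f s)).
Proof.
elim: s => //= x s IH /andP[xs us] uf disj; rewrite cat_uniq uf ?mem_head //=.
rewrite IH // => [|y ys|y y' z ys ys']; last 2 first.
- by apply: uf; rewrite inE ys orbT.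
- by apply: disj; rewrite inE (ys, ys') orbT.
rewrite andbT; apply/hasPn => z /flatten_mapP[y ys zfy]; apply/negP => zfx.
have xy : x = y by apply: (disj x y z); rewrite ?mem_head // inE ys orbT.
by move: xs; rewrite xy ys.
Qed.

Lemma size_flatten_map (T U : Type) (f : T -> seq U) (s : seq T) :
  size (flatten (map f s)) = \sum_(x <- s) size (f x).
Proof. by rewrite size_flatten /shape -map_comp sumnE big_map. Qed.

Definition rem_rows mu := [seq i <- iota 0 (size mu) | rembl mu i].
Definition add_rows la := [seq i <- iota 0 (size la).+1 | addable la i].

Lemma mem_rem_rows mu i : (i \in rem_rows mu) = rembl mu i.
Proof.
rewrite mem_filter mem_iota /=; case ri: (rembl mu i) => //=.
exact: rembl_lt_size.
Qed.

Lemma mem_add_rows la i : (i \in add_rows la) = addable la i.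
Proof.
rewrite mem_filter mem_iota /=; case ai: (addable la i) => //=.
by rewrite add0n ltnS; apply: addable_leq_size.
Qed.

Lemma sum_rem_rows (F : nat -> nat) mu :
  \sum_(i <- rem_rows mu) F i = \sum_(i < size mu | rembl mu i) F i.
Proof. by rewrite big_filter -[RHS](big_mkord (rembl mu) F) /index_iota subn0. Qed.

Lemma sum_add_rows (F : nat -> nat) la :
  \sum_(i <- add_rows la) F i = \sum_(i < (size la).+1 | addable la i) F i.
Proof. by rewrite big_filter -[RHS](big_mkord (addable la) F) /index_iota subn0. Qed.

Definition stay_downs mu := mu :: [seq rembox mu i | i <- rem_rows mu].
Definition stay_ups la := la :: [seq addbox la i | i <- add_rows la].

Lemma mem_stay_downs la mu : la \in stay_downs mu <-> mu = la \/ young_cover la mu.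
Proof.
rewrite inE young_coverP; split.
  case/orP => [/eqP->|/mapP[i + ->]]; first by left.
  by rewrite mem_rem_rows => ri; right; exists i.
case=> [->|[i ri ->]]; rewrite ?eqxx // map_f ?orbT //.
by rewrite mem_rem_rows.
Qed.

Lemma mem_stay_ups la mu : mu \in stay_ups la <-> la = mu \/ young_cover la mu.
Proof.
rewrite inE young_coverP_add; split.
  case/orP => [/eqP->|/mapP[i + ->]]; first by left.
  by rewrite mem_add_rows => ri; right; exists i.
case=> [->|[i ri ->]]; rewrite ?eqxx // map_f ?orbT //.
by rewrite mem_add_rows.
Qed.

Lemma uniq_stay_downs mu : uniq (stay_downs mu).
Proof.
rewrite /= map_inj_in_uniq ?filter_uniq ?iota_uniq // ?andbT.
  apply/mapP => -[ i ]; rewrite mem_rem_rows => ri eq.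
  by have := part_size_rembox ri; rewrite -eq; lia.
by move=> i j; rewrite !mem_rem_rows; apply: rembox_inj.
Qed.

Lemma uniq_stay_ups la : uniq (stay_ups la).
Proof.
rewrite /stay_ups cons_uniq map_inj_in_uniq ?filter_uniq ?iota_uniq //.
  rewrite andbT; apply/mapP => -[ i ]; rewrite mem_add_rows => ri eq.
  by have := part_size_addbox ri; rewrite -eq; lia.
by move=> i j; rewrite !mem_add_rows; apply: addbox_inj.
Qed.

Lemma sum_stay_downs F mu : \sum_(la <- stay_downs mu) F la = lazy_dn F mu.
Proof. by rewrite big_cons big_map sum_rem_rows. Qed.

Lemma sum_stay_ups F la : \sum_(mu <- stay_ups la) F mu = F la + up F la.
Proof. by rewrite big_cons big_map sum_add_rows. Qed.

Arguments stay_downs : simpl never.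
Arguments stay_ups : simpl never.

Definition svt_seq k mu (v : seq intpart) : Prop :=
  [/\ size v = k.*2.+1, nth part0 v 0 = part0, nth part0 v k.*2 = mu &
      forall i, i < k ->
        (nth part0 v i.*2.+1 = nth part0 v i.*2
           \/ young_cover (nth part0 v i.*2.+1) (nth part0 v i.*2)) /\
        (nth part0 v i.*2.+2 = nth part0 v i.*2.+1
           \/ young_cover (nth part0 v i.*2.+1) (nth part0 v i.*2.+2))].

Fixpoint walks k mu : seq (seq intpart) :=
  if k is k'.+1 then
    flatten [seq flatten [seq [seq rcons (rcons w nu) mu | w <- walks k' la]
                         | la <- stay_ups nu] | nu <- stay_downs mu]
  else if mu == part0 then [:: [:: part0]] else [::].

Lemma nth_rcons2 (w : seq intpart) a b :
  [/\ forall i, i < size w -> nth part0 (rcons (rcons w a) b) i = nth part0 w i,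
      nth part0 (rcons (rcons w a) b) (size w) = a &
      nth part0 (rcons (rcons w a) b) (size w).+1 = b].
Proof.
split=> [i lti||]; rewrite !nth_rcons size_rcons.
- by rewrite ltnS (ltnW lti) lti.
- by rewrite ltnS leqnn ltnn eqxx.
- by rewrite ltnn eqxx.
Qed.

Lemma svt_seq_rcons k mu nu (w : seq intpart) : size w = k.*2.+1 ->
  svt_seq k.+1 mu (rcons (rcons w nu) mu) <->
  [/\ svt_seq k (nth part0 w k.*2) w, nu \in stay_downs mu
     & nth part0 w k.*2 \in stay_ups nu].
Proof.
move=> sw; have [nlt n1 n2] := nth_rcons2 w nu mu; rewrite sw in nlt n1 n2.
set v := rcons _ _ in nlt n1 n2 *.
have vlt i : i < k -> [/\ nth part0 v i.*2 = nth part0 w i.*2,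
    nth part0 v i.*2.+1 = nth part0 w i.*2.+1
  & nth part0 v i.*2.+2 = nth part0 w i.*2.+2].
  by move=> ltik; rewrite !nlt //; lia.
split.
  case=> _ v0 _ steps; split.
  - split=> // [|i ltik]; first by rewrite -nlt.
    by have := steps i (leqW ltik); case: (vlt i ltik) => -> -> ->.
  - by apply/mem_stay_downs; have [_] := steps k (ltnSn k); rewrite n1 n2.
  - by apply/mem_stay_ups; have [+ _] := steps k (ltnSn k); rewrite n1 nlt.
case=> -[_ w0 _ steps] /mem_stay_downs down /mem_stay_ups ups; split.
- by rewrite !size_rcons sw.
- by rewrite nlt.
- by rewrite doubleS n2.
move=> i; rewrite ltnS leq_eqVlt => /predU1P[->|ltik].
  by rewrite n1 n2 nlt.
by case: (vlt i ltik) => -> -> ->; apply: steps.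
Qed.

Lemma mem_walks k mu v : v \in walks k mu <-> svt_seq k mu v.
Proof.
elim: k mu v => [|k IH] mu v.
  rewrite /=; case: (eqVneq mu part0) => [->|nz]; last first.
    by split=> // -[_ -> eq _]; rewrite eq eqxx in nz.
  rewrite inE; split=> [/eqP ->|] //.
  by case; case: v => // x [|//] _ /= ->.
split.
  case/flatten_mapP => nu down /flatten_mapP[la ups].
  case/mapP => w /IH w_la ->; have [sw _ wla _] := w_la.
  by apply/svt_seq_rcons => //; rewrite wla.
case; case/lastP: v => // v b; case/lastP: v => [|w a]; first by rewrite size_rcons.
rewrite !size_rcons doubleS => -[sw] w0 wmu steps.
have eb : b = mu by rewrite -wmu nth_rcons size_rcons sw ltnn eqxx.
subst b; have [w_la down ups] : [/\ svt_seq k (nth part0 w k.*2) w, a \in stay_downs mu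
    & nth part0 w k.*2 \in stay_ups a].
  apply/(svt_seq_rcons mu) => //.
  by split; rewrite // !size_rcons sw.
apply/flatten_mapP; exists a => //; apply/flatten_mapP; exists (nth part0 w k.*2) => //.
by apply: map_f; apply/IH.
Qed.

Lemma uniq_walks k mu : uniq (walks k mu).
Proof.
elim: k mu => [|k IH] mu; first by rewrite /=; case: ifP.
apply: uniq_flatten_map (uniq_stay_downs mu) _ _ => [nu _|nu nu' v _ _].
  apply: uniq_flatten_map (uniq_stay_ups nu) _ _ => [la _|la la' v _ _].
    by rewrite map_inj_uniq // => w w' /rcons_inj[/rcons_inj[]].
  case/mapP => w /mem_walks[_ _ wla _] -> /mapP[w' /mem_walks[_ _ wla' _]].
  by case/rcons_inj => /rcons_inj[eqw]; rewrite -wla -wla' eqw.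
case/flatten_mapP => la _ /mapP[w _ vE] /flatten_mapP[la' _ /mapP[w' _]].
by rewrite vE => /rcons_inj[/rcons_inj[]].
Qed.

Lemma size_walks k mu : size (walks k mu) = svt_count k mu.
Proof.
elim: k mu => [|k IH] mu; first by rewrite /= /svt_count /= /at_empty; case: ifP.
rewrite [LHS](size_flatten_map (fun nu => flatten [seq [seq rcons (rcons w nu) mu |
   w <- walks k la] | la <- stay_ups nu]) (stay_downs mu))
  -[RHS]/(lazy_dn (fun x => svt_count k x + up (svt_count k) x) mu) -sum_stay_downs.
apply: eq_bigr => nu _; rewrite size_flatten_map -sum_stay_ups.
by apply: eq_bigr => la _; rewrite size_map IH.
Qed.

Lemma num_svtE k mu : num_svt k mu = svt_count k mu.
Proof.
rewrite -size_walks /num_svt.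
have all_size : all (fun v : seq intpart => size v == k.*2.+1) (walks k mu).
  by apply/allP => v /mem_walks[-> _ _ _].
rewrite (@card_fset_set_seq _ _ (pmap insub (walks k mu))).
- by rewrite size_pmap_sub; apply/eqP; rewrite -all_count.
- by rewrite pmap_sub_uniq ?uniq_walks.
move=> w; rewrite mem_pmap_sub mem_walks /svt_seq size_tuple /is_svt /=.
by split=> [[]|[]].
Qed.

(** * Counting standard Young tableaux *)

(** When i is the number of rows, the entry starts a new row. *)
Fixpoint addentry (t : seq (seq nat)) i v : seq (seq nat) :=
  match t, i with
  | [::], _ => [:: [:: v]]
  | row :: t', 0 => rcons row v :: t'
  | row :: t', i'.+1 => row :: addentry t' i' v
  end.

Lemma nth_addentry t i v a : i <= size t ->
  nth [::] (addentry t i v) a =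
  if a == i then rcons (nth [::] t i) v else nth [::] t a.
Proof.
elim: t i a => [|row t IH] [|i] [|a] //= leit; first by rewrite nth_nil.
by rewrite IH.
Qed.

Lemma shape_addentry t i v : i <= size t ->
  shape (addentry t i v) = incr_nth (shape t) i.
Proof.
by elim: t i => [|row t IH] [|i] //= leit; rewrite ?size_rcons // -IH.
Qed.

Lemma flatten_addentry t i v :
  perm_eq (flatten (addentry t i v)) (v :: flatten t).
Proof.
elim: t i => [|row t IH] [|i] //=.
  by rewrite cat_rcons -cat1s perm_catCA.
rewrite -[v :: _]cat1s perm_sym perm_catCA perm_cat2l /= perm_sym; exact: IH.
Qed.

(** A retraction of [addentry], used to see that [addentry] is injective. *)
Definition dropentry (t : seq (seq nat)) v :=
  [seq row <- [seq [seq x <- row | x != v] | row <- t] | row != [::]].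

Lemma filter_neq_id (row : seq nat) v : v \notin row -> [seq x <- row | x != v] = row.
Proof.
by move=> vr; apply/all_filterP/allP => x xr; apply: contraNneq vr => <-.
Qed.

Lemma dropentry_id t v : v \notin flatten t -> 0 \notin shape t -> dropentry t v = t.
Proof.
rewrite /dropentry; elim: t => //= row t IH.
rewrite mem_cat inE !negb_or => /andP[vr vt] /andP[r0 t0].
rewrite filter_neq_id // -size_eq0 eq_sym r0; congr (_ :: _); exact: IH.
Qed.

Lemma addentryK t i v : v \notin flatten t -> 0 \notin shape t -> i <= size t ->
  dropentry (addentry t i v) v = t.
Proof.
elim: t i => [|row t IH] i /=; first by rewrite /dropentry /= eqxx.
rewrite mem_cat inE !negb_or => /andP[vr vt] /andP[r0 t0].
case: i => [|i] leit; rewrite /dropentry /= ?filter_rcons ?eqxx /= filter_neq_id //.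
  by rewrite -size_eq0 eq_sym r0; congr (_ :: _); apply: dropentry_id.
by rewrite -size_eq0 eq_sym r0; congr (_ :: _); apply: IH.
Qed.

Lemma find_addentry t i v : v \notin flatten t -> i <= size t ->
  find (fun row => v \in row) (addentry t i v) = i.
Proof.
elim: t i => [|row t IH] i /=; first by rewrite leqn0 mem_head => _ /eqP.
rewrite mem_cat negb_or => /andP[vr vt].
case: i => [|i] leit /=; first by rewrite mem_rcons mem_head.
by rewrite (negbTE vr) IH.
Qed.

Lemma nz_seq_ext (s : seq nat) mu :
  0 \notin s -> (forall a, nth 0 s a = nth 0 mu a) -> s = mu.
Proof.
move=> s0 eqn; apply: (@eq_from_nth _ 0) => //.
have H a : (a < size s) = (a < size mu).
  rewrite -nth_part_gt0 -eqn; have [lts|/(nth_default 0)->//] := ltnP a (size s).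
  by rewrite lt0n; apply/esym; apply: contra s0 => /eqP <-; apply: mem_nth.
have := H (size s); have := H (size mu); rewrite !ltnn; lia.
Qed.

Lemma part_nz mu : 0 \notin (mu : seq nat).
Proof. by case: mu => s /= /andP[]. Qed.

Lemma nth_shape (t : seq (seq nat)) a : nth 0 (shape t) a = size (nth [::] t a).
Proof. by elim: t a => [|r t IH] [|a] //=. Qed.

Lemma mem_flatten_nth (t : seq (seq nat)) a b : b < size (nth [::] t a) ->
  nth 0 (nth [::] t a) b \in flatten t.
Proof.
move=> ltb; have lta : a < size t.
  by rewrite ltnNge; apply/negP => /(nth_default [::]) eq; rewrite eq in ltb.
by apply/flattenP; exists (nth [::] t a); rewrite mem_nth.
Qed.

Section SytStep.
Variables (mu : intpart) (i : nat) (t : seq (seq nat)).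
Hypothesis ri : rembl mu i.
Let nu := rembox mu i.
Let v := (part_size nu).+1.

Lemma syt_addentry : is_syt nu t -> is_syt mu (addentry t i v).
Proof.
case=> sh pe rows cols.
have ai : addable nu i := addable_rembox ri.
have leit : i <= size t by rewrite -(size_map size) -/(shape t) sh addable_leq_size.
have nthmu a : nth 0 mu a = nth 0 nu a + (i == a).
  by rewrite -{1}(remboxK ri) nth_addbox.
have szrow a : size (nth [::] t a) = nth 0 nu a by rewrite -nth_shape sh.
have ltv a b : b < nth 0 nu a -> nth 0 (nth [::] t a) b < v.
  rewrite -szrow => /mem_flatten_nth; rewrite (perm_mem pe) mem_iota /v; lia.
split.
- by rewrite shape_addentry // sh -[in RHS](remboxK ri) val_addbox.
- rewrite (perm_trans (flatten_addentry t i v)) // (part_size_rembox ri) -/nu.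
  by rewrite -[X in iota 1 X]addn1 iotaD /= add1n cats1 -/v perm_sym perm_rcons perm_cons perm_sym.
- move=> a b; rewrite /node /= nthmu nth_addentry //.
  have [->|nai] := eqVneq a i; last by rewrite addn0; apply: rows.
  rewrite !nth_rcons !szrow addn1 ltnS => ltb; rewrite ltb.
  have [ltb1|] := ltnP b.+1 (nth 0 nu i); first exact: rows.
  by move=> geb; rewrite eqn_leq ltb geb /=; apply: ltv.
- move=> a b; rewrite /node /= nthmu !nth_addentry //.
  have := nth_part_anti nu a; have [eai|nai] := eqVneq a.+1 i.
    rewrite -eai ltn_eqF //= addn1 ltnS => anti.
    rewrite leq_eqVlt nth_rcons szrow => /predU1P[->|ltb]; last by rewrite ltb; apply: cols.
    rewrite ltnn eqxx; apply: ltv.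
    move: ai; rewrite -eai /addable /=; lia.
  rewrite addn0 => anti ltb.
  have ltba : b < nth 0 nu a by apply: leq_trans ltb anti.
  have [eai|_] := eqVneq a i; last exact: cols.
  by rewrite nth_rcons -eai szrow ltba; apply: cols.
Qed.

Lemma addentry_syt : 0 \notin shape t -> i <= size t ->
  is_syt mu (addentry t i v) -> is_syt nu t.
Proof.
move=> t0 leit [sh pe rows cols].
have nthmu a : nth 0 mu a = nth 0 nu a + (i == a).
  by rewrite -{1}(remboxK ri) nth_addbox ?addable_rembox.
have sht : shape t = nu.
  apply: nz_seq_ext => // a; have := congr1 (nth 0 ^~ a) sh.
  by rewrite shape_addentry // nth_incr_nth nthmu; lia.
have szrow a : size (nth [::] t a) = nth 0 nu a by rewrite -nth_shape sht.
have entry a b : b < nth 0 nu a ->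
    nth 0 (nth [::] (addentry t i v) a) b = nth 0 (nth [::] t a) b.
  move=> ltb; rewrite nth_addentry //; case: eqP => [eai|//].
  by rewrite nth_rcons -eai szrow ltb.
split=> //.
- rewrite -(perm_cons v) perm_sym -(perm_rcons v (iota _ _)).
  rewrite -cats1 -[[:: v]]/(iota (1 + part_size nu) 1) -iotaD addn1 -(part_size_rembox ri).
  by rewrite (perm_trans _ (flatten_addentry t i v)) // perm_sym.
- move=> a b; rewrite /node /= => ltb; rewrite -!entry //; last exact: ltnW.
  by apply: rows; rewrite /node /= nthmu; lia.
- move=> a b; rewrite /node /= => ltb; rewrite -!entry //; last first.
    exact: leq_trans ltb (nth_part_anti _ _).
  by apply: cols; rewrite /node /= nthmu; lia.
Qed.

End SytStep.

(** The largest entry of a standard tableau lies at the end of its row and has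
nothing below it, so it occupies a removable node. *)
Lemma syt_last mu t : is_syt mu t -> mu != part0 ->
  exists2 i, rembl mu i & exists t', [/\ 0 \notin shape t', i <= size t'
    & t = addentry t' i (part_size mu)].
Proof.
case=> sh pe rows cols nz.
have szrow a : size (nth [::] t a) = nth 0 mu a by rewrite -nth_shape sh.
set v := part_size mu.
have lev a b : b < nth 0 mu a -> nth 0 (nth [::] t a) b <= v.
  rewrite -szrow => /mem_flatten_nth; rewrite (perm_mem pe) mem_iota -/v; lia.
have v0 : 0 < v.
  by rewrite lt0n; apply: contra nz => /eqP/part_size_eq0->.
have : v \in flatten t by rewrite (perm_mem pe) mem_iota -/v v0 add1n ltnSn.
case/flattenP => row /(nthP [::])[i lti rE] /(nthP 0)[j ltj vE].
rewrite -{}rE in ltj vE; rewrite szrow in ltj.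
have ij1 : nth 0 mu i = j.+1.
  apply/eqP; rewrite eqn_leq ltj andbT leqNgt; apply/negP => lt1.
  by have := rows i j lt1; rewrite vE ltnNge lev.
have ri : rembl mu i.
  rewrite /rembl ij1 ltnS leqNgt; apply/negP => lt1.
  by have := cols i j lt1; rewrite vE ltnNge lev.
exists i => //.
have rowE : nth [::] t i = rcons (take j (nth [::] t i)) v.
  rewrite -vE -take_nth ?szrow ?ij1 // take_oversize //.
  by rewrite szrow ij1.
have szt : size t = size mu by rewrite -sh size_map.
(* The row of the largest entry disappears, or keeps j > 0 entries. *)
have [j0|jpos] := posnP j.
  have szi : size t = i.+1.
    rewrite szt; apply/eqP; rewrite eqn_leq (rembl_lt_size ri) andbT leqNgt.
    by rewrite -nth_part_gt0; move: ri; rewrite /rembl ij1 j0; lia.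
  exists (take i t); split.
  - apply/mapP => -[r rt]; move/mem_take: rt => rt r0.
    by have := part_nz mu; rewrite -sh => /mapP; apply; exists r.
  - by rewrite size_take lti.
  apply: (@eq_from_nth _ [::]).
    rewrite -[RHS](size_map size) -/(shape _) shape_addentry ?size_take ?lti //.
    by rewrite size_incr_nth size_map size_take lti ltnn.
  move=> a lta; rewrite nth_addentry ?size_take ?lti //.
  case: eqP => [->|nai]; last by rewrite nth_take //; lia.
  by rewrite rowE j0 take0 nth_default ?size_take ?lti.
exists (set_nth [::] t i (take j (nth [::] t i))).
have szs : size (set_nth [::] t i (take j (nth [::] t i))) = size t.
  by rewrite size_set_nth (maxn_idPr lti).
have shs a : nth 0 (shape (set_nth [::] t i (take j (nth [::] t i)))) a =
    if a == i then j else nth 0 mu a.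
  rewrite nth_shape nth_set_nth /=; case: eqP => // _.
  by rewrite size_take szrow ltj.
split.
- apply/(nthP 0) => -[a]; rewrite size_map szs shs szt => lta.
  case: eqP => _; first by move=> j0; rewrite j0 in jpos.
  by move: lta; rewrite -nth_part_gt0 => /[swap] ->.
- by rewrite szs ltnW.
apply: (@eq_from_nth _ [::]).
  rewrite -[RHS](size_map size) -/(shape _) shape_addentry ?szs ?(ltnW lti) //.
  by rewrite size_incr_nth size_map szs lti.
move=> a lta; rewrite nth_addentry ?szs ?(ltnW lti) // !nth_set_nth /= eqxx.
by case: eqP => [->|].
Qed.

Fixpoint tableaux r mu : seq (seq (seq nat)) :=
  if r is r'.+1 then
    flatten [seq [seq addentry t i r | t <- tableaux r' (rembox mu i)] | i <- rem_rows mu]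
  else if mu == part0 then [:: [::]] else [::].

Lemma size_tableaux r mu : size (tableaux r mu) = syt_count r mu.
Proof.
elim: r mu => [|r IH] mu; first by rewrite /= /syt_count /= /at_empty; case: ifP.
rewrite [LHS](size_flatten_map (fun i => [seq addentry t i r.+1 |
  t <- tableaux r (rembox mu i)]) (rem_rows mu)).
rewrite [syt_count _.+1]iterS /dn -(sum_rem_rows (fun i => syt_count r (rembox mu i))).
by apply: eq_bigr => i _; rewrite size_map IH.
Qed.

Lemma mem_tableaux r mu t : part_size mu = r ->
  t \in tableaux r mu <-> is_syt mu t.
Proof.
elim: r mu t => [|r IH] mu t smu.
  rewrite (part_size_eq0 smu) /= ?eqxx inE; split=> [/eqP ->|[sh _ _ _]].
    by split=> // i j; rewrite /node /= nth_nil.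
  by case: t sh.
have nz : mu != part0 by apply: contra_eqN smu => /eqP ->.
split.
  case/flatten_mapP => i; rewrite mem_rem_rows => ri /mapP[t' + ->].
  have sr : part_size (rembox mu i) = r by have := part_size_rembox ri; rewrite smu => -[].
  by move/(IH _ _ sr)/(syt_addentry ri); rewrite sr.
move=> syt; have [i ri [t' [t0 leit tE]]] := syt_last syt nz.
have sr : part_size (rembox mu i) = r by have := part_size_rembox ri; rewrite smu => -[].
apply/flatten_mapP; exists i; first by rewrite mem_rem_rows.
rewrite tE smu; apply: map_f; apply/(IH _ _ sr)/addentry_syt => //.
by rewrite sr -smu -tE.
Qed.

Lemma uniq_tableaux r mu : part_size mu = r -> uniq (tableaux r mu).
Proof.
elim: r mu => [|r IH] mu smu; first by rewrite /=; case: ifP.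
have good i t : i \in rem_rows mu -> t \in tableaux r (rembox mu i) ->
    [/\ r.+1 \notin flatten t, 0 \notin shape t & i <= size t].
  rewrite mem_rem_rows => ri.
  have sr : part_size (rembox mu i) = r by have := part_size_rembox ri; rewrite smu => -[].
  case/(mem_tableaux _ sr) => sh pe _ _.
  rewrite (perm_mem pe) sh part_nz mem_iota sr add1n ltnn andbF; split=> //.
  by rewrite -(size_map size) -/(shape t) sh addable_leq_size ?addable_rembox.
apply: uniq_flatten_map; first by rewrite filter_uniq ?iota_uniq.
  move=> i im; rewrite map_inj_in_uniq.
    apply: IH; move: im; rewrite mem_rem_rows => ri.
    by have := part_size_rembox ri; rewrite smu => -[].
  move=> t t' /(good _ _ im)[? ? ?] /(good _ _ im)[? ? ?].
  by move/(congr1 (dropentry^~ r.+1)); rewrite !addentryK.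
move=> i i' t im im' /mapP[t1 /(good _ _ im)[? _ ?] ->].
case/mapP=> t2 /(good _ _ im')[? _ ?].
by move/(congr1 (find (fun row => r.+1 \in row))); rewrite !find_addentry.
Qed.

Lemma num_sytE mu : num_syt mu = syt_count (part_size mu) mu.
Proof.
rewrite -size_tableaux; apply: card_fset_set_seq; first exact: uniq_tableaux.
by move=> t; rewrite mem_tableaux.
Qed.

End YoungLattice.

Local Open Scope ring_scope.

(** * The group algebra of a finite group *)
Section GroupAlgebra.
Variables (C : numClosedFieldType) (gT : finGroupType).

(** The function x stands for the formal sum of the x g *: g. *)
Definition galg := {ffun gT -> C^o}.
HB.instance Definition _ := Vector.on galg.

Implicit Types (x y z e f : galg) (g h k : gT).

Definition gmul x y : galg := [ffun g : gT => \sum_h x h * y (h^-1 * g)%g].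
Definition gone : galg := [ffun g : gT => (g == 1%g)%:R : C^o].

Lemma gmulA : associative gmul.
Proof.
move=> x y z; apply/ffunP => g; rewrite !ffunE.
transitivity (\sum_k \sum_h x k * (y (k^-1 * h)%g * z (h^-1 * g)%g)).
  apply: eq_bigr => k _; rewrite ffunE big_distrr /=.
  rewrite [RHS](reindex_inj (mulgI k)); apply: eq_bigr => h _ /=.
  by rewrite mulKg invMg mulgA.
rewrite exchange_big; apply: eq_bigr => h _; rewrite ffunE big_distrl /=.
by apply: eq_bigr => k _; rewrite mulrA.
Qed.

Lemma gmul1 : left_id gone gmul.
Proof.
move=> x; apply/ffunP => g; rewrite ffunE (bigD1 (1%g : gT)) //= ffunE eqxx mul1r.
rewrite invg1 mul1g big1 ?addr0 // => h /negbTE nh.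
by rewrite ffunE nh mul0r.
Qed.

Lemma gmulr1 : right_id gone gmul.
Proof.
move=> x; apply/ffunP => g; rewrite ffunE (bigD1 g) //= ffunE mulVg eqxx mulr1.
rewrite big1 ?addr0 // => h nh.
by rewrite ffunE -eq_mulVg1 (negbTE nh) mulr0.
Qed.

Lemma gmulDl : left_distributive gmul +%R.
Proof.
move=> x y z; apply/ffunP => g; rewrite !ffunE -big_split.
by apply: eq_bigr => h _; rewrite ffunE mulrDl.
Qed.

Lemma gmulDr : right_distributive gmul +%R.
Proof.
move=> x y z; apply/ffunP => g; rewrite !ffunE -big_split.
by apply: eq_bigr => h _; rewrite ffunE mulrDr.
Qed.

HB.instance Definition _ :=
  GRing.Zmodule_isPzRing.Build galg gmulA gmul1 gmulr1 gmulDl gmulDr.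

Lemma galgZl (a : C) x y : (a *: x) * y = a *: (x * y).
Proof.
apply/ffunP => g; rewrite !ffunE scaler_sumr; apply: eq_bigr => h _.
by rewrite ffunE -scalerAl.
Qed.

Lemma galgZr (a : C) x y : x * (a *: y) = a *: (x * y).
Proof.
apply/ffunP => g; rewrite !ffunE scaler_sumr; apply: eq_bigr => h _.
by rewrite ffunE -scalerAr.
Qed.

Lemma galg_mulE x y g : (x * y) g = \sum_h x h * y (h^-1 * g)%g.
Proof. by rewrite ffunE. Qed.

Definition gelt g : galg := [ffun k : gT => (k == g)%:R : C^o].

Lemma gelt1 : gelt 1 = 1. Proof. by []. Qed.

Lemma gelt_mulE g x k : (gelt g * x) k = x (g^-1 * k)%g.
Proof.
rewrite galg_mulE (bigD1 g) //= ffunE eqxx mul1r big1 ?addr0 // => h /negbTE nh.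
by rewrite ffunE nh mul0r.
Qed.

Lemma mul_geltE g x k : (x * gelt g) k = x (k * g^-1)%g.
Proof.
rewrite galg_mulE (bigD1 (k * g^-1)%g) //= ffunE invMg invgK -mulgA mulVg mulg1 eqxx.
rewrite mulr1 big1 ?addr0 // => h nh; rewrite ffunE.
case: eqP => [eqg|_]; last by rewrite mulr0.
by case/eqP: nh; rewrite -eqg invMg invgK mulKVg.
Qed.

Lemma geltM g h : gelt (g * h) = gelt g * gelt h.
Proof.
apply/ffunP => k; rewrite gelt_mulE !ffunE; congr (_%:R); congr nat_of_bool.
by apply/eqP/eqP => [->|<-]; rewrite ?mulKg ?mulKVg.
Qed.

Lemma galg_sum x : x = \sum_g x g *: gelt g.
Proof.
apply/ffunP => g; rewrite sum_ffunE (bigD1 g) //= !ffunE eqxx.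
rewrite big1 => [|h nh]; first by rewrite addr0 /GRing.scale /= mulr1.
by rewrite !ffunE eq_sym (negbTE nh) scaler0.
Qed.

Definition tau x : galg := [ffun g : gT => x g^-1%g].
Definition star x : galg := [ffun g : gT => (x g^-1%g)^* : C^o].

Lemma tauM x y : tau (x * y) = tau y * tau x.
Proof.
apply/ffunP => g; rewrite ffunE !galg_mulE (reindex_inj (mulgI g^-1)%g) /=.
apply: eq_bigr => h _.
by rewrite !ffunE mulrC !invMg !invgK mulgK.
Qed.

Lemma tauB x y : tau (x - y) = tau x - tau y.
Proof. by apply/ffunP => g; rewrite !ffunE. Qed.

Lemma tau1 : tau 1 = 1.
Proof. by apply/ffunP => g; rewrite !ffunE invg_eq1. Qed.

Lemma starM x y : star (x * y) = star y * star x.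
Proof.
transitivity (([ffun g => (tau (x * y) g)^*] : galg)).
  by apply/ffunP => g; rewrite !ffunE.
rewrite tauM; apply/ffunP => g; rewrite ffunE !galg_mulE rmorph_sum.
by apply: eq_bigr => h _; rewrite !ffunE rmorphM.
Qed.

Lemma starK : involutive star.
Proof. by move=> x; apply/ffunP => g; rewrite !ffunE invgK conjCK. Qed.

Lemma starB x y : star (x - y) = star x - star y.
Proof. by apply/ffunP => g; rewrite !ffunE rmorphB. Qed.

Lemma starZ (a : C) x : star (a *: x) = a^* *: star x.
Proof. by apply/ffunP => g; rewrite !ffunE rmorphM. Qed.

Lemma star1 : star 1 = 1.
Proof. by apply/ffunP => g; rewrite !ffunE invg_eq1 rmorph_nat. Qed.

Lemma star_gelt g : star (gelt g) = gelt g^-1.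
Proof.
by apply/ffunP => k; rewrite !ffunE -(inj_eq invg_inj) invgK rmorph_nat.
Qed.

(** The coefficient of x^* x at 1 is the sum of the |x g|^2. *)
Lemma star_mul_eq0 x : star x * x = 0 -> x = 0.
Proof.
move/ffunP/(_ 1%g); rewrite galg_mulE ffunE => sum0.
have ge0 h : 0 <= star x h * x (h^-1 * 1)%g.
  by rewrite ffunE mulg1 mulrC mul_conjC_ge0.
apply/ffunP => g; rewrite ffunE; apply/eqP; rewrite -mul_conjC_eq0.
have all0 h : star x h * x (h^-1 * 1)%g = 0.
  by apply: (psumr_eq0P (fun h _ => ge0 h) sum0).
by have := all0 g^-1%g; rewrite ffunE mulg1 invgK mulrC => ->.
Qed.

Section Support.
Variable K : {group gT}.

(** Membership in the group algebra of K, seen inside that of the whole group. *)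
Definition supp x := forall g, g \notin K -> x g = 0.

Lemma suppB x y : supp x -> supp y -> supp (x - y).
Proof. by move=> sx sy g gK; rewrite !ffunE sx // sy // subr0. Qed.

Lemma suppZ (a : C) x : supp x -> supp (a *: x).
Proof. by move=> sx g gK; rewrite ffunE sx // scaler0. Qed.

Lemma supp_gelt g : g \in K -> supp (gelt g).
Proof. by move=> gK h hK; rewrite ffunE; case: eqP hK => // ->; rewrite gK. Qed.

Lemma supp1 : supp 1. Proof. exact: supp_gelt (group1 K). Qed.

Lemma suppM x y : supp x -> supp y -> supp (x * y).
Proof.
move=> sx sy g gK; rewrite galg_mulE big1 // => h _.
have [hK|/sx->] := boolP (h \in K); last by rewrite mul0r.
by rewrite sy ?mulr0 // groupMl ?groupV.
Qed.

Lemma supp_star x : supp x -> supp (star x).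
Proof. by move=> sx g gK; rewrite ffunE sx ?groupV // rmorph0. Qed.

Lemma galg_sum_supp x : supp x -> x = \sum_(g in K) x g *: gelt g.
Proof.
move=> sx; rewrite {1}[x]galg_sum (bigID (mem K)) /= [X in _ + X]big1 ?addr0 //.
by move=> g /sx ->; rewrite scale0r.
Qed.

End Support.
End GroupAlgebra.

(** * Splitting idempotents of a group algebra *)
Lemma stable_eigenvector (C : numClosedFieldType) (V : vectType C)
    (f : 'End(V)) (U : {vspace V}) :
  U != 0%VS -> (f @: U <= U)%VS ->
  exists a u, [/\ u \in U, u != 0 & f u = a *: u].
Proof.
move=> U0 fU; set b := vbasis U; set n := \dim U.
pose M : 'M[C]_n := \matrix_(i, j) coord b j (f b`_i).
have bU (i : 'I_n) : b`_i \in U by rewrite vbasis_mem ?mem_nth ?size_tuple.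
have fb (i : 'I_n) : f b`_i = \sum_j M i j *: b`_j.
  rewrite [LHS](coord_vbasis (subvP fU _ (memv_img f (bU i)))).
  by apply: eq_bigr => j _; rewrite mxE.
have : size (char_poly M) != 1.
  by rewrite size_char_poly eqSS /n dimv_eq0.
case/closed_rootP => a; rewrite -eigenvalue_root_char => /eigenvalueP[v vM v0].
exists a, (\sum_i v 0 i *: b`_i); split.
- by apply: rpred_sum => i _; rewrite rpredZ.
- apply: contra v0 => /eqP v0; apply/eqP/rowP => i; rewrite mxE.
  have /freeP fr := basis_free (vbasisP U).
  by rewrite (fr (fun j => v 0 j)).
rewrite linear_sum; under eq_bigr do rewrite linearZ /= fb scaler_sumr.
rewrite exchange_big scaler_sumr; apply: eq_bigr => j _ /=.
under eq_bigr do rewrite scalerA.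
rewrite -scaler_suml scalerA; congr (_ *: _).
by have /rowP/(_ j) := vM; rewrite !mxE.
Qed.

Section Splitting.
Variables (C : numClosedFieldType) (gT : finGroupType) (K : {group gT}).
Local Notation A := (galg C gT).
Implicit Types (x y z e f b : A) (g h k : gT).

Definition selfadj_idem e := [/\ supp K e, e * e = e, tau e = e, star e = e & e != 0].
(** For an idempotent e this says e A e = C e, where A is the group algebra of K. *)
Definition minimal_idem e := forall x, supp K x -> exists c : C, e * x * e = c *: e.
Definition corner e b := [/\ supp K b, e * b = b & b * e = b].

Definition lmulg w (z : A) : A := w * z.
Lemma lmulg_is_linear w : linear (lmulg w).
Proof. by move=> c u v; rewrite /lmulg mulrDr galgZr. Qed.
HB.instance Definition _ w :=
  GRing.isSemilinear.Build C A A _ (lmulg w) (GRing.semilinear_linear (lmulg_is_linear w)).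

(** Restricting z to K makes [e A e] the image of a linear map on the whole algebra. *)
Definition compress e (z : A) : A := e * [ffun g : gT => if g \in K then z g else 0 : C^o] * e.
Lemma compress_is_linear e : linear (compress e).
Proof.
move=> c u v; rewrite /compress -galgZl -galgZr -mulrDl -mulrDr; congr (_ * _ * _).
by apply/ffunP => g; rewrite !ffunE; case: ifP; rewrite // scaler0 addr0.
Qed.
HB.instance Definition _ e :=
  GRing.isSemilinear.Build C A A _ (compress e) (GRing.semilinear_linear (compress_is_linear e)).

Lemma compressE e x : supp K x -> compress e x = e * x * e.
Proof.
move=> sx; congr (_ * _ * _); apply/ffunP => g; rewrite ffunE.
by case: ifPn => // /sx ->.
Qed.

Lemma mem_corner e b : supp K e -> e * e = e ->
  b \in limg (linfun (compress e)) <-> corner e b.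
Proof.
move=> se ee; split=> [/memv_imgP[z _ ->]|[sb eb be]].
  rewrite lfunE /= /compress; split; last 2 first.
  - by rewrite !mulrA ee.
  - by rewrite -!mulrA ee.
  apply: suppM => //; apply: suppM => // g gK; by rewrite ffunE (negbTE gK).
apply/memv_imgP; exists b; first exact: memvf.
by rewrite lfunE /= compressE // eb be.
Qed.

Section Corner.
Variable e : A.
Hypothesis e_idem : selfadj_idem e.
Hypothesis e_fix : forall x, supp K x -> tau (e * x * e) = e * x * e.

Let se : supp K e. Proof. by case: e_idem. Qed.
Let ee : e * e = e. Proof. by case: e_idem. Qed.
Let te : tau e = e. Proof. by case: e_idem. Qed.
Let ste : star e = e. Proof. by case: e_idem. Qed.
Let e0 : e != 0. Proof. by case: e_idem. Qed.

Lemma corner_tau b : corner e b -> tau b = b.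
Proof. by case=> sb eb be; have := e_fix sb; rewrite eb be. Qed.

Lemma cornerM a b : corner e a -> corner e b -> corner e (a * b).
Proof.
case=> sa ea ae [sb eb be]; split; first exact: suppM.
  by rewrite mulrA ea.
by rewrite -mulrA be.
Qed.

Lemma cornerB a b : corner e a -> corner e b -> corner e (a - b).
Proof.
case=> sa ea ae [sb eb be]; split; first exact: suppB.
  by rewrite mulrBr ea eb.
by rewrite mulrBl ae be.
Qed.

Lemma cornerZ (c : C) b : corner e b -> corner e (c *: b).
Proof.
by case=> sb eb be; split; rewrite ?galgZl ?galgZr ?eb ?be //; apply: suppZ.
Qed.

Lemma corner1 : corner e e. Proof. by []. Qed.

Lemma corner_star b : corner e b -> corner e (star b).
Proof.
case=> sb eb be; split; first exact: supp_star.
  by rewrite -{1}ste -starM be.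
by rewrite -{1}ste -starM eb.
Qed.

(** tau is an anti-automorphism that fixes the corner e A e pointwise. *)
Lemma corner_comm a b : corner e a -> corner e b -> a * b = b * a.
Proof.
move=> ca cb; rewrite -(corner_tau (cornerM ca cb)) tauM.
by rewrite (corner_tau ca) (corner_tau cb).
Qed.

(** With c = b^* b, commutativity gives c^* c = 0, so c = 0 and b = 0. *)
Lemma corner_reduced b : corner e b -> b * b = 0 -> b = 0.
Proof.
move=> cb bb0; have cs := corner_star cb.
apply/star_mul_eq0/star_mul_eq0; rewrite starM starK.
by rewrite mulrA -[_ * b * _]mulrA (corner_comm cb cs) -!mulrA bb0 !mulr0.
Qed.

(** The corner e A e is a commutative algebra without nilpotents.  A non-scalar
element has an eigenvalue, hence a translate w <> 0 that kills some u <> 0.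
Multiplication by w is injective, hence bijective, on the ideal w e A e, which
therefore has an identity element f; f <> 0 because w <> 0, and f <> e because
f kills u. *)
Lemma corner_split : ~ minimal_idem e ->
  exists f, [/\ selfadj_idem f, f != e, e * f = f & f * e = f].
Proof.
move=> nmin; have [x sx nx] : exists2 x, supp K x & forall c, e * x * e <> c *: e.
  apply: contra_notP nmin => nex x sx; apply: contra_notP nex => nc.
  by exists x => // c xc; apply: nc; exists c.
set y := e * x * e in nx.
have cy : corner e y.
  split; first by apply: suppM => //; apply: suppM.
    by rewrite /y !mulrA ee.
  by rewrite /y -!mulrA ee.
pose B := limg (linfun (compress e)).
have memB b : b \in B <-> corner e b by apply: mem_corner.
have eB : e \in B by apply/memB.
have stB w : corner e w -> (linfun (lmulg w) @: B <= B)%VS.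
  move=> cw; apply/subvP => _ /memv_imgP[b /memB cb ->].
  by rewrite lfunE /=; apply/memB/cornerM.
have B0 : B != 0%VS.
  by apply: contraNneq e0 => B0; rewrite -memv0 -B0.
have [a [u [/memB cu u0]]] := stable_eigenvector B0 (stB y cy).
rewrite lfunE /= /lmulg => yu.
pose w := y - a *: e.
have cw : corner e w by apply: cornerB => //; apply: cornerZ corner1.
have w0 : w != 0.
  by apply/eqP => /eqP; rewrite subr_eq0 => /eqP; apply: nx.
have wu : w * u = 0.
  by rewrite mulrBl yu galgZl; case: cu => _ -> _; rewrite subrr.
pose I := (linfun (lmulg w) @: B)%VS.
have cI b : b \in I -> corner e b.
  by move=> bI; apply/memB; apply: subvP (stB w cw) _ bI.
have wI b : corner e b -> w * b \in I.
  move=> /memB bB; apply/memv_imgP; exists b => //.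
  by rewrite lfunE.
have II : (linfun (lmulg w) @: I)%VS = I.
  apply/eqP; rewrite eqEdim limg_dim_eq ?leqnn ?andbT.
    by apply/subvP => _ /memv_imgP[b /cI cb ->]; rewrite lfunE; apply: wI.
  apply/eqP; rewrite -subv0; apply/subvP => b; rewrite memv_cap memv_ker memv0.
  rewrite lfunE /= /lmulg => /andP[bI /eqP wb0]; apply/eqP/corner_reduced; first exact: cI.
  have /memv_imgP[z _] := bI; rewrite lfunE /= /lmulg => bE.
  by rewrite {2}bE mulrA (corner_comm (cI b bI) cw) wb0 mul0r.
have /memv_imgP[f fI] : w \in (linfun (lmulg w) @: I)%VS.
  by rewrite II -{1}[w](_ : w * e = w) ?wI; case: cw.
rewrite lfunE /= /lmulg => wf; have cf := cI f fI; have csf := corner_star cf.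
have /memv_imgP[z /memB cz] := fI; rewrite lfunE /= /lmulg => fE.
have ff : f * f = f.
  by rewrite {1}fE (corner_comm cw cz) -mulrA -wf -(corner_comm cw cz) -fE.
(* f - f f^* is killed by its adjoint; so f = f f^* is self-adjoint. *)
have f_sf : f = f * star f.
  have sf := corner_comm csf cf.
  have ss : star f * star f = star f by rewrite -starM ff.
  have fsf : f * star f * f = f * star f by rewrite -mulrA sf mulrA ff.
  apply/eqP; rewrite -subr_eq0; apply/eqP/star_mul_eq0.
  rewrite starB starM starK mulrBl !mulrBr !mulrA sf fsf.
  by rewrite -(mulrA f (star f) (star f)) ss !subrr.
exists f; split; [split=> //| | |]; try by case: cf.
- exact: corner_tau.
- by rewrite {1}f_sf starM starK -f_sf.
- by apply: contraNneq w0 => f0; rewrite wf f0 mulr0.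
apply: contraNneq u0 => fe; have [_ <- _] := cu.
by rewrite -fe fE (corner_comm cw cz) -mulrA wu mulr0.
Qed.

End Corner.

(** A decomposition of e into pairwise orthogonal minimal idempotents, all of
them self-adjoint and fixed by tau. *)
Record orth_decomp e (es : seq A) : Prop := OrthDecomp {
  od_uniq : uniq es;
  od_idem : forall f, f \in es -> selfadj_idem f;
  od_min : forall f, f \in es -> minimal_idem f;
  od_corner : forall f, f \in es -> e * f = f /\ f * e = f;
  od_orth : forall f f', f \in es -> f' \in es -> f != f' -> f * f' = 0;
  od_sum : \sum_(f <- es) f = e }.

Lemma orth_decomp_flatten (es : seq A) :
  uniq es -> (forall e e', e \in es -> e' \in es -> e != e' -> e * e' = 0) ->
  (forall e, e \in es -> exists fs, orth_decomp e fs) ->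
  exists fs, orth_decomp (\sum_(e <- es) e) fs.
Proof.
move=> ues orth dec.
have [F FP] : exists F : A -> seq A, forall e, e \in es -> orth_decomp e (F e).
  have H e : exists s, e \in es -> orth_decomp e s.
    by case: (boolP (e \in es)) => [/dec[s ds]|_]; [exists s | exists [::]].
  by have [F FP] := choice H; exists F.
have cross e f : e \in es -> f \in F e ->
    forall e', e' \in es -> e' * f = (if e' == e then f else 0)
                         /\ f * e' = (if e' == e then f else 0).
  move=> ees fF e' e'es; have [ef fe] := od_corner (FP e ees) fF.
  case: eqP => [->//|/eqP ne]; split.
    by rewrite -ef mulrA (orth e' e) // mul0r.
  by rewrite -fe -mulrA (orth e e') 1?eq_sym // mulr0.
exists (flatten (map F es)); split.
- apply: uniq_flatten_map ues _ _ => [e ees|e e' f ees e'es fe fe'].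
    exact: od_uniq (FP e ees).
  apply/eqP; apply: contraTT (isT) => ne /=.
  have [_ _ _ _ /eqP[]] := od_idem (FP e ees) fe.
  have [<- _] := od_corner (FP e ees) fe.
  by have [-> _] := cross _ _ e'es fe' _ ees; rewrite (negbTE ne).
- by move=> f /flatten_mapP[e ees fF]; apply: od_idem (FP e ees) _ fF.
- by move=> f /flatten_mapP[e ees fF]; apply: od_min (FP e ees) _ fF.
- move=> f /flatten_mapP[e ees fF]; split.
    rewrite mulr_suml (bigD1_seq e) //= big_seq_cond big1 ?addr0.
      by have [->] := cross _ _ ees fF _ ees; rewrite eqxx.
    by move=> e' /andP[e'es ne]; have [-> _] := cross _ _ ees fF _ e'es; rewrite (negbTE ne).
  rewrite mulr_sumr (bigD1_seq e) //= big_seq_cond big1 ?addr0.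
    by have [_ ->] := cross _ _ ees fF _ ees; rewrite eqxx.
  by move=> e' /andP[e'es ne]; have [_ ->] := cross _ _ ees fF _ e'es; rewrite (negbTE ne).
- move=> f f' /flatten_mapP[e ees fF] /flatten_mapP[e' e'es f'F] nff.
  have [ee'|ne] := eqVneq e e'.
    by move: f'F; rewrite -ee' => f'F; apply: od_orth (FP e ees) _ _ fF f'F nff.
  have [_ <-] := od_corner (FP e ees) fF; rewrite -mulrA.
  by have [-> _] := cross _ _ e'es f'F _ ees; rewrite (negbTE ne) mulr0.
- rewrite big_flatten big_map; apply: eq_big_seq => e ees.
  exact: od_sum (FP e ees).
Qed.

(** Induction on the dimension of the corner: [corner_split] writes e as
f + (e - f), and both corners are proper subspaces of e A e. *)
Lemma orth_decomp_exists e : selfadj_idem e ->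
  (forall x, supp K x -> tau (e * x * e) = e * x * e) ->
  exists fs, orth_decomp e fs.
Proof.
have [n] := ubnP (\dim (limg (linfun (compress e)))).
elim: n e => // n IH e le_n e_idem e_fix.
have [min|nmin] := pselect (minimal_idem e).
  case: (e_idem) => _ ee _ _ _; exists [:: e]; split=> //.
  - by move=> f; rewrite inE => /eqP->.
  - by move=> f; rewrite inE => /eqP->.
  - by move=> f; rewrite inE => /eqP->.
  - by move=> f f'; rewrite !inE => /eqP-> /eqP->; rewrite eqxx.
  - by rewrite big_seq1.
have [se ee te ste e0] := e_idem.
have [f [f_idem fne ef fe]] := corner_split e_idem e_fix nmin.
have [sf ff tf stf f0] := f_idem.
have e'_idem : selfadj_idem (e - f).
  split; first exact: suppB.
  - by rewrite mulrBl !mulrBr ee ef fe ff subrr subr0.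
  - by rewrite tauB te tf.
  - by rewrite starB ste stf.
  - by rewrite subr_eq0 eq_sym.
have sub f' : selfadj_idem f' -> f' != e -> e * f' = f' -> f' * e = f' ->
    exists fs, orth_decomp f' fs.
  move=> f'_idem ne ef' f'e; have [sf' f'f' _ _ _] := f'_idem.
  apply: IH => //; last first.
    move=> x sx; have := e_fix (f' * x * f').
    by rewrite !mulrA ef' -!mulrA f'e !mulrA => -> //; do 2?apply: suppM.
  apply: leq_trans (_ : _ < \dim (limg (linfun (compress e))))%N _ => //.
  rewrite ltnNge; apply/negP => le_dim.
  have sub : (limg (linfun (compress f')) <= limg (linfun (compress e)))%VS.
    apply/subvP => b /(mem_corner _ sf' f'f')[sb fb bf]; apply/mem_corner => //.
    by split=> //; [rewrite -fb mulrA ef' | rewrite -bf -mulrA f'e].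
  have /eqP eq_dim : (limg (linfun (compress f')) == limg (linfun (compress e)))%VS.
    by rewrite eqEdim sub.
  have : e \in limg (linfun (compress f')) by rewrite eq_dim; apply/mem_corner.
  by case/(mem_corner _ sf' f'f') => _ + _; rewrite f'e => /eqP; rewrite (negbTE ne).
have [] := @orth_decomp_flatten [:: f; e - f].
- rewrite /= inE andbT; apply: contraNneq f0 => fE.
  by rewrite -ff {1}fE mulrBl ef ff subrr.
- have fe0 : f * (e - f) = 0 by rewrite mulrBr fe ff subrr.
  have ef0 : (e - f) * f = 0 by rewrite mulrBl ef ff subrr.
  by move=> x y; rewrite !inE => /orP[]/eqP-> /orP[]/eqP->; rewrite ?eqxx.
- move=> x; rewrite !inE => /orP[]/eqP->; apply: sub => //.
  + by rewrite -subr_eq0 addrAC subrr sub0r oppr_eq0.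
  + by rewrite mulrBr ee ef.
  + by rewrite mulrBl ee fe.
by move=> fs; rewrite big_cons big_seq1 addrC subrK; exists fs.
Qed.

End Splitting.

(** * Refining decompositions along a Gelfand pair *)
Section GelfandStep.
Variables (C : numClosedFieldType) (gT : finGroupType) (H K : {group gT}).
Local Notation A := (galg C gT).
Implicit Types (x y z e f : A) (g h k : gT).
Hypothesis sHK : H \subset K.
Hypothesis gelfand : forall k, k \in K -> exists2 h, h \in H & (k ^ h = k^-1)%g.

Lemma minimal_star_coef e x y c d : selfadj_idem H e -> e * x * e = c *: e ->
  e * star x * e = d *: e -> d = c^*.
Proof.
case=> _ _ _ ste e0 xc xd; have := congr1 (@star _ _) xc.
rewrite !starM starZ ste mulrA xd => /eqP; rewrite -subr_eq0 -scalerBl scaler_eq0.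
by rewrite (negbTE e0) orbF subr_eq0 => /eqP.
Qed.

Lemma supp_sub x : supp H x -> supp K x.
Proof. by move=> sx g gK; apply: sx; apply: contra gK; apply: (subsetP sHK). Qed.

(** Averaging e x e over the conjugates by H gives an element z that commutes
with H.  It is a combination of H-class sums of K, so tau fixes it by the Gelfand
condition.  Since e is minimal for H, e z e is a multiple of e x e.  The
multiple is the sum over H of the |c h|^2, where e h e = c h *: e; it is nonzero
because c 1 = 1. *)
Lemma gelfand_corner e : selfadj_idem H e -> minimal_idem H e ->
  forall x, supp K x -> tau (e * x * e) = e * x * e.
Proof.
move=> e_idem e_min x sx; have [se ee te ste e0] := e_idem.
have [c cE] : exists c : gT -> C, forall h, h \in H -> e * gelt C h * e = c h *: e.
  have P h : exists c : C, h \in H -> e * gelt C h * e = c *: e.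
    case: (boolP (h \in H)) => [hH|_]; last by exists 0.
    by have [c ->] := e_min (gelt C h) (supp_gelt C hH); exists c.
  by have [c cP] := choice P; exists c.
have cV h : h \in H -> c h^-1%g = (c h)^*.
  move=> hH; apply: (@minimal_star_coef e (gelt C h)) => //; first exact: cE.
  by rewrite star_gelt cE ?groupV.
set y := e * x * e.
have sy : supp K y by apply: suppM (suppM (supp_sub se) sx) (supp_sub se).
pose z := \sum_(h in H) gelt C h * y * gelt C h^-1.
have zE g : z g = \sum_(h in H) y (g ^ h)%g.
  rewrite sum_ffunE; apply: eq_bigr => h _.
  by rewrite mul_geltE gelt_mulE invgK conjgE mulgA.
have tau_z : tau z = z.
  apply/ffunP => k; rewrite ffunE !zE.
  have [kK|kK] := boolP (k \in K); last first.
    by rewrite !big1 // => h hH; rewrite sy // groupJr ?groupV // (subsetP sHK).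
  have [h0 h0H <-] := gelfand kK.
  rewrite [RHS](reindex_inj (mulgI h0)) /=.
  by apply: eq_big => h; rewrite ?groupMl // => _; rewrite conjgM.
pose s := \sum_(h in H) c h * (c h)^*.
have eze : e * z * e = s *: y.
  rewrite mulr_sumr mulr_suml scaler_suml; apply: eq_bigr => h hH.
  rewrite /y !mulrA -[_ * e * gelt C h^-1 * e]mulrA -[_ * e * _]mulrA.
  rewrite -[e * gelt C h * e * x * _]mulrA cE // -cV // -!mulrA.
  rewrite [e * (gelt C h^-1 * e)]mulrA cE ?groupV //.
  by rewrite !galgZl !galgZr scalerA ?mulrA // galgZr.
have s0 : s != 0.
  have ge0 h : 0 <= c h * (c h)^* by apply: mul_conjC_ge0.
  have c1 : c 1%g = 1.
    have := cE 1%g (group1 H); rewrite gelt1 mulr1 ee => /eqP.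
    rewrite -subr_eq0 -{1}[e]scale1r -scalerBl scaler_eq0 (negbTE e0) orbF.
    by rewrite subr_eq0 eq_sym => /eqP.
  apply/eqP => /(psumr_eq0P (fun h _ => ge0 h)) /(_ 1%g (group1 H)).
  by rewrite c1 conjC1 mulr1 => /eqP; rewrite oner_eq0.
have : tau (s *: y) = s *: y by rewrite -eze !tauM te tau_z mulrA.
have -> : tau (s *: y) = s *: tau y by apply/ffunP => g; rewrite !ffunE.
by move/(congr1 (fun v => s^-1 *: v)); rewrite !scalerA mulVf // !scale1r.
Qed.

Lemma gelfand_refine es : orth_decomp H (1 : A) es ->
  exists fs, orth_decomp K (1 : A) fs.
Proof.
case=> ues idem min _ orth sum1; rewrite -sum1.
apply: orth_decomp_flatten => // e ees; apply: orth_decomp_exists.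
  by have [se ee te ste e0] := idem e ees; split=> //; apply: supp_sub.
exact: gelfand_corner (idem e ees) (min e ees).
Qed.

End GelfandStep.

(** * The Frobenius-Schur count of minimal idempotents *)
Section Count.
Variables (C : numClosedFieldType) (gT : finGroupType) (K : {group gT}).
Local Notation A := (galg C gT).
Implicit Types (x y z e f : A) (g h k : gT).

Let theta : A := \sum_(k in K) gelt C (k * k).

Lemma theta_comm k : k \in K -> theta * gelt C k = gelt C k * theta.
Proof.
move=> kK; rewrite mulr_suml mulr_sumr.
rewrite (reindex_inj (conjg_inj k^-1%g)) /=.
apply: eq_big => h; first by rewrite groupJr ?groupV.
move=> _; rewrite -!geltM; congr (gelt C _).
by rewrite -conjMg conjgE invgK !mulgA mulgKV.
Qed.

Lemma theta_central x : supp K x -> theta * x = x * theta.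
Proof.
move/galg_sum_supp => ->; rewrite mulr_sumr mulr_suml; apply: eq_bigr => k kK.
by rewrite galgZl galgZr theta_comm.
Qed.

(** Let e k e = c k *: e.  Substituting k v^-1 for k in the sum over k, v of
e v *: e (k v k) turns it into e theta tau(e), so e theta is the sum of the
e k e k = c k *: e k.  Its coefficient at 1 is the sum of the c k e(k^-1), that
is of the e(k) c k since tau e = e; and this is 1 because e e e = e. *)
Lemma theta_idem e : selfadj_idem K e -> minimal_idem K e -> (e * theta) 1%g = 1.
Proof.
move=> e_idem e_min; have [se ee te ste e0] := e_idem.
have [c cE] : exists c : gT -> C, forall h, h \in K -> e * gelt C h * e = c h *: e.
  have P h : exists c : C, h \in K -> e * gelt C h * e = c *: e.
    case: (boolP (h \in K)) => [hK|_]; last by exists 0.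
    by have [c ->] := e_min (gelt C h) (supp_gelt C hK); exists c.
  by have [c cP] := choice P; exists c.
have ec1 : \sum_(k in K) e k * c k = 1.
  have eee : e * e * e = (\sum_(k in K) e k * c k) *: e.
    rewrite {2}(galg_sum_supp se) mulr_sumr mulr_suml scaler_suml.
    by apply: eq_bigr => k kK; rewrite galgZr galgZl cE // scalerA.
  apply/eqP; rewrite -subr_eq0; move: eee; rewrite !ee => /eqP.
  rewrite eq_sym -subr_eq0 -{3}[e]scale1r -scalerBl scaler_eq0 (negbTE e0).
  by rewrite orbF.
have key : \sum_(k in K) e * gelt C k * e * gelt C k = e * theta.
  have tauE : tau e = \sum_(v in K) e v *: gelt C v^-1.
    apply/ffunP => g; rewrite {1}(galg_sum_supp se) ffunE !sum_ffunE.
    apply: eq_bigr => v _; rewrite !ffunE; congr (_ *: _); congr (_%:R).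
    by congr nat_of_bool; rewrite -(inj_eq invg_inj) invgK.
  transitivity (\sum_(v in K) \sum_(k in K) e v *: (e * gelt C (k * v * k))).
    rewrite exchange_big; apply: eq_bigr => k kK.
    rewrite {2}(galg_sum_supp se) mulr_sumr mulr_suml.
    by apply: eq_bigr => v _; rewrite galgZr galgZl !geltM !mulrA.
  transitivity (\sum_(v in K) \sum_(k in K) e v *: (e * gelt C (k * k * v^-1))).
    apply: eq_bigr => v vK; rewrite (reindex_inj (mulIg v^-1)%g) /=.
    apply: eq_big => k; first by rewrite groupMr ?groupV.
    by move=> _; rewrite mulgKV mulgA.
  transitivity (e * theta * tau e).
    rewrite tauE mulr_sumr; apply: eq_bigr => v _.
    rewrite galgZr mulr_sumr mulr_suml scaler_sumr; apply: eq_bigr => k _.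
    by rewrite -mulrA -geltM.
  by rewrite te -theta_central // -mulrA ee theta_central.
rewrite -key sum_ffunE -[RHS]ec1; apply: eq_bigr => k kK.
rewrite cE // mul_geltE mul1g ffunE mulrC; congr (_ * _).
by rewrite -{2}te ffunE.
Qed.

(** The coefficient at 1 of theta, the sum of all squares, counts the solutions of
k^2 = 1, while each minimal idempotent contributes exactly 1 to it. *)
Lemma size_orth_decomp es : orth_decomp K (1 : A) es ->
  size es = #|[set k in K | (k * k == 1)%g]|.
Proof.
case=> ues idem min _ orth sum1.
have : (theta 1%g : C) = (size es)%:R.
  rewrite -[theta]mul1r -sum1 mulr_suml sum_ffunE -sum1_size natr_sum.
  by apply: eq_big_seq => e ees; apply: theta_idem; [apply: idem|apply: min].
have -> : (theta 1%g : C) = (#|[set k in K | (k * k == 1)%g]|)%:R.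
  rewrite sum_ffunE -sum1_card natr_sum big_mkcond [RHS]big_mkcond.
  by apply: eq_bigr => k _; rewrite inE ffunE eq_sym; case: (k \in K) => //=; case: eqP.
by move/eqP; rewrite eqr_nat => /eqP.
Qed.

(** x^* x lies in e A e = C e and is nonzero, so a multiple of x^* works. *)
Lemma minimal_generates e x : selfadj_idem K e -> minimal_idem K e ->
  supp K x -> x * e = x -> x != 0 -> exists2 y, supp K y & y * x = e.
Proof.
move=> [se ee te ste e0] e_min sx xe x0.
have sss : supp K (star x * x) by apply: suppM => //; apply: supp_star.
have [c cE] := e_min _ sss.
have xxE : star x * x = c *: e.
  by rewrite -cE -!mulrA xe -{1}xe starM ste mulrA.
have c0 : c != 0.
  by apply: contra_neq x0 => c0; apply: star_mul_eq0; rewrite xxE c0 scale0r.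
exists (c^-1 *: star x); first by apply: suppZ; apply: supp_star.
by rewrite galgZl xxE scalerA mulVf // scale1r.
Qed.

End Count.

Local Close Scope ring_scope.

Local Open Scope group_scope.

(** * Involutions and idempotents of symmetric groups *)
Section SymConj.
Variable T : finType.
Implicit Types (k h : {perm T}) (x y p : T) (S : {set T}).

Lemma expg_inv_eq k i j x :
  (k ^+ i) x = (k ^+ j) x -> (k ^- i) x = (k ^- j) x.
Proof.
move=> eq; apply: (@perm_inj _ (k ^+ (i + j))).
by rewrite -!permM {1}expgD mulKg addnC expgD mulKg.
Qed.

(** Reverse every cycle of k around a base point, taking p itself as the base
point of its own cycle: h (k^i b) = k^-i b conjugates k to its inverse and
fixes p. *)
Lemma sym_gelfand p S k : p \notin S -> k \in Sym (p |: S) ->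
  exists2 h, h \in Sym S & k ^ h = k^-1.
Proof.
move=> pS; rewrite inE => kS.
(* b x is the base point of the cycle of x. *)
pose b x := if p \in porbit k x then p else odflt p [pick y in porbit k x].
have bO x : b x \in porbit k x.
  rewrite /b; case: ifP => // _; case: pickP => //= /(_ x).
  by rewrite porbit_id.
have b_h (x : T) i : b ((k ^- i) x) = b x.
  by rewrite -[x in RHS](permKV (k ^+ i)) /b porbit_perm.
have b_eq x y : y \in porbit k x -> b y = b x.
  by move=> yx; rewrite /b (_ : porbit k y = porbit k x) //; apply/eqP; rewrite eq_porbit_mem.
have ex_i x : exists i, x = (k ^+ i) (b x).
  by apply/porbitP; rewrite porbit_sym.
have [h0 h0E] : exists h0 : T -> T, forall x i, x = (k ^+ i) (b x) -> h0 x = (k ^- i) (b x).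
  have ex x : exists y, forall i, x = (k ^+ i) (b x) -> y = (k ^- i) (b x).
    have [j xj] := ex_i x; exists ((k ^- j) (b x)) => i xi.
    by apply: expg_inv_eq; rewrite -xi -xj.
  by have [h0 h0P] := choice ex; exists h0.
have b_h0 x : b (h0 x) = b x.
  by have [j xj] := ex_i x; rewrite (h0E x j xj) b_h; apply: b_eq.
have h0_inj : injective h0.
  move=> x y exy; have bxy : b x = b y by rewrite -b_h0 exy b_h0.
  have [i xi] := ex_i x; have [j yj] := ex_i y.
  rewrite xi yj -bxy -(invgK (k ^+ i)) -(invgK (k ^+ j)) -!expgVn.
  rewrite !expgVn -!(expgVn k); apply: expg_inv_eq.
  by rewrite !expgVn -h0E // exy bxy -h0E.
pose h := perm h0_inj.
exists h.
  rewrite inE; apply/subsetP => x; rewrite inE permE; apply: contraR => xS.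
  have [xp|xp] := eqVneq x p.
    have bp : b p = p by rewrite /b porbit_id.
    by rewrite xp; apply/eqP; rewrite (h0E p 0%N) bp ?invg1 perm1.
  have kx : k x = x by apply: (out_perm kS); rewrite !inE negb_or xp.
  have kix i : (k ^+ i) x = x.
    by elim: i => [|i IH]; rewrite ?perm1 // expgSr permM IH.
  have bx : b x = x by have /porbitP[i ->] := bO x.
  by apply/eqP; rewrite (h0E x 0%N) bx ?invg1 perm1.
apply/permP => y; rewrite -[y](permKV h); set x := h^-1 y.
rewrite permJ /h !(permE h0_inj) -/h; have [i xi] := ex_i x.
have bk : b (k x) = b x by apply: b_eq; rewrite -{1}[k]expg1 mem_porbit.
rewrite (h0E x i xi) (h0E (k x) i.+1); last by rewrite bk expgSr permM -xi.
by rewrite bk -permM -invMg -expgS.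
Qed.
End SymConj.

Section Involutions.
Variable T : finType.
Implicit Types (k h : {perm T}) (x y p q : T) (S : {set T}).

Definition invols S := [set k in Sym S | k * k == 1].

Lemma invols_fix S p : p \notin S ->
  [set k in invols (p |: S) | k p == p] = invols S.
Proof.
move=> pS; apply/setP => k; rewrite !inE; apply/andP/andP => -[].
  case/andP => kS kk /eqP kp; split=> //; apply/subsetP => x xk.
  have := subsetP kS x xk; rewrite !inE => /predU1P[xp|//].
  by move: xk; rewrite inE xp kp eqxx.
move=> kS kk; split; last by rewrite (out_perm kS).
by rewrite kk andbT; apply: subset_trans kS (subsetUr _ _).
Qed.

Lemma invols_move S p q : p \notin S -> q \in S ->
  [set k in invols (p |: S) | k p == q] =
  [set (k : {perm T}) * tperm p q | k in invols (S :\ q)].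
Proof.
move=> pS qS; have npq : p != q by apply: contraNneq pS => ->.
apply/setP => k; apply/idP/imsetP.
  rewrite !inE => /andP[/andP[kS /eqP kk] /eqP kp].
  have kq : k q = p by rewrite -kp -permM kk perm1.
  have comm : tperm p q * k = k * tperm p q.
    by rewrite conjgC tpermJ kp kq tpermC.
  exists (k * tperm p q); last by rewrite -mulgA tperm2 mulg1.
  rewrite !inE -mulgA [tperm p q * _]mulgA comm -!mulgA tperm2 mulg1 kk eqxx andbT.
  apply/subsetP => x; rewrite !inE permM.
  have [->|nxq] := eqVneq x q; first by rewrite kq tpermL eqxx.
  have [->|nxp] := eqVneq x p; first by rewrite kp tpermR eqxx.
  apply: contraR => xS; rewrite (out_perm kS) ?tpermD ?(eq_sym p) ?(eq_sym q) //.
  by rewrite !inE negb_or nxp.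
case=> h; rewrite !inE => /andP[hS /eqP hh] ->.
have hp : h p = p by rewrite (out_perm hS) // !inE negb_and pS orbT.
have hq : h q = q by rewrite (out_perm hS) // !inE eqxx.
have comm : tperm p q * h = h * tperm p q by rewrite conjgC tpermJ hp hq.
rewrite permM hp tpermL eqxx andbT -mulgA [tperm p q * _]mulgA comm -!mulgA.
rewrite tperm2 mulg1 hh eqxx andbT; apply: perm_onM.
  by apply: subset_trans hS _; apply/subsetP => x; rewrite !inE => /andP[_ ->]; rewrite orbT.
apply: subset_trans (tperm_on p q) _; apply/subsetP => x; rewrite !inE.
by case/orP => [->//|/eqP->]; rewrite qS orbT.
Qed.

(** An involution of S either fixes p, or exchanges p with some q and is an
involution of the rest: the recursion of [syt_totalS]. *)
Lemma card_invols S : #|invols S| = syt_total #|S|.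
Proof.
have [n] := ubnP #|S|; elim: n S => // n IH S le_n.
have [->|[p pS]] := set_0Vmem S.
  rewrite cards0 syt_total0 -[RHS](cards1 (1 : {perm T})); congr #|pred_of_set _|.
  apply/setP => k; rewrite !inE; apply/andP/eqP => [[kS _]|->].
    by apply/permP => x; rewrite perm1 (out_perm kS) // inE.
  by rewrite mulg1 eqxx perm_on1.
set R := S :\ p; have pR : p \notin R by rewrite !inE eqxx.
have SE : S = p |: R by rewrite setD1K.
have cS : #|S| = #|R|.+1 by rewrite (cardsD1 p) pS.
rewrite SE -sum1_card (partition_big (fun k : {perm T} => k p) (mem (p |: R))) /=; last first.
  by move=> k; rewrite !inE => /andP[kS _]; have := perm_closed p kS; rewrite !inE eqxx.
have sum_fib q : (\sum_(k in invols (p |: R) | k p == q) 1 =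
    #|[set k in invols (p |: R) | k p == q]|)%N.
  by rewrite -sum1dep_card; apply: eq_bigl => k; rewrite inE.
rewrite big_setU1 //= sum_fib invols_fix // -SE cS syt_totalS.
rewrite IH; last by rewrite -ltnS -cS.
congr (_ + _)%N.
transitivity (\sum_(q in R) syt_total #|R|.-1); last by rewrite sum_nat_const.
apply: eq_bigr => q qR; rewrite SE sum_fib invols_move // card_imset; last exact: mulIg.
have cR : #|R| = #|R :\ q|.+1 by rewrite (cardsD1 q R) qR.
rewrite IH; first by congr syt_total; rewrite -[#|R :\ q|]/(#|R :\ q|.+1.-1) -cR.
by apply: (leq_trans _ (le_n : (#|S| <= n)%N)); rewrite cS cR ltnW.
Qed.

End Involutions.

Section SymIdempotents.
Variables (C : numClosedFieldType) (T : finType).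
Local Open Scope ring_scope.

(** Points are added to S one at a time; for a single permutation the unit is
already a minimal idempotent. *)
Theorem sym_orth_decomp (S : {set T}) :
  exists2 es, orth_decomp (Sym_group S) (1 : galg C {perm T}) es
            & size es = syt_total #|S|.
Proof.
suff [es od] : exists es, orth_decomp (Sym_group S) (1 : galg C {perm T}) es.
  by exists es => //; rewrite (size_orth_decomp od) -card_invols.
have [n] := ubnP #|S|; elim: n S => // n IH S le_n.
have [->|[p pS]] := set_0Vmem S; last first.
  have [|es od] := IH (S :\ p).
    by rewrite -ltnS (leq_trans _ le_n) // [in leqRHS](cardsD1 p) pS.
  apply: (gelfand_refine _ _ od).
    by apply/subsetP => k; rewrite !inE => kS; apply: subset_trans kS (subsetDl _ _).
  move=> k kS; have [||h hS hk] := @sym_gelfand T p (S :\ p) k.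
  - by rewrite !inE eqxx.
  - by rewrite setD1K.
  by exists h.
have triv (x : galg C {perm T}) : supp (Sym_group (set0 : {set T})) x ->
    x = (x 1%g : C) *: (1 : galg C {perm T}).
  move=> sx; rewrite {1}(galg_sum_supp sx) (bigD1 (1%g : {perm T})) ?group1 //=.
  rewrite gelt1 big1 ?addr0 //.
  move=> k /andP[kS nk]; case/eqP: nk; apply/permP => x'.
  by move: kS; rewrite inE perm1 => /out_perm->; rewrite ?inE.
exists [:: 1]; split=> //.
- move=> f; rewrite inE => /eqP->; split; rewrite ?mulr1 ?tau1 ?star1 //.
    exact: supp1.
  apply/eqP => /ffunP/(_ 1%g); rewrite !ffunE eqxx => /eqP.
  by rewrite oner_eq0.
- move=> f; rewrite inE => /eqP-> x sx; exists (x 1%g).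
  by rewrite mul1r mulr1; apply: triv.
- by move=> f _; rewrite mul1r mulr1.
- by move=> f f'; rewrite !inE => /eqP-> /eqP->; rewrite eqxx.
- by rewrite big_seq1.
Qed.

End SymIdempotents.

Local Close Scope group_scope.

(** * Rook matrices as partial injections *)
Section RookMap.
Variable N : nat.
Implicit Types (A B g : rook N) (i j p q : 'I_N).

(** Columns are sources and rows are targets: products act on the left. *)
Definition rook_map A p : option 'I_N := [pick i | rook_mx A i p == 1%N].

Lemma rook_colP A i j p :
  rook_mx A i p = 1%N -> rook_mx A j p = 1%N -> i = j.
Proof.
move=> Ai Aj; apply: contraTeq isT => nij.
case/and3P: (rookP A) => _ _ /forallP/(_ p).
by rewrite (bigD1 i) //= (bigD1 j) 1?eq_sym //= Ai Aj.
Qed.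

Lemma rook_rowP A i p q :
  rook_mx A i p = 1%N -> rook_mx A i q = 1%N -> p = q.
Proof.
move=> Ai Aj; apply: contraTeq isT => npq.
case/and3P: (rookP A) => _ /forallP/(_ i) + _.
by rewrite (bigD1 p) //= (bigD1 q) 1?eq_sym //= Ai Aj.
Qed.

Lemma rook_mapE A i p : rook_mx A i p = (rook_map A p == Some i) :> nat.
Proof.
rewrite /rook_map; case: pickP => [j /eqP Aj|none].
  have [[<-]|/eqP ne] := eqVneq (Some j) (Some i); first by rewrite Aj.
  case/and3P: (rookP A) => /forallP/(_ i)/forallP/(_ p) + _ _.
  case Ai: (rook_mx A i p) => [|[]] //= _.
  by case: ne; congr Some; apply: rook_colP Aj Ai.
have := none i; case/and3P: (rookP A) => /forallP/(_ i)/forallP/(_ p) + _ _.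
by case: (rook_mx A i p) => [|[]].
Qed.

Lemma rook_map_inj A p q i : rook_map A p = Some i -> rook_map A q = Some i -> p = q.
Proof.
by move=> Ap Aq; apply: (@rook_rowP A i); rewrite rook_mapE ?Ap ?Aq eqxx.
Qed.

Lemma rook_ext A B : rook_map A =1 rook_map B -> A = B.
Proof. by move=> eqAB; apply/val_inj/matrixP => i p /=; rewrite !rook_mapE eqAB. Qed.

Definition partial_inj (f : 'I_N -> option 'I_N) :=
  forall p q i, f p = Some i -> f q = Some i -> p = q.

(** The default value of [insubd] is never reached on a [partial_inj]. *)
Definition mk_rook (f : 'I_N -> option 'I_N) : rook N :=
  insubd (rook_one N) (\matrix_(i, p) nat_of_bool (f p == Some i))%R.

Lemma sum_nat_le1 (T : finType) (P : pred T) :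
  (forall x y, P x -> P y -> x = y) -> (\sum_x nat_of_bool (P x) <= 1)%N.
Proof.
move=> inj; case: (pickP P) => [x Px|none]; last by rewrite big1 // => x; rewrite none.
rewrite (bigD1 x) //= Px big1 // => y; case Py: (P y) => // /eqP[].
exact: inj.
Qed.

Lemma mk_rookE f : partial_inj f -> rook_map (mk_rook f) =1 f.
Proof.
move=> inj p.
have rk : is_rook (\matrix_(i, p) nat_of_bool (f p == Some i))%R.
  apply/and3P; split; apply/forallP => i.
  - by apply/forallP => j; rewrite mxE; case: eqP.
  - under eq_bigr do rewrite mxE.
    by apply: sum_nat_le1 => x y /eqP fx /eqP fy; apply: inj fx fy.
  under eq_bigr do rewrite mxE.
  by apply: sum_nat_le1 => x y /eqP -> /eqP[].
have E i : rook_mx (mk_rook f) i p = (f p == Some i) :> nat.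
  by rewrite /mk_rook -/(val _) insubdK ?mxE.
have Ei i : (rook_map (mk_rook f) p == Some i) = (f p == Some i).
  by have := E i; rewrite rook_mapE; do 2!case: (_ == _).
case fp: (f p) => [i|]; first by apply/eqP; rewrite Ei fp.
by case mp: (rook_map _ p) => [i|//]; have := Ei i; rewrite mp fp eqxx.
Qed.

Lemma rook_mapM A B p : rook_map (A * B)%g p = obind (rook_map A) (rook_map B p).
Proof.
have E i : rook_mx (A * B)%g i p = (obind (rook_map A) (rook_map B p) == Some i) :> nat.
  rewrite [LHS]mxE; under eq_bigr do rewrite !rook_mapE.
  case Bp: (rook_map B p) => [j|] /=; last by rewrite big1 // => j _; rewrite mulr0.
  rewrite (bigD1 j) //= eqxx mulr1 big1 ?addr0 // => j' /negbTE nj.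
  by rewrite (inj_eq Some_inj) [j == j']eq_sym nj mulr0.
have Ei i : (rook_map (A * B)%g p == Some i) = (obind (rook_map A) (rook_map B p) == Some i).
  by have := E i; rewrite rook_mapE; do 2!case: (_ == _).
case fp: (obind _ _) Ei => [i|] Ei; first by apply/eqP; rewrite Ei.
by case mp: (rook_map _ p) Ei => [i|//] /(_ i); rewrite eqxx.
Qed.

Lemma rook_map1 p : rook_map 1%g p = Some p.
Proof.
have := rook_mapE 1%g p p; rewrite [rook_mx _]/(1%:M)%R mxE eqxx.
by case: eqP.
Qed.

Definition rook_dom A : {set 'I_N} := [set p | rook_map A p].

Lemma mem_dom A p : (p \in rook_dom A) = rook_map A p :> bool.
Proof. by rewrite inE. Qed.

Lemma rook_domM A B : rook_dom (A * B)%g \subset rook_dom B.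
Proof.
by apply/subsetP => p; rewrite !inE rook_mapM; case: (rook_map B p).
Qed.

End RookMap.

Section RookEmb.
Variable n : nat.

Definition rook_last : 'I_(n + 1) := rshift n ord0.

Lemma rook_map_emb_last (a : rook n) : rook_map (rook_emb a) rook_last = Some rook_last.
Proof.
have := rook_mapE (rook_emb a) rook_last rook_last.
by rewrite block_mxEdr mxE eqxx; case: eqP.
Qed.

Lemma rook_map_emb_lshift (a : rook n) p :
  rook_map (rook_emb a) (lshift 1 p) = omap (lshift 1) (rook_map a p).
Proof.
have E (i : 'I_n) : (rook_map (rook_emb a) (lshift 1 p) == Some (lshift 1 i)) =
                    (rook_map a p == Some i).
  have := rook_mapE (rook_emb a) (lshift 1 i) (lshift 1 p).
  by rewrite block_mxEul rook_mapE; do 2!case: (_ == _).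
case ap: (rook_map a p) => [i|] /=; first by apply/eqP; rewrite E ap.
case mp: (rook_map _ _) => [x|//]; case: (split_ordP x) mp => j -> mp.
  by have := E j; rewrite mp ap eqxx.
have := rook_map_emb_last a; rewrite /rook_last (ord1 j) in mp * => /(rook_map_inj mp) /eqP.
by rewrite eq_lrshift.
Qed.

End RookEmb.

Local Open Scope ring_scope.

(** * Modules with a permuted basis, and their induction *)

(** b is a basis of V indexed by D, on which M acts through maps of D to itself
that need not be injective; c is the dual basis. *)
Definition is_perm_basis (F : fieldType) (M : monoidType) (V : fmodule F M)
    (X : finType) (D : {set X}) (xact : M -> X -> X)
    (b : X -> V) (c : X -> 'Hom(V, F^o)) : Prop :=
  [/\ forall a x, x \in D -> act V a (b x) = b (xact a x),
      forall x y, x \in D -> y \in D -> c x (b y) = (x == y)%:R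
    & forall v, v = \sum_(x in D) c x v *: b x].

Section PermBasis.
Variables (F : fieldType) (M : monoidType) (V : fmodule F M).
Variables (X : finType) (D : {set X}) (xact : M -> X -> X).
Variables (b : X -> V) (c : X -> 'Hom(V, F^o)).
Hypothesis basis : is_perm_basis D xact b c.

Lemma perm_basis_dim : fmod_dim V = #|D|.
Proof.
case: basis => _ ortho span; pose Y := [tuple b (enum_val i) | i < #|D|].
have nthY (i : 'I_#|D|) : Y`_i = b (enum_val i) by rewrite -tnth_nth tnth_mktuple.
suff Y_basis : basis_of fullv Y by rewrite /fmod_dim (size_basis Y_basis).
apply/andP; split.
  rewrite eqEsubv subvf /=; apply/subvP => v _; rewrite [v]span.
  apply: rpred_sum => x xD; apply: rpredZ; apply: memv_span.
  by rewrite -(enum_rankK_in xD xD) -nthY mem_nth ?size_tuple.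
apply/freeP => k sum0 i; have := congr1 (c (enum_val i)) sum0.
rewrite linear_sum linear0 (bigD1 i) //= big1 ?addr0 => [|j nj].
  by rewrite nthY linearZ /= ortho ?enum_valP // eqxx /GRing.scale /= mulr1.
rewrite nthY linearZ /= ortho ?enum_valP // (inj_eq enum_val_inj) eq_sym.
by rewrite (negbTE nj) scaler0.
Qed.

End PermBasis.

Section IndBasis.
Variables (F : fieldType) (H G : finMonoidType).
Variable phi : UMagmaMorphism.type H G.
Variable V : fmodule F H.
Variables (X Y : finType) (D : {set X}) (E : {set Y}).
Variables (xact : H -> X -> X) (yact : G -> Y -> Y).
Variables (b : X -> V) (c : X -> 'Hom(V, F^o)).
Hypothesis basis : is_perm_basis D xact b c.
Hypothesis xactD : forall a x, x \in D -> xact a x \in D.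

(* theta realises the quotient of G x X by (g phi(a), x) ~ (g, a x), and
   (sg, sx) is a section of it to which every pair is linked in one step. *)
Variables (theta : G -> X -> Y) (sg : Y -> G) (sx : Y -> X).
Hypothesis thetaE : forall g x, x \in D -> theta g x \in E.
Hypothesis theta_bal : forall g a x, x \in D -> theta (g * phi a)%g x = theta g (xact a x).
Hypothesis theta_act : forall g h x, x \in D -> theta (g * h)%g x = yact g (theta h x).
Hypothesis sxD : forall y, y \in E -> sx y \in D.
Hypothesis theta_sec : forall y, y \in E -> theta (sg y) (sx y) = y.
Hypothesis canonical_form : forall g x, x \in D ->
  exists2 a, x = xact a (sx (theta g x)) & (g * phi a)%g = sg (theta g x).

Local Notation T := {ffun G -> V}.
Local Notation B := (balance_space phi V).

Definition eval_at (g : G) (t : T) : V := t g.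
Lemma eval_at_is_linear g : linear (eval_at g).
Proof. by move=> k u v; rewrite /eval_at !ffunE. Qed.
HB.instance Definition _ g :=
  GRing.isSemilinear.Build F T V _ (eval_at g)
    (GRing.semilinear_linear (eval_at_is_linear g)).

(** The coordinate along y of the linear extension of theta; it kills the balance
relations, hence gives the dual basis of the induced module. *)
Definition tens_coord (y : Y) : 'Hom(T, F^o) :=
  \sum_(g : G) \sum_(x in D | theta g x == y) (c x \o linfun (eval_at g))%VF.

Lemma tens_coordE y g v :
  tens_coord y (tens g v) = \sum_(x in D | theta g x == y) c x v.
Proof.
rewrite /tens_coord sum_lfunE (bigD1 g) //= [X in _ + X]big1 ?addr0.
  rewrite sum_lfunE; apply: eq_bigr => x _.
  by rewrite comp_lfunE lfunE /= /eval_at ffunE eqxx.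
move=> h /negbTE nh; rewrite sum_lfunE big1 // => x _.
by rewrite comp_lfunE lfunE /= /eval_at ffunE nh linear0.
Qed.

Lemma tens_coord_balance y t : t \in B -> tens_coord y t = 0.
Proof.
case: basis => actb ortho span.
suff sub : (B <= lker (tens_coord y))%VS.
  by move/(subvP sub); rewrite memv_ker => /eqP.
apply/subv_sumP => g _; apply/subv_sumP => a _; apply/subvP => _ /memv_imgP[v _ ->].
rewrite memv_ker lfunE /= /balance linearB /= !tens_coordE subr_eq0; apply/eqP.
have cE x : x \in D -> c x (act V a v) = \sum_(x' in D | xact a x' == x) c x' v.
  move=> xD; rewrite {1}[v]span !linear_sum /= [RHS]big_mkcondr /=.
  apply: eq_bigr => x' x'D; rewrite !linearZ /= actb // ortho ?xactD // eq_sym.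
  by case: eqP => _; rewrite ?scaler0 // /GRing.scale /= mulr1.
transitivity (\sum_(x in D | theta g x == y) \sum_(x' in D | xact a x' == x) c x' v).
  rewrite (exchange_big_dep (mem D)) /=; last by move=> x x' _ /andP[].
  rewrite big_mkcondr; apply: eq_bigr => x xD; rewrite theta_bal //.
  case: eqP => [th|nth].
    rewrite (big_pred1 (xact a x)) // => x' /=.
    rewrite xD [x' == _]eq_sym /=; have [<-|_] := eqVneq (xact a x) x'; last by rewrite andbF.
    by rewrite xactD // th eqxx.
  rewrite big_pred0 // => x'; apply/negP => /andP[/andP[_ /eqP th] /andP[_ /eqP xx]].
  by apply: nth; rewrite xx.
by apply: eq_bigr => x /andP[xD _]; rewrite cE.
Qed.

Definition ind_vec (y : Y) : Ind phi V := quot_proj B (tens (sg y) (b (sx y))).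
Definition ind_coord (y : Y) : 'Hom(Ind phi V, F^o) := (tens_coord y \o quot_lift B)%VF.

Lemma ind_coord_proj y t : ind_coord y (quot_proj B t) = tens_coord y t.
Proof.
rewrite comp_lfunE; apply/eqP; rewrite eq_sym -subr_eq0 -linearB; apply/eqP.
by apply: tens_coord_balance; apply: quot_projK.
Qed.

Lemma proj_tens g x : x \in D ->
  quot_proj B (tens g (b x)) = ind_vec (theta g x).
Proof.
case: basis => actb _ _ xD; have [a xE gE] := canonical_form g xD.
rewrite /ind_vec -gE {1}xE -actb ?sxD ?thetaE //.
apply/esym/quot_proj_eq; exact: mem_balance.
Qed.

Lemma ind_perm_basis : is_perm_basis E yact ind_vec ind_coord.
Proof.
case: (basis) => actb ortho span; split=> [g y yE|y z yE zE|w].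
- rewrite /ind_vec /= ind_act_proj lmul_tens proj_tens ?sxD //.
  by rewrite theta_act ?sxD // theta_sec.
- rewrite ind_coord_proj tens_coordE big_mkcondr (bigD1 (sx z)) ?sxD //=.
  rewrite theta_sec // ortho ?sxD // eqxx big1 ?addr0 => [|x /andP[xD nx]].
    by rewrite eq_sym; case: eqP.
  by rewrite ortho ?sxD // (negbTE nx); case: ifP.
- set t := quot_lift B w.
  have -> : w = quot_proj B t by rewrite quot_liftK.
  transitivity (\sum_g \sum_(x in D) c x (t g) *: ind_vec (theta g x)).
    rewrite {1}[t]tens_sum linear_sum; apply: eq_bigr => g _ /=.
    rewrite {1}[t g]span !linear_sum; apply: eq_bigr => x xD /=.
    by rewrite !linearZ /= proj_tens.
  under [RHS]eq_bigr => y yE.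
    rewrite ind_coord_proj {1}[t]tens_sum linear_sum scaler_suml.
    under eq_bigr do rewrite /= tens_coordE scaler_suml.
    over.
  rewrite [RHS]exchange_big; apply: eq_bigr => g _ /=.
  rewrite [RHS](exchange_big_dep (mem D)) /=; last by move=> y x _ /andP[].
  apply: eq_bigr => x xD; rewrite (big_pred1 (theta g x)) // => y.
  by rewrite xD /= [y == _]eq_sym; have [<-|_] := eqVneq (theta g x) y; rewrite ?andbF ?thetaE.
Qed.

End IndBasis.

(** * The set induced from the restriction of a set of rook matrices *)
Section RookInd.
Variable n : nat.
Local Notation N := (n + 1)%N.
Local Notation w := (rook_last n).
Implicit Types (A B g : rook N) (a : rook n) (p q x : 'I_N) (m : nat).

Definition rook_cols m : {set rook N} :=
  [set A | rook_dom A \subset [set p : 'I_N | (p < m)%N]].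

Lemma rook_colsP m A :
  reflect (forall p, (m <= p)%N -> rook_map A p = None) (A \in rook_cols m).
Proof.
rewrite inE; apply: (iffP subsetP) => [sub p le_mp|none p].
  by case Ap: (rook_map A p) => [i|//]; have := sub p; rewrite !inE Ap ltnNge le_mp => /(_ isT).
by rewrite !inE ltnNge => Ap; apply/negP => /none A0; rewrite A0 in Ap.
Qed.

Lemma rook_cols_mul m g A : A \in rook_cols m -> (g * A)%g \in rook_cols m.
Proof. by rewrite !inE; apply: subset_trans (rook_domM g A). Qed.

Definition pos_ord m : 'I_N := insubd w m.

Lemma val_pos_ord m : (m <= n)%N -> pos_ord m = m :> nat.
Proof. by move=> le_mn; rewrite /pos_ord -/(val _) insubdK // unfold_in addn1 ltnS. Qed.

(** The column sent to the last row, or column m (which is empty) if there is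
none; in the latter case [rook_extend m A] sends m to the last row. *)
Definition last_pos m A : 'I_N :=
  odflt (pos_ord m) [pick q | rook_map A q == Some w].

Definition ext_fun m A p : option 'I_N :=
  if p == last_pos m A then Some w else rook_map A p.
Definition rook_extend m A : rook N := mk_rook (ext_fun m A).

Definition ext_len m q : nat := if q == m :> nat then m.+1 else m.

Lemma last_posP m A : (m <= n)%N -> A \in rook_cols m ->
  (rook_map A (last_pos m A) = Some w /\ (last_pos m A < m)%N) \/
  (last_pos m A = m :> nat /\ forall p, rook_map A p <> Some w).
Proof.
move=> le_mn /rook_colsP Am; rewrite /last_pos; case: pickP => [q /eqP Aq|none] /=.
  by left; split=> //; rewrite ltnNge; apply/negP => /Am; rewrite Aq.
by right; split; [apply: val_pos_ord | move=> p /eqP; rewrite none].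
Qed.

Lemma last_pos_leq m A : (m <= n)%N -> A \in rook_cols m -> (last_pos m A <= m)%N.
Proof. by move=> le_mn /(last_posP le_mn)[[_ /ltnW]|[->]]. Qed.

Lemma ext_fun_inj m A : (m <= n)%N -> A \in rook_cols m -> partial_inj (ext_fun m A).
Proof.
move=> le_mn Am p q i; rewrite /ext_fun.
case: (last_posP le_mn Am) => [[Aq _]|[_ none]].
  case: eqP => [->|_]; case: eqP => [->|_] //.
  - by move=> [<-] Aq'; apply: rook_map_inj Aq Aq'.
  - by move=> Ap [iw]; rewrite -iw in Ap; apply: rook_map_inj Ap Aq.
  - exact: rook_map_inj.
case: eqP => [->|_]; case: eqP => [->|_] //.
- by move=> [<-] /none.
- by move=> Ap [iw]; rewrite -iw in Ap; case: (none _ Ap).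
- exact: rook_map_inj.
Qed.

Lemma rook_map_extend m A p : (m <= n)%N -> A \in rook_cols m ->
  rook_map (rook_extend m A) p = if p == last_pos m A then Some w else rook_map A p.
Proof. by move=> le_mn Am; rewrite mk_rookE //; apply: ext_fun_inj. Qed.

Lemma rook_extend_cols m A : (m <= n)%N -> A \in rook_cols m ->
  rook_extend m A \in rook_cols (ext_len m (last_pos m A)).
Proof.
move=> le_mn Am; apply/rook_colsP => p; rewrite rook_map_extend // /ext_len.
case: (last_posP le_mn Am) => [[_ ltm]|[-> _]].
  rewrite ltn_eqF // => le_mp; case: eqP => [pq|_]; last exact: (rook_colsP _ _ Am).
  by move: le_mp; rewrite pq leqNgt ltm.
rewrite eqxx => lt_mp; case: eqP => [pq|_]; last by apply: (rook_colsP _ _ Am); apply: ltnW.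
by move: (lt_mp); rewrite pq; case: (last_posP le_mn Am) => [[_]|[-> _]]; lia.
Qed.

Lemma rook_emb_eq_last a i : obind (rook_map (rook_emb a)) i = Some w <-> i = Some w.
Proof.
split=> [|->]; last exact: rook_map_emb_last.
case: i => //= i ai; congr Some; apply: rook_map_inj ai _.
exact: rook_map_emb_last.
Qed.

Lemma last_pos_emb m a A : last_pos m (rook_emb a * A)%g = last_pos m A.
Proof.
rewrite /last_pos; congr odflt; apply: eq_pick => q /=.
by rewrite rook_mapM; apply/eqP/eqP => /rook_emb_eq_last.
Qed.

Lemma rook_extend_emb m a A : (m <= n)%N -> A \in rook_cols m ->
  rook_extend m (rook_emb a * A)%g = (rook_emb a * rook_extend m A)%g.
Proof.
move=> le_mn Am; apply: rook_ext => p.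
rewrite rook_map_extend ?rook_cols_mul // last_pos_emb !rook_mapM rook_map_extend //.
by case: eqP => //= _; rewrite rook_map_emb_last.
Qed.

(** Among the matrices of [rook_cols m] whose [last_pos] is q, this one generates
the others under the smaller rook monoid. *)
Definition gen_fun m q p : option 'I_N :=
  if (p < m)%N then Some (if p == q then w else p) else None.
Definition gen_rook m q : rook N := mk_rook (gen_fun m q).

Lemma lt_neq_last m p : (m <= n)%N -> (p < m)%N -> p != w.
Proof.
by move=> le_mn lt_pm; apply: contraTneq lt_pm => ->; rewrite -leqNgt /= addn0.
Qed.

Lemma gen_fun_inj m q : (m <= n)%N -> partial_inj (gen_fun m q).
Proof.
move=> le_mn x y i; rewrite /gen_fun; case: ltnP => // xm [<-]; case: ltnP => // ym [].
have /eqP nxw := lt_neq_last le_mn xm; have /eqP nyw := lt_neq_last le_mn ym.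
by have [->|_] := eqVneq x q; have [->|_] := eqVneq y q => // /esym.
Qed.

Lemma rook_map_gen m q p : (m <= n)%N ->
  rook_map (gen_rook m q) p = if (p < m)%N then Some (if p == q then w else p) else None.
Proof. by move=> le_mn; rewrite mk_rookE //; apply: gen_fun_inj. Qed.

Lemma gen_rook_cols m q : (m <= n)%N -> gen_rook m q \in rook_cols m.
Proof.
by move=> le_mn; apply/rook_colsP => p le_mp; rewrite rook_map_gen // ltnNge le_mp.
Qed.

Lemma last_pos_gen m q : (m <= n)%N -> (q <= m)%N -> last_pos m (gen_rook m q) = q.
Proof.
move=> le_mn le_qm; case: (last_posP le_mn (gen_rook_cols q le_mn)) => [[]|[eq_m none]].
  rewrite rook_map_gen // => + lt; rewrite lt => -[]; case: eqP => // _ eqw.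
  by have := lt_neq_last le_mn lt; rewrite eqw eqxx.
apply/val_inj; rewrite /= eq_m; apply/eqP; rewrite eqn_leq le_qm andbT leqNgt.
by apply/negP => lt_qm; apply: (none q); rewrite rook_map_gen // lt_qm eqxx.
Qed.

(** The canonical g with g * rook_extend m (gen_rook m q) = B. *)
Definition transp_fun m q B x : option 'I_N :=
  if x == w then rook_map B q
  else if (x < m)%N && (x != q) then rook_map B x else None.
Definition transp m q B : rook N := mk_rook (transp_fun m q B).

Lemma transp_fun_inj m q B : partial_inj (transp_fun m q B).
Proof.
move=> x y i; rewrite /transp_fun.
have [->|_] := eqVneq x w; have [->|_] := eqVneq y w => //.
- by case: ifP => // /andP[_ /eqP nyq] Bq By; case: nyq; apply: rook_map_inj By Bq.
- by case: ifP => // /andP[_ /eqP nxq] Bx Bq; case: nxq; apply: rook_map_inj Bx Bq.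
by do 2!case: ifP => // _; apply: rook_map_inj.
Qed.

Lemma rook_map_transp m q B x : rook_map (transp m q B) x =
  if x == w then rook_map B q
  else if (x < m)%N && (x != q) then rook_map B x else None.
Proof. by rewrite mk_rookE //; apply: transp_fun_inj. Qed.

Lemma transpK m q B : (m <= n)%N -> (q <= m)%N -> B \in rook_cols (ext_len m q) ->
  (transp m q B * rook_extend m (gen_rook m q))%g = B.
Proof.
move=> le_mn le_qm /rook_colsP Bm; apply: rook_ext => p.
rewrite rook_mapM rook_map_extend ?gen_rook_cols // last_pos_gen //.
have [->|npq] := eqVneq p q; first by rewrite /= rook_map_transp eqxx.
rewrite rook_map_gen //; case: ltnP => [lt_pm|le_mp] /=.
  by rewrite (negbTE npq) rook_map_transp (negbTE (lt_neq_last le_mn lt_pm)) lt_pm npq.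
symmetry; apply: Bm; rewrite /ext_len; case: eqP => // qm.
by rewrite ltn_neqAle le_mp andbT; apply: contra npq => /eqP mp; apply/eqP/val_inj; rewrite /= qm.
Qed.

(** The element of the smaller rook monoid that takes [gen_rook] to A. *)
Definition body_fun m A (p : 'I_n) : option 'I_n :=
  if (p < m)%N && (lshift 1 p != last_pos m A) then
    obind (fun x : 'I_N => insub (val x)) (rook_map A (lshift 1 p))
  else None.
Definition body_rook m A : rook n := mk_rook (body_fun m A).

Lemma rook_map_body m A (p : 'I_n) : (m <= n)%N -> A \in rook_cols m ->
  omap (lshift 1) (rook_map (body_rook m A) p) =
  if (p < m)%N && (lshift 1 p != last_pos m A) then rook_map A (lshift 1 p) else None.
Proof.
move=> le_mn Am.
have key (x : 'I_n) : omap (lshift 1) (body_fun m A x) =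
    if (x < m)%N && (lshift 1 x != last_pos m A) then rook_map A (lshift 1 x) else None.
  rewrite /body_fun; case: ifP => // /andP[_ nx].
  case Ax: (rook_map A (lshift 1 x)) => [y|] //=.
  case: (split_ordP y) Ax => j -> Ax; first by rewrite /= valK.
  case/eqP: nx; rewrite (ord1 j) -/w in Ax.
  case: (last_posP le_mn Am) => [[Aq _]|[_ /(_ _ Ax)//]].
  exact: rook_map_inj Ax Aq.
rewrite mk_rookE // => x y i fx fy.
have := key x; have := key y; rewrite fx fy /=.
do 2!case: ifP => // _; move=> /esym Ay /esym Ax.
exact: lshift_inj (rook_map_inj Ax Ay).
Qed.

Lemma body_gen m A : (m <= n)%N -> A \in rook_cols m ->
  A = (rook_emb (body_rook m A) * gen_rook m (last_pos m A))%g.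
Proof.
move=> le_mn Am; apply: rook_ext => p; rewrite rook_mapM rook_map_gen //.
case: ltnP => [lt_pm|le_mp] /=; last exact: (rook_colsP _ _ Am).
case: eqP => [pE|/eqP np].
  rewrite rook_map_emb_last pE; case: (last_posP le_mn Am) => [[->]|[eqm _]] //.
  by move: lt_pm; rewrite pE eqm ltnn.
have lt_pn : (p < n)%N := leq_trans lt_pm le_mn.
have pE : p = lshift 1 (Ordinal lt_pn) by apply: val_inj.
by rewrite pE rook_map_emb_lshift rook_map_body //= lt_pm -pE np.
Qed.

(** Moving the body of A across the tensor sign puts (g, A) in canonical form: the
result depends on g only through g * rook_extend m A. *)
Lemma body_transp m g A : (m <= n)%N -> A \in rook_cols m ->
  (g * rook_emb (body_rook m A))%g = transp m (last_pos m A) (g * rook_extend m A)%g.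
Proof.
move=> le_mn Am; apply: rook_ext => x.
rewrite rook_mapM rook_map_transp !rook_mapM !rook_map_extend // eqxx.
case: eqP => [->|/eqP nxw]; first by rewrite rook_map_emb_last.
case: (split_ordP x) => [j xE|j xE]; last by rewrite xE (ord1 j) eqxx in nxw.
rewrite xE rook_map_emb_lshift rook_map_body //=; case: ifP => // /andP[_ nj].
by rewrite (negbTE nj).
Qed.

End RookInd.

(** * The iterated module as a span of rook matrices *)
Section IndResBasis.
Variables (F : fieldType) (n : nat).
Local Notation N := (n + 1)%N.

(** Copies, labelled by i in L, of the sets [rook_cols (m i)]. *)
Definition rook_index (I : finType) (L : {set I}) (m : I -> nat) : {set I * rook N} :=
  [set y | (y.1 \in L) && (y.2 \in rook_cols n (m y.1))].
Definition rook_act (I : finType) (g : rook N) (y : I * rook N) : I * rook N :=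
  (y.1, (g * y.2)%g).

Definition ext_labels (I : finType) (L : {set I}) (m : I -> nat) : {set I * 'I_N} :=
  [set x : I * 'I_N | (x.1 \in L) && (x.2 <= m x.1)%N].
Definition ext_lens (I : finType) (m : I -> nat) (x : I * 'I_N) : nat :=
  ext_len (m x.1) x.2.

Lemma sum_ext_labels (I : finType) (L : {set I}) (m : I -> nat) (f : nat -> nat) :
  (forall i, i \in L -> (m i <= n)%N) ->
  (\sum_(x in ext_labels L m) f (ext_lens m x) =
   \sum_(i in L) (f (m i).+1 + m i * f (m i)))%N.
Proof.
move=> le_mn.
transitivity (\sum_(i in L) \sum_(q : 'I_N | (q <= m i)%N) f (ext_len (m i) q))%N.
  rewrite pair_big_dep /=; apply: eq_bigl => x; by rewrite inE.
apply: eq_bigr => i iL; have lt_mN : (m i < N)%N by rewrite addn1 ltnS le_mn.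
rewrite (bigD1 (Ordinal lt_mN)) //= /ext_len eqxx; congr (_ + _)%N.
rewrite (eq_bigr (fun=> f (m i))) => [|q /andP[_ nq]]; last first.
  by case: eqP => // qm; case/eqP: nq; apply: val_inj.
rewrite sum_nat_const; congr (_ * _)%N.
have inj : injective (widen_ord (ltnW lt_mN)).
  by move=> x y /(congr1 val) /= /val_inj.
rewrite -[RHS]card_ord -(card_codom inj); apply: eq_card => q.
apply/andP/codomP => [[le_qm nq]|[x ->]]; last first.
  by rewrite /= ltnW //; split=> //; rewrite -val_eqE /= ltn_eqF.
have lt_qm : (q < m i)%N.
  by rewrite ltn_neqAle le_qm andbT; apply: contra nq => /eqP qm; apply/eqP/val_inj.
by exists (Ordinal lt_qm); apply: val_inj.
Qed.

(** The copy labelled i splits according to the value q of [last_pos], and the part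
(i, q) induces to a copy of the rook matrices with [ext_len (m i) q] columns. *)
Lemma IndRes_perm_basis (V : fmodule F (rook N)) (I : finType) (L : {set I})
    (m : I -> nat) b c :
  (forall i, i \in L -> (m i <= n)%N) ->
  is_perm_basis (V := V) (rook_index L m) (@rook_act I) b c ->
  exists b' c', is_perm_basis (V := IndRes V) (rook_index (ext_labels L m) (ext_lens m))
    (@rook_act _) b' c'.
Proof.
move=> le_mn basis.
pose theta (g : rook N) (x : I * rook N) : (I * 'I_N) * rook N :=
  ((x.1, last_pos (m x.1) x.2), (g * rook_extend (m x.1) x.2)%g).
pose sg (y : (I * 'I_N) * rook N) := transp (m y.1.1) y.1.2 y.2.
pose sx (y : (I * 'I_N) * rook N) : I * rook N := (y.1.1, gen_rook (m y.1.1) y.1.2).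
have res_basis : is_perm_basis (V := Res (rook_emb (n := n)) V) (rook_index L m)
    (fun a => rook_act (rook_emb a)) b c.
  by case: basis => actb ortho span; split=> // a x xD; apply: actb.
do 2!eexists.
apply: (ind_perm_basis (E := rook_index (ext_labels L m) (ext_lens m))
  (yact := @rook_act (I * 'I_N)%type) res_basis _ (theta := theta) (sg := sg) (sx := sx)).
- by move=> a x; rewrite !inE /= => /andP[-> Am]; apply: subset_trans (rook_domM _ _) Am.
- move=> g [i A]; rewrite inE /= => /andP[iL Am]; rewrite 2!inE /= iL last_pos_leq ?le_mn //=.
  by apply: rook_cols_mul; apply: rook_extend_cols; rewrite ?le_mn.
- move=> g a [i A]; rewrite inE /= => /andP[iL Am].
  by rewrite /theta /= last_pos_emb rook_extend_emb ?le_mn // mulgA.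
- by move=> g h [i A] _; rewrite /theta /rook_act /= mulgA.
- move=> [[i q] B]; rewrite 2!inE /= => /andP[/andP[iL le_q] Bm].
  by rewrite inE /= iL gen_rook_cols ?le_mn.
- move=> [[i q] B]; rewrite 2!inE /= => /andP[/andP[iL le_q] Bm].
  by rewrite /theta /= last_pos_gen ?transpK ?le_mn.
move=> g [i A]; rewrite inE /= => /andP[iL Am]; exists (body_rook (m i) A).
  by rewrite /rook_act /sx /=; congr pair; apply: body_gen; rewrite ?le_mn.
by rewrite /sg /=; apply: body_transp; rewrite ?le_mn.
Qed.

Definition iter_module k : fmodule F (rook N) :=
  iter k (@IndRes F n) (triv_module F (rook N)).

(** The labels follow the Stirling recursion of [sum_ext_labels]. *)
Lemma iter_perm_basis k : (k <= N)%N ->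
  exists (I : finType) (L : {set I}) (m : I -> nat) b c,
  [/\ is_perm_basis (V := iter_module k) (rook_index L m) (@rook_act I) b c,
      forall i, i \in L -> (m i <= k)%N
    & forall f : nat -> nat, (\sum_(i in L) f (m i) = stirsum k f)%N].
Proof.
elim: k => [|k IH] le_kN.
  exists unit, [set: unit], (fun=> 0%N), (fun=> 1 : F^o), (fun=> \1%VF).
  have E : rook_index [set: unit] (fun=> 0%N) = [set (tt, mk_rook (fun=> None))].
    apply/setP => -[[] A]; rewrite !inE /= xpair_eqE eqxx /=.
    have mkE : rook_map (@mk_rook N (fun=> None)) =1 (fun=> None) by apply: mk_rookE.
    apply/subsetP/eqP => [sub|-> p]; last by rewrite !inE mkE.
    apply: rook_ext => p; rewrite mkE; case Ap: (rook_map A p) => [i|//].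
    by have := sub p; rewrite !inE Ap => /(_ isT).
  split=> //; last by move=> f; apply: (big_pred1 tt) => -[]; rewrite inE.
  rewrite E; split=> [a x _|x y|v]; first by rewrite id_lfunE.
    by rewrite !inE => /eqP-> /eqP->; rewrite id_lfunE eqxx.
  by rewrite big_set1 id_lfunE /GRing.scale /= mulr1.
have [I [L [m [b [c [basis le_mk sumL]]]]]] := IH (ltnW le_kN).
have le_mn i : i \in L -> (m i <= n)%N.
  by move/le_mk => le_m; apply: leq_trans le_m _; move: le_kN; rewrite addn1.
have [b' [c' basis']] := IndRes_perm_basis le_mn basis.
exists (I * 'I_N)%type, (ext_labels L m), (ext_lens m), b', c'; split=> //.
  move=> [i q]; rewrite inE /ext_lens /ext_len /= => /andP[/le_mk le_m _].
  by case: ifP => // _; apply: leqW.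
move=> f; rewrite sum_ext_labels //.
exact: (sumL (fun l => f l.+1 + l * f l)%N).
Qed.

End IndResBasis.

(** * Symmetric groups inside the rook monoid *)
Section RookSym.
Variable N : nat.
Implicit Types (A B : rook N) (s t : {perm 'I_N}) (S : {set 'I_N}) (p q : 'I_N).

(** The inverse compensates the order of composition of permutations. *)
Definition perm_rook s : rook N := mk_rook (fun p => Some (s^-1 p)%g).

Lemma rook_map_perm s p : rook_map (perm_rook s) p = Some (s^-1 p)%g.
Proof. by rewrite mk_rookE // => x y i [<-] [] /perm_inj. Qed.

Lemma perm_rook1 : perm_rook 1 = 1%g.
Proof. by apply: rook_ext => p; rewrite rook_map_perm rook_map1 invg1 perm1. Qed.

Lemma perm_rookM s t : perm_rook (s * t) = (perm_rook s * perm_rook t)%g.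
Proof.
by apply: rook_ext => p; rewrite rook_mapM !rook_map_perm /= rook_map_perm invMg permM.
Qed.

Definition id_rook S : rook N := mk_rook (fun p => if p \in S then Some p else None).

Lemma rook_map_id S p : rook_map (id_rook S) p = if p \in S then Some p else None.
Proof. by rewrite mk_rookE // => x y i; do 2!case: ifP => // _; move=> [->] []. Qed.

Lemma dom_id S : rook_dom (id_rook S) = S.
Proof. by apply/setP => p; rewrite inE rook_map_id; case: ifP. Qed.

Lemma rook_mul_id A : (A * id_rook (rook_dom A))%g = A.
Proof.
apply: rook_ext => p; rewrite rook_mapM rook_map_id.
by case: ifPn => //; rewrite inE; case: (rook_map A p).
Qed.

Lemma sym_mem S s p : s \in Sym S -> (s p \in S) = (p \in S).
Proof. by rewrite inE => /perm_closed. Qed.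

Lemma symV S s : s \in Sym S -> s^-1%g \in Sym S.
Proof. by rewrite -[Sym S]/(gval (Sym_group S)) groupV. Qed.

Lemma dom_perm S A s : s \in Sym S -> rook_dom A = S -> rook_dom (A * perm_rook s)%g = S.
Proof.
move=> sS domA; apply/setP => p; rewrite inE rook_mapM rook_map_perm /=.
by rewrite -mem_dom domA sym_mem ?symV.
Qed.

Lemma id_rook_perm S s : s \in Sym S ->
  (perm_rook s * id_rook S)%g = (id_rook S * perm_rook s)%g.
Proof.
move=> sS; apply: rook_ext => p; rewrite !rook_mapM rook_map_perm /= !rook_map_id.
by rewrite sym_mem ?symV //; case: ifP => //= _; rewrite rook_map_perm.
Qed.

Lemma perm_rook_free S A s t : rook_dom A = S -> s \in Sym S -> t \in Sym S ->
  (A * perm_rook s)%g = (A * perm_rook t)%g -> s = t.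
Proof.
move=> domA sS tS eqA; apply: invg_inj; apply/permP => p.
have [pS|pS] := boolP (p \in S); last first.
  by have := symV sS; have := symV tS; rewrite !inE => /out_perm-> // /out_perm->.
have := congr1 (fun B => rook_map B p) eqA; rewrite !rook_mapM !rook_map_perm /=.
have : (s^-1)%g p \in S by rewrite sym_mem ?symV.
rewrite -domA inE; case As: (rook_map A _) => [i|//] _ /esym.
by move=> At; apply: rook_map_inj As At.
Qed.

(** C restricts to a permutation of S, because its image of S is dom A = S. *)
Lemma perm_rook_transitive S A B (C : rook N) : rook_dom A = S -> rook_dom B = S ->
  B = (A * C)%g -> exists2 s, s \in Sym S & B = (A * perm_rook s)%g.
Proof.
move=> domA domB BE.
pose f p := if p \in S then odflt p (rook_map C p) else p.
have CS p : p \in S -> exists2 q, rook_map C p = Some q & q \in S.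
  rewrite -{1}domB BE inE rook_mapM; case: (rook_map C p) => //= q Aq.
  by exists q; rewrite // -domA inE.
have fS p : (f p \in S) = (p \in S).
  by rewrite /f; case: ifPn => [/CS[q -> /=]|/negbTE].
have f_inj : injective f.
  move=> x y fxy; have := fS x; rewrite fxy fS => xyS; move: fxy; rewrite /f -xyS.
  case: ifP => // yS; have [u Cx _] := CS x (etrans (esym xyS) yS).
  have [v Cy _] := CS y yS; rewrite Cx Cy /= => uv; rewrite -uv in Cy.
  exact: rook_map_inj Cx Cy.
exists (perm f_inj)^-1%g.
  apply: symV; rewrite inE; apply/subsetP => p; rewrite inE permE /f.
  by case: ifP => //; rewrite eqxx.
apply: rook_ext => p; rewrite BE !rook_mapM rook_map_perm invgK permE /f /=.
case: ifPn => [/CS[q -> _] //|pS].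
have : rook_map B p = None by move: pS; rewrite -domB inE; case: (rook_map B p).
have -> : rook_map A p = None by move: pS; rewrite -domA inE; case: (rook_map A p).
by rewrite BE rook_mapM.
Qed.

Lemma rook_left_inverse A : exists h : rook N, (h * A)%g = id_rook (rook_dom A).
Proof.
pose f i := [pick p | rook_map A p == Some i].
have f_inj : partial_inj f.
  move=> x y p; rewrite /f; case: pickP => // q /eqP Aq [<-].
  by case: pickP => // q' /eqP Aq' [qq]; move: Aq; rewrite -qq Aq' => -[].
exists (mk_rook f); apply: rook_ext => p; rewrite rook_mapM rook_map_id inE.
case Ap: (rook_map A p) => [i|] //=; rewrite mk_rookE // /f.
case: pickP => [q /eqP Aq|/(_ p)]; last by rewrite Ap eqxx.
by congr Some; apply: rook_map_inj Aq Ap.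
Qed.

End RookSym.

(** * Composition factors of one layer *)
Section Layers.
Variables (C : numClosedFieldType) (n : nat).
Local Notation N := (n + 1)%N.
Variables (V : fmodule C (rook N)) (I : finType) (L : {set I}) (m : I -> nat).
Variables (b : I * rook N -> V) (c : I * rook N -> 'Hom(V, C^o)).
Hypothesis basis : is_perm_basis (rook_index n L m) (@rook_act n I) b c.
Local Notation D := (rook_index n L m).
Implicit Types (A B g : rook N) (s t : {perm 'I_N}) (S : {set 'I_N}) (v : V).
Implicit Types (P : {set I * {set 'I_N}}).

(** Acting by a rook matrix keeps the label and can only shrink the domain. *)
Definition stratum (y : I * rook N) : I * {set 'I_N} := (y.1, rook_dom y.2).

Definition outside P : {set I * rook N} := [set y in D | stratum y \notin P].
(** The span of the basis vectors whose stratum lies in P. *)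
Definition supported P : {vspace V} := (\bigcap_(y in outside P) lker (c y))%VS.

Lemma mem_supported P v :
  reflect (forall y, y \in D -> stratum y \notin P -> c y v = 0) (v \in supported P).
Proof.
rewrite memvE; apply: (iffP subv_bigcapP) => [sub y yD yP|vP y].
  by apply/eqP; rewrite -memv_ker memvE; apply: sub; rewrite inE yD.
by rewrite inE => /andP[yD yP]; rewrite -memvE memv_ker vP.
Qed.

Definition down_closed P := forall i S S',
  (i, S) \in P -> S' \subset S -> (i, S') \in P.

Lemma coord_act y g v : y \in D ->
  c y (act V g v) = \sum_(y' in D | rook_act g y' == y) c y' v.
Proof.
case: basis => actb ortho span yD; rewrite {1}[v]span !linear_sum /= big_mkcondr /=.
apply: eq_bigr => y' y'D; rewrite !linearZ /= actb // ortho // 1?eq_sym.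
  by case: eqP => _; rewrite ?scaler0 // /GRing.scale /= mulr1.
by move: y'D; rewrite !inE /= => /andP[-> sub]; apply: subset_trans (rook_domM _ _) sub.
Qed.

Lemma supported_submodule P : down_closed P -> is_submodule (supported P).
Proof.
move=> downP g; apply/subvP => _ /memv_imgP[v /mem_supported vP ->].
apply/mem_supported => y yD yP; rewrite coord_act // big1 // => y' /andP[y'D /eqP y'y].
apply: vP => //; apply: contra yP; rewrite -y'y /stratum /= => /downP; apply.
exact: rook_domM.
Qed.

Section Layer.
Variables (i0 : I) (S : {set 'I_N}) (P : {set I * {set 'I_N}}).
Hypothesis i0L : i0 \in L.
Hypothesis Sm : S \subset [set p : 'I_N | (p < m i0)%N].
Hypothesis downP : down_closed P.
Hypothesis SP : (i0, S) \notin P.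
Let P' := (i0, S) |: P.
Hypothesis downP' : down_closed P'.

Local Notation A_ := (galg C {perm 'I_N}).
Local Notation G := (Sym_group S).

Lemma dom_act A s : s \in G -> rook_dom A = S -> rook_dom (A * perm_rook s)%g = S.
Proof. exact: dom_perm. Qed.

Lemma layer_mem B : rook_dom B = S -> (i0, B) \in D.
Proof. by move=> domB; rewrite inE /= i0L inE domB. Qed.

(** The coordinates of v along the right Sym S-orbit of A, gathered as an element
of the group algebra of Sym S. *)
Definition layer_coord A v : A_ := [ffun s => if s \in G then c (i0, A * perm_rook s)%g v else 0].

Lemma layer_coord_is_linear A : linear (layer_coord A).
Proof.
move=> k u v; apply/ffunP => s; rewrite !ffunE; case: ifP => _; first by rewrite linearP.
by rewrite scaler0 addr0.
Qed.
HB.instance Definition _ A :=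
  GRing.isSemilinear.Build C V A_ _ (layer_coord A)
    (GRing.semilinear_linear (layer_coord_is_linear A)).

Lemma supp_psi A v : supp G (layer_coord A v).
Proof. by move=> s sG; rewrite ffunE (negbTE sG). Qed.

Lemma layer_coord1 A v : layer_coord A v 1%g = c (i0, A) v.
Proof. by rewrite ffunE group1 perm_rook1 mulg1. Qed.

Lemma layer_coord_shift A v s : s \in G ->
  layer_coord (A * perm_rook s)%g v = gelt C s^-1 * layer_coord A v.
Proof.
move=> sG; apply/ffunP => t; rewrite gelt_mulE invgK !ffunE groupMl //.
by case: ifP => // _; rewrite perm_rookM mulgA.
Qed.

(** Vectors supported on P stay there, so only the stratum (i0, S) contributes. *)
Lemma coord_act_layer B g v : v \in supported P' -> rook_dom B = S ->
  c (i0, B) (act V g v) = \sum_(A | (rook_dom A == S) && (g * A == B)%g) c (i0, A) v.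
Proof.
move=> /mem_supported vP' domB; rewrite coord_act ?layer_mem //.
rewrite (bigID (fun y : I * rook N => rook_dom y.2 == S)) /= [X in _ + X]big1 ?addr0.
  rewrite (reindex_onto (fun A => (i0, A)) snd) /=.
    apply: eq_bigl => A; rewrite eqxx andbT xpair_eqE eqxx /=.
    rewrite andbC; case: eqP => //= domA; rewrite layer_mem //.
  by move=> [i A] /= /andP[/andP[_ /eqP[-> _]] _].
move=> [i A] /= /andP[/andP[AD /eqP[iE gA]] domA]; apply: vP' => //.
rewrite /stratum /= in_setU1 iE xpair_eqE eqxx (negbTE domA) /=.
apply: contra SP => /downP; apply; rewrite -domB -gA; exact: rook_domM.
Qed.

Lemma coord_act_layer_eq A g v : v \in supported P' -> rook_dom A = S ->
  rook_dom (g * A)%g = S -> c (i0, g * A)%g (act V g v) = c (i0, A) v.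
Proof.
move=> vP' domA domgA; rewrite coord_act_layer // (big_pred1 A) // => B.
apply/andP/eqP => [[/eqP domB /eqP gBA]|->]; last by rewrite domA !eqxx.
apply: rook_ext => p; have := congr1 (fun B => rook_map B p) gBA; rewrite !rook_mapM.
have [pS|pS] := boolP (p \in S); last first.
  have : p \notin rook_dom A by rewrite domA.
  have : p \notin rook_dom B by rewrite domB.
  by rewrite !inE; case: (rook_map A p); case: (rook_map B p).
have := pS; rewrite -{1}domgA inE rook_mapM.
have := pS; rewrite -{1}domB inE; case Bp: (rook_map B p) => [j|] // _.
have := pS; rewrite -{1}domA inE; case Ap: (rook_map A p) => [j'|] //= _.
case gj': (rook_map g j') => [l|] // _ gj.
by congr Some; apply: rook_map_inj gj gj'.
Qed.

(** Left multiplication by rook matrices commutes with the right action of Sym S: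
it permutes the orbits of the layer or sends them to smaller strata. *)
Lemma layer_coord_act A g v : v \in supported P' -> rook_dom A = S ->
  rook_dom (g * A)%g = S -> layer_coord (g * A)%g (act V g v) = layer_coord A v.
Proof.
move=> vP' domA domgA; apply/ffunP => s; rewrite !ffunE; case: ifP => // sG.
have gAs : rook_dom (g * (A * perm_rook s))%g = S by rewrite mulgA dom_act.
by rewrite -mulgA coord_act_layer_eq // dom_act.
Qed.

Lemma layer_coord_act0 B g v : v \in supported P' -> rook_dom B = S ->
  (forall A, rook_dom A = S -> (g * A)%g <> B) -> layer_coord B (act V g v) = 0.
Proof.
move=> vP' domB none; apply/ffunP => s; rewrite !ffunE; case: ifP => // sG.
rewrite coord_act_layer ?dom_act // big1 // => A /andP[/eqP domA /eqP gA].
case: (none (A * perm_rook s^-1)%g); first by rewrite dom_act ?groupV.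
by rewrite mulgA gA -mulgA -perm_rookM mulgV perm_rook1 mulg1.
Qed.

Definition layer_coord_mul A (e : A_) v : A_ := layer_coord A v * e.
Lemma layer_coord_mul_is_linear A e : linear (layer_coord_mul A e).
Proof. by move=> k u v; rewrite /layer_coord_mul linearP mulrDl galgZl. Qed.
HB.instance Definition _ A e :=
  GRing.isSemilinear.Build C V A_ _ (layer_coord_mul A e)
    (GRing.semilinear_linear (layer_coord_mul_is_linear A e)).

Definition layer_dom : {set rook N} := [set A | rook_dom A == S].

(** The vectors of the layer killed by es under right multiplication, together
with the smaller strata. *)
Fixpoint layer_cut (es : seq A_) : {vspace V} :=
  if es is e :: es' then
    (layer_cut es' :&: \bigcap_(A in layer_dom) lker (linfun (layer_coord_mul A e)))%VS
  else supported P'.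

Lemma mem_layer_cut es v : v \in layer_cut es <->
  v \in supported P' /\ forall A e, rook_dom A = S -> e \in es -> layer_coord A v * e = 0.
Proof.
elim: es => [|e es IH] /=; first by split=> [|[]] //; split.
rewrite memv_cap; split=> [/andP[/IH[vP' ves] ve]|[vP' ves]].
  split=> // A f domA; rewrite inE => /predU1P[->|]; last exact: ves.
  move: ve; rewrite memvE => /subv_bigcapP/(_ A); rewrite inE domA eqxx => /(_ isT).
  by rewrite -memvE memv_ker lfunE => /eqP.
apply/andP; split.
  by apply/IH; split=> // A f domA fes; apply: ves; rewrite // inE fes orbT.
rewrite memvE; apply/subv_bigcapP => A; rewrite inE => /eqP domA.
by rewrite -memvE memv_ker lfunE; apply/eqP; apply: ves; rewrite ?mem_head.
Qed.

Lemma layer_cut_supported es v : v \in layer_cut es -> v \in supported P'.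
Proof. by case/mem_layer_cut. Qed.

Lemma layer_cut_submodule es : is_submodule (layer_cut es).
Proof.
move=> g; apply/subvP => _ /memv_imgP[v /mem_layer_cut[vP' ves] ->].
apply/mem_layer_cut; split.
  by apply: subvP (supported_submodule downP' g) _ _; apply: memv_img.
move=> B e domB ees.
have [[A domA gA]|none] := pselect (exists2 A, rook_dom A = S & (g * A)%g = B).
  by rewrite -gA layer_coord_act ?gA // ves.
by rewrite layer_coord_act0 ?mul0r // => A domA gA; apply: none; exists A.
Qed.

(** The basis vector of A multiplied on the right by x. *)
Definition layer_vec A (x : A_) : V := \sum_(s in G) x s *: b (i0, A * perm_rook s)%g.

Lemma coord_vec y A x : y \in D -> rook_dom A = S ->
  c y (layer_vec A x) = \sum_(s in G | y == (i0, A * perm_rook s)%g) x s.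
Proof.
case: basis => _ ortho _ yD domA; rewrite linear_sum big_mkcondr; apply: eq_bigr => s sG /=.
rewrite linearZ /= ortho ?layer_mem ?dom_act //.
by case: eqP => _; rewrite ?scaler0 // /GRing.scale /= mulr1.
Qed.

Lemma layer_vec_supported A x : rook_dom A = S -> layer_vec A x \in supported P'.
Proof.
move=> domA; apply/mem_supported => y yD yP'; rewrite coord_vec // big1 // => s /andP[sG /eqP yE].
by case/negP: yP'; rewrite yE /stratum /= dom_act // in_setU1 eqxx.
Qed.

Lemma layer_coord_vec A x : supp G x -> rook_dom A = S -> layer_coord A (layer_vec A x) = x.
Proof.
move=> sx domA; apply/ffunP => s; rewrite ffunE; case: ifPn => [sG|/sx-> //].
rewrite coord_vec ?layer_mem ?dom_act // (big_pred1 s) // => t /=.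
rewrite xpair_eqE eqxx /=; apply/andP/eqP => [[tG /eqP]|->]; last by rewrite sG eqxx.
by move=> eqA; rewrite (perm_rook_free domA _ _ eqA).
Qed.

Lemma layer_coord_vec_shift A x s : supp G x -> rook_dom A = S -> s \in G ->
  layer_coord (A * perm_rook s)%g (layer_vec A x) = gelt C s^-1 * x.
Proof. by move=> sx domA sG; rewrite layer_coord_shift // layer_coord_vec. Qed.

Lemma layer_coord_vec0 A B x : rook_dom A = S -> rook_dom B = S ->
  (forall s, s \in G -> B <> (A * perm_rook s)%g) -> layer_coord B (layer_vec A x) = 0.
Proof.
move=> domA domB none; apply/ffunP => t; rewrite !ffunE; case: ifP => // tG.
rewrite coord_vec ?layer_mem ?dom_act // big1 // => s /andP[sG].
rewrite xpair_eqE eqxx => /eqP BtAs; case: (none (s * t^-1)%g); first by rewrite groupM ?groupV.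
by rewrite perm_rookM mulgA -BtAs -mulgA -perm_rookM mulgV perm_rook1 mulg1.
Qed.

(** Right multiplication by e on the layer.  It is not a morphism of modules, only
modulo the smaller strata, which is why [layer_cut] is defined by coordinates. *)
Definition layer_right (e : A_) v : V :=
  \sum_(A | rook_dom A == S) c (i0, A) v *: layer_vec A e.

Lemma layer_coord_right e B v : supp G e -> rook_dom B = S ->
  layer_coord B (layer_right e v) = layer_coord B v * e.
Proof.
move=> se; have H1 A : rook_dom A = S -> c (i0, A) (layer_right e v) = (layer_coord A v * e) 1%g.
  move=> domA; rewrite linear_sum galg_mulE.
  transitivity (\sum_(B' | rook_dom B' == S) \sum_(s in G | A == (B' * perm_rook s)%g)
      c (i0, B') v *: (e s : C^o)).
    apply: eq_bigr => B' /eqP domB' /=; rewrite linearZ /= coord_vec ?layer_mem //.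
    rewrite scaler_sumr; apply: eq_bigl => s; by rewrite xpair_eqE eqxx.
  rewrite (exchange_big_dep (mem G)) /=; last by move=> ? ? _ /andP[].
  rewrite [RHS](bigID (mem G)) /= [X in _ = _ + X]big1 ?addr0; last first.
    by move=> s /(supp_psi A v) ->; rewrite mul0r.
  rewrite [RHS](reindex_inj invg_inj) /=; apply: eq_big => s; first by rewrite groupV.
  move=> sG; rewrite invgK mulg1 (big_pred1 (A * perm_rook s^-1)%g) => [|B' /=].
    by rewrite ffunE groupV sG.
  apply/andP/eqP => [[_ /andP[_ /eqP ->]]|->].
    by rewrite -mulgA -perm_rookM mulgV perm_rook1 mulg1.
  by rewrite dom_act ?groupV // -mulgA -perm_rookM mulVg perm_rook1 mulg1 sG !eqxx.
move=> domB; apply/ffunP => t; rewrite ffunE.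
case: ifPn => [tG|tG].
  by rewrite H1 ?dom_act // layer_coord_shift // -mulrA gelt_mulE invgK mulg1.
by rewrite (suppM (supp_psi B v) se tG).
Qed.

Lemma layer_right_supported e v : layer_right e v \in supported P'.
Proof. by apply: rpred_sum => A /eqP domA; apply/rpredZ/layer_vec_supported. Qed.

(** If x survives multiplication by e at A0, some y in the group algebra takes
[layer_coord A0 x * e] to e, by minimality of e.  Let h be a left inverse of
A0; transporting by h, acting with y and moving to A yields a vector of X that
differs from [layer_vec A e] by an element of the smaller submodule. *)
Lemma layer_vec_generated (X : {vspace V}) e es x A0 : is_submodule X ->
  selfadj_idem G e -> minimal_idem G e -> (forall f, f \in es -> e * f = 0) ->
  (layer_cut (e :: es) <= X)%VS -> x \in X -> x \in layer_cut es ->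
  rook_dom A0 = S -> layer_coord A0 x * e != 0 ->
  forall A, rook_dom A = S -> layer_vec A e \in X.
Proof.
move=> subX e_idem e_min orth leX xX xes domA0 xe0 A domA.
have [se ee _ _ _] := e_idem; have xP' := layer_cut_supported xes.
have [|||y sy yE] := minimal_generates e_idem e_min (x := layer_coord A0 x * e) => //.
- by apply: suppM => //; apply: supp_psi.
- by rewrite -mulrA ee.
have [h hA0] := rook_left_inverse A0; rewrite domA0 in hA0.
pose g t := (A * perm_rook t * h)%g.
pose z := \sum_(t in G) y t *: act V (g t) x.
have zX : z \in X.
  apply: rpred_sum => t _; apply: rpredZ; apply: subvP (subX (g t)) _ _.
  exact: memv_img.
have zes : z \in layer_cut es.
  apply: rpred_sum => t _; apply: rpredZ; apply: subvP (layer_cut_submodule es (g t)) _ _.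
  exact: memv_img.
suff : z - layer_vec A e \in X by rewrite rpredBl.
apply: (subvP leX); apply/mem_layer_cut; split.
  by rewrite rpredB ?layer_vec_supported //; apply: layer_cut_supported zes.
have A_id : (A * id_rook S)%g = A by rewrite -{1}domA rook_mul_id.
move=> B f domB; rewrite linearB /= mulrBl inE.
have [[r rG BE]|none] := pselect (exists2 r, r \in G & B = (A * perm_rook r)%g).
  have layer_coord_z : layer_coord B z = gelt C r^-1 * y * layer_coord A0 x.
    rewrite linear_sum [in RHS](galg_sum_supp sy) mulr_sumr mulr_suml.
    apply: eq_bigr => t tG; rewrite linearZ /= galgZr galgZl; congr (_ *: _).
    have gB : (g t * (A0 * perm_rook (t^-1 * r)))%g = B.
      rewrite /g -!mulgA [(h * _)%g]mulgA hA0 -id_rook_perm ?groupM ?groupV //.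
      rewrite [(perm_rook t * _)%g]mulgA -perm_rookM mulKVg.
      by rewrite id_rook_perm // mulgA A_id.
    have domA0s : rook_dom (A0 * perm_rook (t^-1 * r))%g = S.
      by rewrite dom_act // groupM ?groupV.
    rewrite -gB layer_coord_act // ?gB // layer_coord_shift ?groupM ?groupV //.
    by rewrite invMg invgK geltM.
  rewrite layer_coord_z BE layer_coord_vec_shift // => /predU1P[->|fes].
    by rewrite -!mulrA yE ee subrr.
  rewrite -layer_coord_z; have [_ /(_ B f domB fes) ->] := (mem_layer_cut es z).1 zes.
  by rewrite -mulrA orth // mulr0 subrr.
rewrite layer_coord_vec0 // ?mul0r; last by move=> s sG BE; apply: none; exists s.
suff -> : layer_coord B z = 0 by rewrite mul0r subrr.
rewrite linear_sum big1 // => t tG; rewrite linearZ /= layer_coord_act0 ?scaler0 //.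
move=> B' domB' gB'; apply: none; apply: (perm_rook_transitive domA domB).
by rewrite -gB' /g -!mulgA.
Qed.

(** Any X strictly above the smaller cut contains all [layer_vec A e], and each v
is v * e modulo the smaller cut. *)
Lemma layer_cut_step e es : selfadj_idem G e -> minimal_idem G e ->
  (forall f, f \in es -> e * f = 0) ->
  is_maximal_submodule (layer_cut (e :: es)) (layer_cut es).
Proof.
move=> e_idem e_min orth; have [se ee _ _ e0] := e_idem.
split; try exact: layer_cut_submodule; first exact: capvSl.
- apply/eqP => eq_cut.
  have : layer_vec (id_rook S) e \in layer_cut es.
    apply/mem_layer_cut; split; first by apply: layer_vec_supported; apply: dom_id.
    move=> B f domB fes.
    have [[r rG ->]|none] := pselect (exists2 r, r \in G & B = (id_rook S * perm_rook r)%g).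
      by rewrite layer_coord_vec_shift ?dom_id // -mulrA orth // mulr0.
    rewrite layer_coord_vec0 ?mul0r ?dom_id // => s sG BE; apply: none; by exists s.
  rewrite -eq_cut => /mem_layer_cut[_ /(_ (id_rook S) e (dom_id S) (mem_head _ _))].
  by rewrite layer_coord_vec ?dom_id // ee => /eqP; rewrite (negbTE e0).
move=> X subX leX Xle.
have [XE|nX] := pselect (X = layer_cut (e :: es)); first by left.
right; apply/eqP; rewrite eqEsubv Xle /=.
have [x [xX [A0 domA0 xe0]]] : exists x, x \in X /\
    exists2 A0, rook_dom A0 = S & layer_coord A0 x * e != 0.
  apply: contra_notP nX => none; apply/eqP; rewrite eqEsubv leX andbT.
  apply/subvP => x xX; apply/mem_layer_cut; have /mem_layer_cut[xP' xes] := subvP Xle _ xX.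
  split=> // A f domA; rewrite inE => /predU1P[->|]; last exact: xes.
  apply/eqP; apply: contra_notT none => xe; exists x; split=> //; by exists A.
have betaX := layer_vec_generated subX e_idem e_min orth leX xX (subvP Xle _ xX) domA0 xe0.
apply/subvP => v ves; rewrite -(subrK (layer_right e v) v) rpredD //; last first.
  by apply: rpred_sum => A /eqP domA; apply/rpredZ/betaX.
apply: (subvP leX); apply/mem_layer_cut; split.
  by rewrite rpredB ?layer_right_supported //; apply: layer_cut_supported ves.
move=> A f domA; rewrite linearB /= layer_coord_right // mulrBl -mulrA inE => /predU1P[->|fes].
  by rewrite ee subrr.
have [_ /(_ A f domA fes) ->] := (mem_layer_cut es v).1 ves.
by rewrite orth // mulr0 subrr.
Qed.

Lemma layer_cut_all es : \sum_(e <- es) e = 1 -> layer_cut es = supported P.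
Proof.
move=> sum1; apply/eqP; rewrite eqEsubv; apply/andP; split; apply/subvP => v.
  case/mem_layer_cut => /mem_supported vP' ves; apply/mem_supported => -[i A] yD yP.
  have [/eqP[iE domA]|nE] := boolP (stratum (i, A) == (i0, S)); last first.
    by apply: vP' => //; rewrite in_setU1 negb_or nE.
  rewrite iE -layer_coord1 -[layer_coord A v]mulr1 -sum1 mulr_sumr big_seq big1 ?ffunE // => e.
  exact: ves.
move=> /mem_supported vP; apply/mem_layer_cut; split.
  by apply/mem_supported => y yD; rewrite in_setU1 negb_or => /andP[_]; apply: vP.
move=> A e domA _; suff -> : layer_coord A v = 0 by rewrite mul0r.
apply/ffunP => s; rewrite !ffunE; case: ifP => // sG; apply: vP.
  by rewrite layer_mem ?dom_act.
by rewrite /stratum /= dom_act.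
Qed.

End Layer.
End Layers.

Local Close Scope ring_scope.

(** * Length *)
Section Chains.
Variables (F : fieldType) (M : monoidType) (V : fmodule F M).
Implicit Types (U W X : {vspace V}).

Definition composition_chain l U W := exists u : nat -> {vspace V},
  [/\ u 0 = U, u l = W & forall i, i < l -> is_maximal_submodule (u i) (u i.+1)].

Lemma chain_nil U : composition_chain 0 U U.
Proof. by exists (fun=> U). Qed.

Lemma chain_step U W : is_maximal_submodule U W -> composition_chain 1 U W.
Proof. by move=> UW; exists (fun i => if i is 0 then U else W); split=> // -[]. Qed.

Lemma chain_cat k l U W X :
  composition_chain k U W -> composition_chain l W X -> composition_chain (k + l) U X.
Proof.
move=> [u [u0 uk u_max]] [w [w0 wl w_max]].
exists (fun i => if i <= k then u i else w (i - k)); split=> [//||i lt_i].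
  case: leqP => [le_k|_]; last by rewrite addKn.
  have l0 : l = 0 by lia.
  by rewrite l0 addn0 uk -w0 -wl l0.
have [lt_ik|le_ki] := ltnP i k; first by rewrite ltnW //; apply: u_max.
have [le_ik|lt_ki] := leqP i k.
  have -> : i = k by apply/eqP; rewrite eqn_leq le_ik.
  rewrite uk -w0 subSn // subnn; apply: w_max; lia.
by rewrite subSn //; apply: w_max; lia.
Qed.

End Chains.

Section Filtration.
Variables (C : numClosedFieldType) (n : nat).
Local Notation N := (n + 1).
Variables (V : fmodule C (rook N)) (I : finType) (L : {set I}) (m : I -> nat).
Variables (b : I * rook N -> V) (c : I * rook N -> 'Hom(V, C^o)).
Hypothesis basis : is_perm_basis (rook_index n L m) (@rook_act n I) b c.
Implicit Types (P : {set I * {set 'I_N}}) (S : {set 'I_N}).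

Definition first_ords k : {set 'I_N} := [set p : 'I_N | p < k].

Section Layer.
Variables (i0 : I) (S : {set 'I_N}) (P : {set I * {set 'I_N}}).
Hypothesis i0L : i0 \in L.
Hypothesis Sm : S \subset first_ords (m i0).
Hypothesis downP : down_closed P.
Hypothesis SP : (i0, S) \notin P.
Hypothesis downP' : down_closed ((i0, S) |: P).

Lemma layer_cut_chain (es : seq (galg C {perm 'I_N})) : uniq es ->
  (forall e, e \in es -> selfadj_idem (Sym_group S) e) ->
  (forall e, e \in es -> minimal_idem (Sym_group S) e) ->
  (forall e f, e \in es -> f \in es -> e != f -> (e * f = 0)%R) ->
  composition_chain (size es) (layer_cut L m c i0 S P es) (layer_cut L m c i0 S P [::]).
Proof.
elim: es => [|e es IH] /=; first by move=> *; apply: chain_nil.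
move=> /andP[e_es ues] idem min orth; rewrite -[(size es).+1]add1n; apply: chain_cat.
  apply: chain_step; apply: (layer_cut_step basis) => //.
  - exact: idem (mem_head _ _).
  - exact: min (mem_head _ _).
  move=> f fes; apply: orth; rewrite ?mem_head ?inE ?fes ?orbT //.
  by apply: contraNneq e_es => ->.
apply: IH => // [f fes|f fes|f f' fes f'es].
- by apply: idem; rewrite inE fes orbT.
- by apply: min; rewrite inE fes orbT.
- by apply: orth; rewrite inE ?fes ?f'es orbT.
Qed.

Lemma layer_chain : composition_chain (syt_total #|S|)
  (supported L m c P) (supported L m c ((i0, S) |: P)).
Proof.
have [es [ues idem min _ orth sum1] <-] := sym_orth_decomp C S.
by rewrite -(layer_cut_all c i0L Sm SP sum1); apply: layer_cut_chain.
Qed.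

End Layer.

Definition strata : {set I * {set 'I_N}} :=
  [set x : I * {set 'I_N} | (x.1 \in L) && (x.2 \subset first_ords (m x.1))].

(** A missing stratum with the smallest domain can always be added, as all the
strata below it are already present. *)
Lemma strata_chain P : down_closed P -> P \subset strata ->
  composition_chain (\sum_(x in strata :\: P) syt_total #|x.2|)
    (supported L m c P) (supported L m c strata).
Proof.
have [k] := ubnP #|strata :\: P|; elim: k P => // k IH P le_k downP subP.
have [eq0|[x0 x0P]] := set_0Vmem (strata :\: P).
  rewrite eq0 big_set0; suff -> : P = strata by apply: chain_nil.
  by apply/eqP; rewrite eqEsubset subP -setD_eq0 eq0 eqxx.
have [[i0 S] SP minS] := @arg_minnP _ x0 (fun x => x \in strata :\: P) (fun x => #|x.2|) x0P.
have := SP; rewrite !inE /= => /and3P[nSP i0L Sm].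
have downP' : down_closed ((i0, S) |: P).
  move=> i S' S''; rewrite !in_setU1 => /predU1P[[-> ->]|S'P] subS; last first.
    by rewrite (downP _ _ _ S'P subS) orbT.
  have [->|neS] := eqVneq S'' S; first by rewrite eqxx.
  apply/orP; right; apply: contraT => nP.
  have /minS : (i0, S'') \in strata :\: P.
    by rewrite !inE /= nP i0L (subset_trans subS).
  by rewrite /= leqNgt proper_card // properEneq neS.
have -> : \sum_(x in strata :\: P) syt_total #|x.2| =
    syt_total #|S| + \sum_(x in strata :\: ((i0, S) |: P)) syt_total #|x.2|.
  rewrite (big_setD1 (i0, S)) //=; congr (_ + _).
  by apply: eq_bigl => x; rewrite !inE negb_or -!andbA; do !bool_congr.
apply: chain_cat (layer_chain i0L Sm downP nSP downP') _; apply: IH => //.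
  apply: leq_trans (_ : _ < #|strata :\: P|) le_k.
  rewrite (cardsD1 (i0, S) (strata :\: P)) SP add1n ltnS subset_leq_card //.
  by apply/subsetP => x; rewrite !inE negb_or -!andbA => /and4P[-> -> -> ->].
by apply/subsetP => x /setU1P[->|/(subsetP subP)//]; rewrite inE i0L.
Qed.

Lemma perm_module_length : has_length V (\sum_(x in strata) syt_total #|x.2|).
Proof.
have down0 : down_closed (set0 : {set I * {set 'I_N}}) by move=> ? ? ?; rewrite inE.
have := strata_chain down0 (sub0set _); rewrite setD0.
have -> : supported L m c set0 = 0%VS.
  apply/eqP; rewrite -subv0; apply/subvP => v /mem_supported v0.
  have [_ _ span] := basis; rewrite memv0 (span v) big1 // => y yD.
  by rewrite (v0 y yD) ?scale0r // inE.
suff -> : supported L m c strata = fullv by [].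
apply/eqP; rewrite eqEsubv subvf; apply/subvP => v _; apply/mem_supported => y yD.
by move: yD; rewrite !inE /= => /andP[-> ->].
Qed.

End Filtration.

(** * Dimension *)
Section Counting.
Variable n : nat.
Local Notation N := (n + 1).

Lemma sum_subsets (T : finType) (X : {set T}) k (f : nat -> nat) : #|X| <= k ->
  \sum_(S : {set T} | S \subset X) f #|S| = \sum_(j < k.+1) 'C(#|X|, j) * f j.
Proof.
move=> le_k.
rewrite (partition_big (fun S : {set T} => inord #|S| : 'I_k.+1) xpredT) //=.
apply: eq_bigr => j _; rewrite -cards_draws -sum_nat_const; apply: eq_big => S.
  rewrite inE; case: (boolP (S \subset X)) => //= sub; rewrite -val_eqE /= inordK //.
  by rewrite ltnS (leq_trans (subset_leq_card sub)).
by case/andP => sub /eqP <-; rewrite inordK // ltnS (leq_trans (subset_leq_card sub)).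
Qed.

Lemma card_first_ords k : k <= N -> #|first_ords n k| = k.
Proof.
move=> le_k; have inj : injective (widen_ord le_k) by move=> x y /(congr1 val) /= /val_inj.
rewrite -[RHS]card_ord -(card_codom inj); apply: eq_card => p.
rewrite inE; apply/idP/codomP => [lt_p|[x ->]]; last by rewrite /=.
by exists (Ordinal lt_p); apply: val_inj.
Qed.

Lemma card_rook_dom (S : {set 'I_N}) :
  #|[set A : rook N | rook_dom A == S]| = N ^_ #|S|.
Proof.
pose Phi (A : rook N) : {ffun {p | p \in S} -> 'I_N} :=
  [ffun p => odflt (rook_last n) (rook_map A (val p))].
have domP (A : rook N) p : rook_dom A = S -> p \in S ->
    rook_map A p = Some (odflt (rook_last n) (rook_map A p)).
  by move=> <-; rewrite inE; case: (rook_map A p).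
rewrite -(@card_in_imset _ _ Phi) => [|A B]; last first.
  rewrite !inE => /eqP domA /eqP domB eqAB; apply: rook_ext => p.
  have [pS|pS] := boolP (p \in S); last first.
    have : p \notin rook_dom A by rewrite domA.
    have : p \notin rook_dom B by rewrite domB.
    by rewrite !inE; case: (rook_map A p); case: (rook_map B p).
  have /ffunP/(_ (exist _ p pS)) := eqAB; rewrite !ffunE /= => eqp.
  by rewrite (domP A) // (domP B) // eqp.
have -> : N ^_ #|S| = #|[set f : {ffun {p | p \in S} -> 'I_N} | injectiveb f]|.
  by rewrite card_inj_ffuns card_sig card_ord.
apply: eq_card => f.
rewrite [RHS]inE; apply/imsetP/injectiveP => [[A]|f_inj].
  rewrite inE => /eqP domA -> x y; rewrite !ffunE => eqxy; apply: val_inj.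
  apply: (@rook_map_inj N A) (domP A _ domA (valP x)) _.
  by rewrite eqxy; apply: domP domA (valP y).
pose g p := omap f (insub p : option {p | p \in S}).
have g_inj : partial_inj g.
  move=> x y i; rewrite /g; case: insubP => //= u _ <- [<-].
  by case: insubP => //= v _ <- [/f_inj ->].
exists (mk_rook g).
  rewrite inE; apply/eqP/setP => p; rewrite inE mk_rookE // /g.
  by case: insubP => [u -> //|/negbTE ->].
by apply/ffunP => x; rewrite ffunE mk_rookE // /g valK.
Qed.

Lemma card_rook_cols k l : k <= N -> k <= l ->
  #|rook_cols n k| = \sum_(j < l.+1) 'C(k, j) * N ^_ j.
Proof.
move=> le_k le_kl; transitivity (\sum_(S : {set 'I_N} | S \subset first_ords n k) N ^_ #|S|).
  rewrite -sum1_card (partition_big (@rook_dom N) (fun S => S \subset first_ords n k)) /=.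
    apply: eq_bigr => S Sk; rewrite -card_rook_dom -sum1_card; apply: eq_bigl => A.
    by rewrite !inE; case: eqP => [->|]; rewrite ?andbF // Sk.
  by move=> A; rewrite inE.
by rewrite (@sum_subsets _ _ l (fun j => N ^_ j)) card_first_ords.
Qed.

End Counting.

(** * Summation over all partitions *)
Section PartitionSums.

Lemma lazy_dn_pow_size m j mu : part_size mu = j -> lazy_dn_pow m mu = 'C(m, j) * syt_count j mu.
Proof.
move=> smu; rewrite lazy_dn_pow_binomial; have [lt_jm|le_mj] := ltnP j m.+1.
  rewrite (bigD1 (Ordinal lt_jm)) //= big1 ?addn0 // => i nij.
  have [->|/syt_count_support] := eqVneq (syt_count i mu) 0; first by rewrite muln0.
  by rewrite smu => ji; case/eqP: nij; apply: val_inj.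
rewrite bin_small // big1 // => i _.
have [->|/syt_count_support] := eqVneq (syt_count i mu) 0; first by rewrite muln0.
by rewrite smu => ji; have := ltn_ord i; rewrite -ji ltnNge le_mj.
Qed.

Lemma eq_stirsum_leq k F G : (forall m, m <= k -> F m = G m) -> stirsum k F = stirsum k G.
Proof.
elim: k F G => [|k IH] F G eqFG /=; first exact: eqFG.
by apply: IH => m le_mk; rewrite !eqFG // ltnW.
Qed.

Lemma stirsum0 k : stirsum k (fun=> 0) = 0.
Proof.
by elim: k => //= k IH; rewrite -[RHS]IH; apply: eq_stirsum => m; rewrite muln0.
Qed.

Lemma svt_count_eq0 k mu : k < part_size mu -> svt_count k mu = 0.
Proof.
move=> lt_k; rewrite svt_count_stirsum -[RHS](stirsum0 k); apply: eq_stirsum_leq => m le_mk.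
by rewrite (lazy_dn_pow_size m erefl) bin_small // (leq_ltn_trans le_mk).
Qed.

Definition small_partitions k := flatten [seq partitions j | j <- iota 0 k.+1].

Lemma mem_small_partitions k mu : (mu \in small_partitions k) = (part_size mu <= k).
Proof.
apply/flatten_mapP/idP => [[j]|le_k]; last first.
  by exists (part_size mu); rewrite ?mem_partitions // mem_iota.
by rewrite mem_iota mem_partitions => lt_j /eqP->.
Qed.

Lemma uniq_small_partitions k : uniq (small_partitions k).
Proof.
apply: uniq_flatten_map (iota_uniq _ _) _ _ => [j _|i j mu _ _].
  exact: partitions_uniq.
by rewrite !mem_partitions => /eqP-> /eqP.
Qed.

Lemma sum_svt_count k (h : intpart -> nat) :
  \big[addn/0]_(mu \in [set: intpart]%classic) (svt_count k mu * h mu) =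
  stirsum k (fun m => \sum_(j < k.+1) 'C(m, j) * \sum_(mu <- partitions j) syt_count j mu * h mu).
Proof.
rewrite (fsbigE (small_partitions k)) ?uniq_small_partitions //; last first.
  by move=> mu _; rewrite mem_small_partitions -ltnNge => /svt_count_eq0->.
rewrite (eq_bigl xpredT) => [|mu]; last by apply/mem_set.
transitivity (stirsum k (fun m => \sum_(mu <- small_partitions k) lazy_dn_pow m mu * h mu)).
  by rewrite stirsum_sum; apply: eq_bigr => mu _; rewrite stirsumZ svt_count_stirsum.
apply: eq_stirsum => m; rewrite big_flatten big_map.
rewrite -[iota 0 k.+1]/(index_iota 0 k.+1) big_mkord; apply: eq_bigr => j _.
rewrite big_distrr; apply: eq_big_seq => mu; rewrite mem_partitions => /eqP smu.
by rewrite (lazy_dn_pow_size m smu) -mulnA.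
Qed.

End PartitionSums.

Theorem lemma5p1 (R : realType) (n k : nat) (hk : 1 <= k) (hkn : k <= n + 1) :
  let M := iter k (@IndRes R[i] n) (triv_module R[i] (rook (n + 1))) in
  [/\ has_length M (\big[addn/0]_(mu \in [set: intpart]%classic) num_svt k mu),
      fmod_dim M = \big[addn/0]_(mu \in [set: intpart]%classic)
        (num_svt k mu * num_syt mu * 'C(n + 1, part_size mu)) &
      forall mu : intpart, k < part_size mu -> num_svt k mu = 0].
Proof.
move=> M; have [I [L [m [b [c [basis le_mk sumL]]]]]] := @iter_perm_basis R[i] n k hkn.
have le_mN i : i \in L -> m i <= n + 1 by move/le_mk/leq_trans; apply.
split=> [||mu lt_k]; last by rewrite num_svtE svt_count_eq0.
- have -> : \big[addn/0]_(mu \in [set: intpart]%classic) num_svt k mu =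
            \sum_(x in strata n L m) syt_total #|x.2|.
    transitivity (\big[addn/0]_(mu \in [set: intpart]%classic) (svt_count k mu * 1)).
      by apply: eq_fsbigr => mu _; rewrite num_svtE muln1.
    rewrite sum_svt_count -sumL.
    transitivity (\sum_(i in L) \sum_(S : {set 'I_(n + 1)} | S \subset first_ords n (m i))
                    syt_total #|S|); last first.
      by rewrite pair_big_dep; apply: eq_bigl => x; rewrite inE.
    apply: eq_bigr => i iL; rewrite (@sum_subsets _ _ k syt_total) card_first_ords ?le_mN ?le_mk //.
    by apply: eq_bigr => j _; congr (_ * _); apply: eq_bigr => mu _; rewrite muln1.
  exact: perm_module_length basis.
rewrite (perm_basis_dim basis).
transitivity (\big[addn/0]_(mu \in [set: intpart]%classic)
    (svt_count k mu * (num_syt mu * 'C(n + 1, part_size mu)))); last first.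
  by apply: eq_fsbigr => mu _; rewrite num_svtE mulnA.
rewrite sum_svt_count -sumL.
transitivity (\sum_(i in L) #|rook_cols n (m i)|).
  transitivity (\sum_(i in L) \sum_(A in rook_cols n (m i)) 1); last first.
    by apply: eq_bigr => i _; rewrite sum1_card.
  by rewrite pair_big_dep -sum1_card; apply: eq_bigl => x; rewrite inE.
apply: eq_bigr => i iL; rewrite (card_rook_cols (le_mN i iL) (le_mk i iL)).
apply: eq_bigr => j _; congr (_ * _); rewrite -bin_ffact mulnC -sum_syt_count_sqr big_distrl /=.
apply: eq_big_seq => mu; rewrite mem_partitions => /eqP smu.
by rewrite num_sytE smu mulnA.
Qed.
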